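(* Let $D:\mathbb R^2\setminus\{0\}\to\mathbb R$ be nonnegative and continuously differentiable, and assume that $D$ is bounded and that $\lim_{x\to 0}\sqrt{|x|}\,\nabla D(x)=0$. Consider the damped Kepler system $$\ddot x+D(x)\dot x=-\frac{x}{|x|^3},\qquad x\in\mathbb R^2\setminus\{0\}.$$ Fix a flight time $T>0$ and points $A,B\in\mathbb R^2\setminus\{0\}$. Then: (a) If $A$ and $B$ lie on the same ray starting at the origin, then there exists a unique rectilinear arc from $A$ to $B$ with flight time $T$. (b) If $A$ and $B$ do not lie on the same ray starting at the origin, then there exists at least one arc from $A$ to $B$ with flight time $T$ rotating clockwise, and at least one arc from $A$ to $B$ with flight time $T$ rotating counterclockwise.
   Context: Solutions are classical: twice continuously differentiable and never passing through $0$. For a solution $x$, its angular momentum $c(t)=\det(x(t),\dot x(t))$ has constant sign; the solution is called rectilinear (living in a ray) if $c\equiv 0$, rotating counterclockwise if $c>0$, and rotating clockwise if $c<0$. Writing $x(t)=r(t)(\cos\theta(t),\sin\theta(t))$ with $r>0$ and $\theta$ a continuous lift of the argument, a solution $x:[-T,0]\to\mathbb R^2\setminus\{0\}$ is called an arc from $A:=x(-T)$ to $B:=x(0)$ with flight time $T$ if $|\theta(0)-\theta(-T)|<2\pi$. *)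

(* Defs.v *)
From Stdlib Require Import Reals Lra.
Open Scope R_scope.

Definition norm2 (x y : R) : R := sqrt (x * x + y * y).

(* D is given as a function of the two coordinates; its value at the origin is irrelevant. *)

Definition cont_punctured (f : R -> R -> R) : Prop :=
  forall x y, (x, y) <> (0, 0) ->
    forall eps, 0 < eps -> exists delta, 0 < delta /\
      forall u w, (u, w) <> (0, 0) -> norm2 (u - x) (w - y) < delta ->
        Rabs (f u w - f x y) < eps.

Definition C1_punctured (D D1 D2 : R -> R -> R) : Prop :=
  (forall x y, (x, y) <> (0, 0) ->
     derivable_pt_lim (fun s => D s y) x (D1 x y) /\
     derivable_pt_lim (fun s => D x s) y (D2 x y)) /\
  cont_punctured D1 /\ cont_punctured D2.

Definition damping_hyp (D : R -> R -> R) : Prop :=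
  (forall x y, (x, y) <> (0, 0) -> 0 <= D x y) /\
  (exists M, forall x y, (x, y) <> (0, 0) -> Rabs (D x y) <= M) /\
  exists D1 D2 : R -> R -> R,
    C1_punctured D D1 D2 /\
    (forall eps, 0 < eps -> exists delta, 0 < delta /\
       forall x y, (x, y) <> (0, 0) -> norm2 x y < delta ->
         sqrt (norm2 x y) * norm2 (D1 x y) (D2 x y) < eps).

Definition in_I (a b t : R) : Prop := a <= t <= b.

Definition deriv_on (a b : R) (f f' : R -> R) : Prop :=
  forall t, in_I a b t -> forall eps, 0 < eps -> exists delta, 0 < delta /\
    forall h, h <> 0 -> in_I a b (t + h) -> Rabs h < delta ->
      Rabs ((f (t + h) - f t) / h - f' t) < eps.

Definition cont_on (a b : R) (f : R -> R) : Prop :=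
  forall t, in_I a b t -> forall eps, 0 < eps -> exists delta, 0 < delta /\
    forall s, in_I a b s -> Rabs (s - t) < delta -> Rabs (f s - f t) < eps.

Definition solution_on (D : R -> R -> R) (T : R)
    (x1 x2 v1 v2 a1 a2 : R -> R) : Prop :=
  deriv_on (- T) 0 x1 v1 /\ deriv_on (- T) 0 x2 v2 /\
  deriv_on (- T) 0 v1 a1 /\ deriv_on (- T) 0 v2 a2 /\
  cont_on (- T) 0 a1 /\ cont_on (- T) 0 a2 /\
  forall t, in_I (- T) 0 t ->
    (x1 t, x2 t) <> (0, 0) /\
    a1 t + D (x1 t) (x2 t) * v1 t = - x1 t / (norm2 (x1 t) (x2 t)) ^ 3 /\
    a2 t + D (x1 t) (x2 t) * v2 t = - x2 t / (norm2 (x1 t) (x2 t)) ^ 3.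

Definition angmom (x1 x2 v1 v2 : R -> R) (t : R) : R :=
  x1 t * v2 t - x2 t * v1 t.

(* |theta(0) - theta(-T)| < 2 pi for a continuous lift theta of the argument
   (all continuous lifts differ by a constant multiple of 2 pi). *)
Definition small_winding (T : R) (x1 x2 : R -> R) : Prop :=
  exists theta : R -> R, cont_on (- T) 0 theta /\
    (forall t, in_I (- T) 0 t ->
       x1 t = norm2 (x1 t) (x2 t) * cos (theta t) /\
       x2 t = norm2 (x1 t) (x2 t) * sin (theta t)) /\
    Rabs (theta 0 - theta (- T)) < 2 * PI.

Inductive rot_kind := Rectilinear | Counterclockwise | Clockwise.

Definition has_kind (k : rot_kind) (c : R -> R) (T : R) : Prop :=
  forall t, in_I (- T) 0 t ->
    match k with
    | Rectilinear => c t = 0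
    | Counterclockwise => 0 < c t
    | Clockwise => c t < 0
    end.

Definition arc_of_kind (D : R -> R -> R) (T : R) (A B : R * R) (k : rot_kind)
    (x1 x2 : R -> R) : Prop :=
  exists v1 v2 a1 a2 : R -> R,
    solution_on D T x1 x2 v1 v2 a1 a2 /\
    (x1 (- T), x2 (- T)) = A /\ (x1 0, x2 0) = B /\
    small_winding T x1 x2 /\
    has_kind k (angmom x1 x2 v1 v2) T.

Definition same_ray (A B : R * R) : Prop :=
  exists lam, 0 < lam /\ fst B = lam * fst A /\ snd B = lam * snd A.

(* Main.v *)
Require Import Defs.
From Stdlib Require Import Reals Lra Lia Bool Classical ClassicalEpsilon FunctionalExtensionality.
From Coquelicot Require Import Coquelicot.
Open Scope R_scope.

(** In polar coordinates the system reads r' = p, th' = c/r^2, p' = c^2/r^3 - 1/r^2 - D p,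
    c' = - D c.  For rectilinear motion (c = 0) let F be a primitive of D along the ray; in the
    variables r and w = p + F(r) the flow is order preserving, so the final radius is strictly
    increasing in the initial velocity.  There is a critical velocity s whose trajectory
    collides exactly at the end of the time interval; for larger velocities the final radius
    runs continuously from 0 to infinity, which gives (a).

    For (b), the motions with c > 0 are global, since energy decreases and c stays positive.
    Describe the initial velocities (p, c), c > 0, by polar coordinates centred at (s, 0).
    Close to (s, 0) the final radius is small, far away it is large.  For small c, the angle
    swept is close to 0 if p > s (no collision), and at least close to 2 pi if p < s (the
    particle turns around the origin before the final time).  A two-dimensional intermediate
    value theorem gives the arc. *)

(** * Initial value problems *)

(** The angle is an unknown with values in the whole real line, so a solution carries its own
    continuous lift, and the winding condition becomes the single equation [y Ang T = al + Th] with
    [Th] prescribed in (0, 2 pi). Its solvability rests on a discontinuity at collisions: as c tends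
    to 0, an orbit aimed at the origin behaves like a Kepler ellipse of eccentricity tending to 1,
    which swings round the centre and leaves along the ray on which it came. The obstacle is that
    friction acts where the speed is unbounded. Two facts control it: near a collision the speed is
    of order r^(-1/2), so the energy lost there is of lower order than a large initial energy; and c
    decays at most like exp(- M t), so over a short time the Keplerian picture is almost exact.
    Since the field is singular at r = 0, existence, uniqueness and continuous dependence are proved
    for a field truncated to a box and then transferred by a priori bounds. *)

Lemma continuous_eps (f : R -> R) (t : R) :
  continuous f t <->
  forall eps, 0 < eps -> exists delta, 0 < delta /\
    forall s, Rabs (s - t) < delta -> Rabs (f s - f t) < eps.
Proof.
  split.
  - intros H eps He.
    apply filterlim_locally with (eps := mkposreal eps He) in H.
    destruct H as [d Hd].
    exists d; split; [apply cond_pos|].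
    intros s Hs; exact (Hd s Hs).
  - intros H. apply filterlim_locally; intros eps.
    destruct (H eps (cond_pos eps)) as [d [Hd1 Hd2]].
    exists (mkposreal d Hd1); intros s Hs; exact (Hd2 s Hs).
Qed.

Lemma is_derive_eps (f : R -> R) (t l : R) :
  is_derive f t l <->
  forall eps, 0 < eps -> exists delta, 0 < delta /\
    forall h, h <> 0 -> Rabs h < delta -> Rabs ((f (t + h) - f t) / h - l) < eps.
Proof.
  rewrite is_derive_Reals; split; intros H eps He; destruct (H eps He) as [d Hd].
  - exists d; split; [apply cond_pos | exact Hd].
  - destruct Hd as [Hd1 Hd2]; exists (mkposreal d Hd1); exact Hd2.
Qed.

Lemma is_derive_cont (f : R -> R) (t l : R) : is_derive f t l -> continuous f t.
Proof. intros H; apply (@ex_derive_continuous R_AbsRing R_NormedModule); exists l; exact H. Qed.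

Lemma incr_of_deriv (f df : R -> R) (a b : R) :
  a <= b ->
  (forall t, a <= t <= b -> is_derive f t (df t)) ->
  (forall t, a <= t <= b -> 0 <= df t) -> f a <= f b.
Proof.
  intros Hab Hd Hp.
  destruct (MVT_gen f a b df) as [c [Hc Heq]].
  - intros x; rewrite Rmin_left, Rmax_right by lra; intros Hx; apply Hd; lra.
  - intros x; rewrite Rmin_left, Rmax_right by lra; intros Hx.
    apply continuity_pt_filterlim, (is_derive_cont _ _ (df x)), Hd; lra.
  - rewrite Rmin_left, Rmax_right in Hc by lra.
    assert (0 <= df c * (b - a)) by (apply Rmult_le_pos; [apply Hp|]; lra). lra.
Qed.

Lemma deriv_bound (u du g dg : R -> R) (a b : R) :
  a <= b ->
  (forall t, a <= t <= b -> is_derive u t (du t)) ->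
  (forall t, a <= t <= b -> is_derive g t (dg t)) ->
  (forall t, a <= t <= b -> Rabs (du t) <= dg t) -> Rabs (u b - u a) <= g b - g a.
Proof.
  intros Hab Hu Hg Hb.
  assert (g a + u a <= g b + u b).
  { apply (incr_of_deriv (fun t => g t + u t) (fun t => dg t + du t)); trivial.
    - intros t Ht; apply (is_derive_plus (V := R_NormedModule)); auto.
    - intros t Ht; specialize (Hb t Ht); apply Rabs_le_between in Hb; lra. }
  assert (g a - u a <= g b - u b).
  { apply (incr_of_deriv (fun t => g t - u t) (fun t => dg t - du t)); trivial.
    - intros t Ht; apply (is_derive_minus (V := R_NormedModule)); auto.
    - intros t Ht; specialize (Hb t Ht); apply Rabs_le_between in Hb; lra. }
  apply Rabs_le; lra.
Qed.

(** The engine of the continuation arguments: at the first failure of a strict inequality, all its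
    consequences are still available up to that time. It also serves as an intermediate value
    theorem. *)
Lemma first_zero (g : R -> R) (a b : R) :
  a <= b -> (forall t, a <= t <= b -> continuous g t) -> 0 < g a ->
  (forall t, a <= t <= b -> 0 < g t) \/
  exists t1, a < t1 <= b /\ g t1 = 0 /\ forall t, a <= t < t1 -> 0 < g t.
Proof.
  intros Hab Hc Ha.
  set (E := fun t => a <= t <= b /\ forall s, a <= s <= t -> 0 < g s).
  destruct (completeness E) as [m [Hm1 Hm2]].
  { exists b; intros t [Ht _]; lra. }
  { exists a; split; [lra|]. intros s Hs; replace s with a by lra; trivial. }
  assert (Ham : a <= m).
  { apply Hm1; split; [lra|]. intros s Hs; replace s with a by lra; trivial. }
  assert (Hmb : m <= b) by (apply Hm2; intros t [Ht _]; lra).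
  assert (Hlt : forall s, a <= s < m -> 0 < g s).
  { intros s Hs. apply NNPP; intros Hn.
    assert (m <= s); [|lra]. apply Hm2; intros t [Ht Ht'].
    destruct (Rle_dec t s); trivial. exfalso; apply Hn, Ht'; lra. }
  assert (Hcm : continuous g m) by (apply Hc; lra).
  rewrite continuous_eps in Hcm.
  destruct (Rtotal_order (g m) 0) as [Hneg | [Hz | Hpos]].
  - exfalso. destruct (Hcm (- g m)) as [d [Hd1 Hd2]]; [lra|].
    destruct (Req_dec m a) as [->|Hne]; [lra|].
    set (s := Rmax a (m - d / 2)).
    assert (a <= s < m) by (unfold s, Rmax; destruct (Rle_dec a (m - d / 2)); lra).
    assert (m - d / 2 <= s) by apply Rmax_r.
    specialize (Hlt s H). specialize (Hd2 s).
    assert (Rabs (s - m) < d) by (apply Rabs_def1; lra).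
    apply Hd2, Rabs_lt_between in H1; lra.
  - right; exists m; split; [|split]; trivial.
    split; trivial. destruct (Req_dec m a) as [->|]; lra.
  - left. destruct (Req_dec m b) as [->|Hne].
    { intros t Ht; destruct (Req_dec t b) as [->|]; trivial; apply Hlt; lra. }
    exfalso. destruct (Hcm (g m) Hpos) as [d [Hd1 Hd2]].
    set (s := Rmin b (m + d / 2)).
    assert (m < s <= b) by (unfold s, Rmin; destruct (Rle_dec b (m + d / 2)); lra).
    assert (s <= m + d / 2) by apply Rmin_r.
    assert (s <= m); [|lra]. apply Hm1; split; [lra|].
    intros x Hx; destruct (Rlt_dec x m); [apply Hlt; lra|].
    assert (Rabs (x - m) < d) by (apply Rabs_def1; lra).
    apply Hd2, Rabs_lt_between in H1; lra.
Qed.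

Lemma le_of_halves (x a b : R) : (forall n : nat, x <= a + b / 2 ^ n) -> x <= a.
Proof.
  intros H. apply Rnot_lt_le; intros Hlt.
  assert (Hb : 0 < b) by (specialize (H 0%nat); simpl in H; lra).
  destruct (pow_lt_1_zero (/ 2)) with (y := (x - a) / b) as [N HN].
  { rewrite Rabs_pos_eq; lra. }
  { apply Rdiv_lt_0_compat; lra. }
  specialize (HN N (Nat.le_refl N)). specialize (H N).
  rewrite Rabs_pos_eq in HN by (apply pow_le; lra).
  rewrite pow_inv in HN.
  apply (Rmult_lt_compat_r b) in HN; trivial.
  unfold Rdiv in *. rewrite Rmult_assoc, Rinv_l in HN by lra. lra.
Qed.

(** * Picard iteration for a bounded, globally Lipschitz autonomous field *)

Section Picard.
Variables (I : Type) (f : I -> (I -> R) -> R) (B L : R).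
Hypothesis HLpos : 1 <= L.
Hypothesis HB : forall i y, Rabs (f i y) <= B.
Hypothesis HL : forall i y z e,
  (forall j, Rabs (y j - z j) <= e) -> Rabs (f i y - f i z) <= L * e.

Let Blip (Y : I -> R -> R) := forall i s t, Rabs (Y i s - Y i t) <= B * Rabs (s - t).
(** The argument is frozen for negative times, so that the integral operator acts on curves over the
    whole line and derivatives at time 0 are two-sided. *)
Let rhs (Y : I -> R -> R) i s := f i (fun j => Y j (Rmax s 0)).
Let step (y0 : I -> R) (Y : I -> R -> R) i t := y0 i + RInt (rhs Y i) 0 t.

Lemma Rmax0_lip (s t : R) : Rabs (Rmax s 0 - Rmax t 0) <= Rabs (s - t).
Proof.
  unfold Rmax; destruct (Rle_dec s 0), (Rle_dec t 0); unfold Rabs;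
  repeat match goal with |- context [Rcase_abs ?x] => destruct (Rcase_abs x) end; lra.
Qed.

Lemma rhs_cont Y i t : Blip Y -> continuous (rhs Y i) t.
Proof.
  intros HY; apply continuous_eps; intros eps He.
  assert (HBpos : 0 <= B) by (eapply Rle_trans; [apply Rabs_pos | apply (HB i (fun _ => 0))]).
  exists (eps / (L * B + 1)); split.
  { apply Rdiv_lt_0_compat; nra. }
  intros s Hs. unfold rhs.
  eapply Rle_lt_trans; [apply (HL _ _ _ (B * Rabs (s - t)))|].
  - intros j; eapply Rle_trans; [apply HY|].
    apply Rmult_le_compat_l; trivial; apply Rmax0_lip.
  - apply Rlt_div_r in Hs; [|nra]. assert (0 <= Rabs (s - t)) by apply Rabs_pos. nra.
Qed.

Lemma step_deriv y0 Y i t : Blip Y -> is_derive (step y0 Y i) t (rhs Y i t).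
Proof.
  intros HY. unfold step.
  evar_last.
  - apply (is_derive_plus (V := R_NormedModule)); [apply is_derive_const|].
    apply (is_derive_RInt (V := R_NormedModule) (rhs Y i) (fun t => RInt (rhs Y i) 0 t) 0).
    + apply filter_forall; intros x.
      apply (RInt_correct (V := R_CompleteNormedModule)), ex_RInt_continuous.
      intros; apply rhs_cont; trivial.
    + apply rhs_cont; trivial.
  - apply plus_zero_l.
Qed.

Lemma step_lip y0 Y : Blip Y -> Blip (step y0 Y).
Proof.
  intros HY.
  assert (H : forall i s t, s <= t -> Rabs (step y0 Y i t - step y0 Y i s) <= B * t - B * s).
  { intros i s t Hst.
    apply (deriv_bound _ (rhs Y i) (fun t => B * t) (fun _ => B)); trivial.
    - intros; apply step_deriv; trivial.
    - intros x _; auto_derive; trivial; ring.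
    - intros; apply HB. }
  intros i s t. destruct (Rle_dec s t) as [Hst|Hst].
  - rewrite Rabs_minus_sym, (Rabs_minus_sym s t), (Rabs_pos_eq (t - s)) by lra.
    generalize (H i s t Hst); lra.
  - rewrite (Rabs_pos_eq (s - t)) by lra.
    generalize (H i t s); lra.
Qed.

(* A bound K e^{2Lt} on the distance of two curves improves to (e + K/2) e^{2Lt} for
   their images under the integral operator, so the iteration contracts on every interval. *)
Lemma weighted_contraction (u du : R -> R) (tau e K : R) :
  0 <= K -> Rabs (u 0) <= e ->
  (forall t, 0 <= t <= tau -> is_derive u t (du t)) ->
  (forall t, 0 <= t <= tau -> Rabs (du t) <= L * (K * exp (2 * L * t))) ->
  forall t, 0 <= t <= tau -> Rabs (u t) <= (e + K / 2) * exp (2 * L * t).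
Proof.
  intros HK Hu0 Hu Hdu t Ht.
  assert (H : Rabs (u t - u 0) <= K / 2 * exp (2 * L * t) - K / 2 * exp (2 * L * 0)).
  { apply (deriv_bound u du (fun t => K / 2 * exp (2 * L * t))
      (fun t => L * (K * exp (2 * L * t)))); try lra.
    - intros s Hs; apply Hu; lra.
    - intros s Hs; auto_derive; trivial; field.
    - intros s Hs; apply Hdu; lra. }
  rewrite Rmult_0_r, exp_0 in H.
  assert (1 <= exp (2 * L * t)) by (generalize (exp_ineq1_le (2 * L * t)); nra).
  assert (0 <= e) by (eapply Rle_trans; [apply Rabs_pos | apply Hu0]).
  replace (u t) with ((u t - u 0) + u 0) by ring.
  eapply Rle_trans; [apply Rabs_triang|]. nra.
Qed.

Fixpoint iterate (y0 : I -> R) (k : nat) : I -> R -> R :=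
  match k with O => fun i _ => y0 i | S k => step y0 (iterate y0 k) end.

Lemma iterate_lip y0 k : Blip (iterate y0 k).
Proof.
  destruct k as [|k]; simpl.
  - intros i s t; rewrite Rminus_diag, Rabs_R0.
    apply Rmult_le_pos; [|apply Rabs_pos].
    eapply Rle_trans; [apply Rabs_pos | apply (HB i (fun _ => 0))].
  - apply step_lip. induction k as [|k IH]; simpl; [|apply step_lip, IH].
    intros i s t; rewrite Rminus_diag, Rabs_R0.
    apply Rmult_le_pos; [|apply Rabs_pos].
    eapply Rle_trans; [apply Rabs_pos | apply (HB i (fun _ => 0))].
Qed.

Lemma step_at_0 y0 Y i : step y0 Y i 0 = y0 i.
Proof. unfold step; rewrite RInt_point; exact (Rplus_0_r (y0 i)). Qed.

Lemma rhs_diff Y Z i t e : 0 <= t ->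
  (forall j, Rabs (Y j t - Z j t) <= e) -> Rabs (rhs Y i t - rhs Z i t) <= L * e.
Proof. intros Ht H; unfold rhs; rewrite Rmax_left by trivial; apply HL, H. Qed.

(** The first gap is at most B t, which the weight absorbs because [1 <= L]; each further step
    halves the constant, by [weighted_contraction] with [e = 0]. *)
Lemma iterate_cauchy y0 k i t : 0 <= t ->
  Rabs (iterate y0 (S k) i t - iterate y0 k i t) <= B / 2 ^ k * exp (2 * L * t).
Proof.
  revert i t; induction k as [|k IH]; intros i t Ht.
  - assert (HBpos : 0 <= B) by (eapply Rle_trans; [apply Rabs_pos | apply (HB i (fun _ => 0))]).
    generalize (iterate_lip y0 1 i t 0).
    simpl iterate. rewrite step_at_0, Rminus_0_r, (Rabs_pos_eq t Ht).
    intros H; eapply Rle_trans; [exact H|].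
    generalize (exp_ineq1_le (2 * L * t)); simpl; intros.
    replace (B / 1) with B by field.
    apply Rmult_le_compat_l; nra.
  - assert (HBpos : 0 <= B) by (eapply Rle_trans; [apply Rabs_pos | apply (HB i (fun _ => 0))]).
    assert (Hp : 0 < 2 ^ k) by (apply pow_lt; lra).
    replace (B / 2 ^ S k) with (0 + B / 2 ^ k / 2) by (simpl; field; lra).
    apply (weighted_contraction
      (fun t => iterate y0 (S (S k)) i t - iterate y0 (S k) i t)
      (fun t => rhs (iterate y0 (S k)) i t - rhs (iterate y0 k) i t) t); try lra.
    + apply Rdiv_le_0_compat; trivial.
    + simpl; rewrite !step_at_0, Rminus_diag, Rabs_R0; lra.
    + intros s Hs; apply (is_derive_minus (V := R_NormedModule)); apply step_deriv; apply iterate_lip.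
    + intros s Hs; apply rhs_diff; [lra|]. intros j; apply IH; lra.
Qed.

Lemma iterate_limit y0 i t : 0 <= t ->
  exists l, forall k, Rabs (iterate y0 k i t - l) <= 2 * B * exp (2 * L * t) / 2 ^ k.
Proof.
  intros Ht. set (C := B * exp (2 * L * t)).
  assert (HC : 0 <= C).
  { apply Rmult_le_pos; [|left; apply exp_pos].
    eapply Rle_trans; [apply Rabs_pos | apply (HB i (fun _ => 0))]. }
  assert (Hp : forall k, 0 < 2 ^ k) by (intros; apply pow_lt; lra).
  set (u := fun k => iterate y0 k i t).
  (* Subtracting the tail of the geometric series is what closes the induction on [n]. *)
  assert (Hn : forall n k, Rabs (u (n + k)%nat - u k) <= 2 * C / 2 ^ k - 2 * C / 2 ^ (n + k)).
  { induction n as [|n IH]; intros k.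
    - change (0 + k)%nat with k; rewrite Rminus_diag, Rabs_R0; lra.
    - change (S n + k)%nat with (S (n + k)).
      replace (u (S (n + k)) - u k) with
        ((u (S (n + k)) - u (n + k)%nat) + (u (n + k)%nat - u k)) by ring.
      eapply Rle_trans; [apply Rabs_triang|].
      assert (H1 : Rabs (u (S (n + k)) - u (n + k)%nat) <= C / 2 ^ (n + k)).
      { eapply Rle_trans; [apply (iterate_cauchy y0 (n + k) i t Ht)|].
        right; unfold C; field; apply Rgt_not_eq, Hp. }
      specialize (IH k).
      replace (2 * C / 2 ^ S (n + k)) with (C / 2 ^ (n + k))
        by (simpl; field; apply Rgt_not_eq, Hp).
      replace (2 * C / 2 ^ (n + k)) with (C / 2 ^ (n + k) + C / 2 ^ (n + k)) in IH
        by (field; apply Rgt_not_eq, Hp). lra. }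
  assert (Hle : forall n k, Rabs (u (n + k)%nat - u k) <= 2 * C / 2 ^ k).
  { intros n k; eapply Rle_trans; [apply Hn|].
    assert (0 <= 2 * C / 2 ^ (n + k)) by (apply Rdiv_le_0_compat; [lra | apply Hp]). lra. }
  assert (Hcv : ex_finite_lim_seq u).
  { apply ex_lim_seq_cauchy_corr; intros eps.
    destruct (classic (exists N, 4 * C / 2 ^ N < eps)) as [[N HN]|Hno].
    - exists N; intros n m Hn' Hm'.
      replace (u n - u m) with ((u n - u N) - (u m - u N)) by ring.
      eapply Rle_lt_trans; [apply Rabs_triang|]; rewrite Rabs_Ropp.
      generalize (Hle (n - N)%nat N) (Hle (m - N)%nat N).
      replace (n - N + N)%nat with n by lia; replace (m - N + N)%nat with m by lia.
      replace (4 * C / 2 ^ N) with (2 * C / 2 ^ N + 2 * C / 2 ^ N) in HN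
        by (field; apply Rgt_not_eq, Hp). lra.
    - exfalso. assert (pos eps <= 0); [|generalize (cond_pos eps); lra].
      apply (le_of_halves _ 0 (4 * C)); intros n.
      apply Rnot_lt_le; intros H; apply Hno; exists n; lra. }
  destruct Hcv as [l Hl]; exists l; intros k.
  assert (Hk : is_lim_seq (fun n => u (n + k)%nat) l) by (apply is_lim_seq_incr_n; trivial).
  apply is_lim_seq_spec in Hk.
  apply le_epsilon; intros eps He.
  destruct (Hk (mkposreal eps He)) as [N HN]; simpl in HN.
  specialize (HN N (Nat.le_refl N)).
  replace (iterate y0 k i t - l) with ((u (N + k)%nat - l) - (u (N + k)%nat - u k)) by (unfold u; ring).
  eapply Rle_trans; [apply Rabs_triang|]; rewrite Rabs_Ropp.
  generalize (Hle N k); unfold C; intros.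
  replace (2 * B * exp (2 * L * t) / 2 ^ k) with (2 * (B * exp (2 * L * t)) / 2 ^ k)
    by (field; apply Rgt_not_eq, Hp). lra.
Qed.

Theorem picard_existence (y0 : I -> R) :
  exists y : I -> R -> R, (forall i, y i 0 = y0 i) /\
    forall i t, 0 <= t -> is_derive (y i) t (f i (fun j => y j t)).
Proof.
  set (lim := fun i t =>
    match Rle_dec 0 t with
    | left H => proj1_sig (constructive_indefinite_description _ (iterate_limit y0 i t H))
    | right _ => y0 i
    end).
  assert (Hlim : forall i t k, 0 <= t ->
    Rabs (iterate y0 k i t - lim i t) <= 2 * B * exp (2 * L * t) / 2 ^ k).
  { intros i t k Ht; unfold lim; destruct (Rle_dec 0 t) as [H|H]; [|lra].
    destruct (constructive_indefinite_description _ _) as [l Hl]; simpl; apply Hl. }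
  set (Y := fun i t => lim i (Rmax t 0)).
  assert (Hp : forall k, 0 < 2 ^ k) by (intros; apply pow_lt; lra).
  assert (HY : Blip Y).
  { intros i s t; unfold Y.
    apply (le_of_halves _ _ (2 * B * exp (2 * L * Rmax s 0) + 2 * B * exp (2 * L * Rmax t 0))).
    intros n.
    generalize (Hlim i (Rmax s 0) n (Rmax_r _ _)) (Hlim i (Rmax t 0) n (Rmax_r _ _)); intros H1 H2.
    generalize (iterate_lip y0 n i (Rmax s 0) (Rmax t 0)); intros H3.
    assert (H4 : B * Rabs (Rmax s 0 - Rmax t 0) <= B * Rabs (s - t)).
    { apply Rmult_le_compat_l; [|apply Rmax0_lip].
      eapply Rle_trans; [apply Rabs_pos | apply (HB i (fun _ => 0))]. }
    replace (lim i (Rmax s 0) - lim i (Rmax t 0)) with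
      (- (iterate y0 n i (Rmax s 0) - lim i (Rmax s 0)) + (iterate y0 n i (Rmax t 0) - lim i (Rmax t 0))
       + (iterate y0 n i (Rmax s 0) - iterate y0 n i (Rmax t 0))) by ring.
    eapply Rle_trans; [apply Rabs_triang|].
    eapply Rle_trans; [apply Rplus_le_compat_r, Rabs_triang|].
    rewrite Rabs_Ropp.
    rewrite Rdiv_plus_distr. lra. }
  (* The solution is the image of the limit under the integral operator, hence differentiable at
     once; it remains to see that for [0 <= t] this image is the limit itself. *)
  exists (step y0 Y).
  assert (Heq : forall i t, 0 <= t -> step y0 Y i t = lim i t).
  { intros i t Ht. apply Rminus_diag_uniq.
    assert (Habs : Rabs (step y0 Y i t - lim i t) <= 0); [|].
    2: { destruct (Req_dec (step y0 Y i t - lim i t) 0); trivial.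
         apply Rabs_pos_lt in H; lra. }
    apply (le_of_halves _ _ (2 * B * exp (2 * L * t))); intros n.
    assert (HBpos : 0 <= B) by (eapply Rle_trans; [apply Rabs_pos | apply (HB i (fun _ => 0))]).
    assert (H1 : Rabs (step y0 Y i t - iterate y0 (S n) i t)
       <= (0 + 2 * B / 2 ^ n / 2) * exp (2 * L * t)).
    { apply (weighted_contraction (fun t => step y0 Y i t - iterate y0 (S n) i t)
        (fun t => rhs Y i t - rhs (iterate y0 n) i t) t); try lra.
      - apply Rdiv_le_0_compat; [lra|apply Hp].
      - simpl; rewrite !step_at_0, Rminus_diag, Rabs_R0; lra.
      - intros s Hs; apply (is_derive_minus (V := R_NormedModule)); apply step_deriv; trivial.
        apply iterate_lip.
      - intros s Hs; apply rhs_diff; [lra|].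
        intros j; unfold Y; rewrite Rmax_left by lra. rewrite Rabs_minus_sym.
        eapply Rle_trans; [apply Hlim; lra|]. right; field. apply Rgt_not_eq, Hp. }
    generalize (Hlim i t (S n) Ht); intros H2.
    replace (step y0 Y i t - lim i t) with
      ((step y0 Y i t - iterate y0 (S n) i t) + (iterate y0 (S n) i t - lim i t)) by ring.
    eapply Rle_trans; [apply Rabs_triang|].
    replace (2 * B * exp (2 * L * t) / 2 ^ S n) with (B / 2 ^ n * exp (2 * L * t)) in H2
      by (simpl; field; apply Rgt_not_eq, Hp).
    replace ((0 + 2 * B / 2 ^ n / 2) * exp (2 * L * t)) with (B / 2 ^ n * exp (2 * L * t)) in H1
      by (field; apply Rgt_not_eq, Hp).
    replace (2 * B * exp (2 * L * t) / 2 ^ n) with (B / 2 ^ n * exp (2 * L * t) + B / 2 ^ n * exp (2 * L * t))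
      by (field; apply Rgt_not_eq, Hp). lra. }
  split; [intros; apply step_at_0|].
  intros i t Ht.
  replace (f i (fun j => step y0 Y j t)) with (rhs Y i t); [apply step_deriv; trivial|].
  unfold rhs, Y. f_equal. apply functional_extensionality; intros j.
  rewrite (Rmax_left t 0), (Rmax_left t 0), Heq; trivial.
Qed.

(** Gronwall's estimate from the same contraction: a constant K improves to e + K/2, whose fixed
    point is 2e, so the excess of a crude first bound halves at each round. *)
Theorem initial_dependence (y z : I -> R -> R) (tau e : R) :
  (forall i t, 0 <= t <= tau -> is_derive (y i) t (f i (fun j => y j t))) ->
  (forall i t, 0 <= t <= tau -> is_derive (z i) t (f i (fun j => z j t))) ->
  (forall i, Rabs (y i 0 - z i 0) <= e) ->
  forall i t, 0 <= t <= tau -> Rabs (y i t - z i t) <= 2 * e * exp (2 * L * t).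
Proof.
  intros Hy Hz H0.
  assert (Hu : forall i t, 0 <= t <= tau -> is_derive (fun t => y i t - z i t) t
     (f i (fun j => y j t) - f i (fun j => z j t))).
  { intros i t Ht; apply (is_derive_minus (V := R_NormedModule)); auto. }
  assert (Hn : forall n i t, 0 <= t <= tau ->
    Rabs (y i t - z i t) <= (2 * e + (2 * B * tau) / 2 ^ n) * exp (2 * L * t)).
  { induction n as [|n IH]; intros i t Ht.
    - assert (HBpos : 0 <= B) by (eapply Rle_trans; [apply Rabs_pos | apply (HB i (fun _ => 0))]).
      assert (He : 0 <= e) by (eapply Rle_trans; [apply Rabs_pos | apply (H0 i)]).
      assert (H : Rabs ((y i t - z i t) - (y i 0 - z i 0)) <= 2 * B * t - 2 * B * 0).
      { apply (deriv_bound (fun t => y i t - z i t) (fun t => f i (fun j => y j t) - f i (fun j => z j t)) (fun t => 2 * B * t) (fun _ => 2 * B)); try lra.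
        - intros s Hs; apply Hu; lra.
        - intros s Hs; auto_derive; trivial; ring.
        - intros s Hs; eapply Rle_trans; [apply Rabs_triang|]; rewrite Rabs_Ropp.
          generalize (HB i (fun j => y j s)) (HB i (fun j => z j s)); lra. }
      assert (1 <= exp (2 * L * t)) by (generalize (exp_ineq1_le (2 * L * t)); nra).
      specialize (H0 i).
      replace (y i t - z i t) with ((y i t - z i t) - (y i 0 - z i 0) + (y i 0 - z i 0)) by ring.
      eapply Rle_trans; [apply Rabs_triang|].
      replace (2 * B * tau / 2 ^ 0) with (2 * B * tau) by (simpl; field).
      assert (B * t <= B * tau) by nra. assert (0 <= B * tau) by nra. nra.
    - assert (HBpos : 0 <= B) by (eapply Rle_trans; [apply Rabs_pos | apply (HB i (fun _ => 0))]).
      assert (He : 0 <= e) by (eapply Rle_trans; [apply Rabs_pos | apply (H0 i)]).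
      assert (Hp : 0 < 2 ^ n) by (apply pow_lt; lra).
      replace (2 * e + 2 * B * tau / 2 ^ S n) with (e + (2 * e + 2 * B * tau / 2 ^ n) / 2)
        by (simpl; field; lra).
      apply (weighted_contraction (fun t => y i t - z i t)
        (fun t => f i (fun j => y j t) - f i (fun j => z j t)) tau); trivial.
      + assert (0 <= 2 * B * tau / 2 ^ n) by (apply Rdiv_le_0_compat; nra). lra.
      + apply Hu.
      + intros s Hs; apply HL; intros j; apply IH; trivial. }
  intros i t Ht.
  apply (le_of_halves _ _ (2 * B * tau * exp (2 * L * t))); intros n.
  eapply Rle_trans; [apply (Hn n); trivial|]. right; field.
  apply Rgt_not_eq, pow_lt; lra.
Qed.

End Picard.

(** * The Poincare-Miranda theorem in the plane *)

(* Labels 0, 1, 2 stand for "g < 0", "f < 0 <= g", "0 <= f, g"; [door] marks the edges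
   joining labels 1 and 2, whose parity is tracked from the bottom side to the top side. *)
Definition door (a b : nat) : bool :=
  match a, b with 1%nat, 2%nat | 2%nat, 1%nat => true | _, _ => false end.

(** Going once round the cell, the changes between 1 and 2 are even in number if label 0 is absent,
    and there are none if 1 or 2 is absent. *)
Lemma cell_parity (a b c e : nat) :
  (a <= 2)%nat -> (b <= 2)%nat -> (c <= 2)%nat -> (e <= 2)%nat ->
  xorb (xorb (door a b) (door c e)) (xorb (door a c) (door b e)) = false \/
  (forall l, (l <= 2)%nat -> a = l \/ b = l \/ c = l \/ e = l).
Proof.
  intros Ha Hb Hc He.
  destruct a as [|[|[|]]], b as [|[|[|]]], c as [|[|[|]]], e as [|[|[|]]];
  try lia; (left; reflexivity) || (right; lia).
Qed.

Fixpoint parity (h : nat -> bool) (n : nat) : bool :=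
  match n with O => false | S n => xorb (parity h n) (h n) end.

Lemma parity_doors (l : nat -> nat) (n : nat) :
  (forall i, (i <= n)%nat -> l i = 1%nat \/ l i = 2%nat) ->
  parity (fun i => door (l i) (l (S i))) n = negb (Nat.eqb (l 0%nat) (l n)).
Proof.
  induction n as [|n IH]; intros H; simpl parity.
  - rewrite Nat.eqb_refl; reflexivity.
  - rewrite IH by (intros; apply H; lia).
    destruct (H 0%nat ltac:(lia)) as [E0|E0], (H n ltac:(lia)) as [E1|E1],
      (H (S n) ltac:(lia)) as [E2|E2]; rewrite E0, E1, E2; reflexivity.
Qed.

(** If no cell carried all three labels, neighbouring rows would have the same parity of doors,
    because the left side avoids 2 and the right side avoids 1. But the bottom row has no doors,
    while the top row uses only 1 and 2 and runs from 1 to 2, so its number of doors is odd. *)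
Lemma discrete_sperner (n : nat) (l : nat -> nat -> nat) :
  (forall i j, (l i j <= 2)%nat) ->
  (forall i, (i <= n)%nat -> l i 0%nat = 0%nat) ->
  (forall i, (i <= n)%nat -> l i n <> 0%nat) ->
  (forall j, (j <= n)%nat -> l 0%nat j <> 2%nat) ->
  (forall j, (j <= n)%nat -> l n j <> 1%nat) ->
  exists i j, (i < n)%nat /\ (j < n)%nat /\
    forall k, (k <= 2)%nat ->
      l i j = k \/ l (S i) j = k \/ l i (S j) = k \/ l (S i) (S j) = k.
Proof.
  intros Hl Hbot Htop Hleft Hright. apply NNPP; intros Hno.
  assert (Hcell : forall i j, (i < n)%nat -> (j < n)%nat ->
    xorb (xorb (door (l i j) (l (S i) j)) (door (l i (S j)) (l (S i) (S j))))
         (xorb (door (l i j) (l i (S j))) (door (l (S i) j) (l (S i) (S j)))) = false).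
  { intros i j Hi Hj.
    destruct (cell_parity (l i j) (l (S i) j) (l i (S j)) (l (S i) (S j))) as [H|H]; auto.
    exfalso; apply Hno; exists i, j; auto. }
  assert (Hrow : forall j, (j < n)%nat -> forall i, (i <= n)%nat ->
    xorb (parity (fun i => door (l i j) (l (S i) j)) i)
         (parity (fun i => door (l i (S j)) (l (S i) (S j))) i) =
    xorb (door (l 0%nat j) (l 0%nat (S j))) (door (l i j) (l i (S j)))).
  { intros j Hj; induction i as [|i IH]; intros Hi.
    - simpl; rewrite xorb_nilpotent; reflexivity.
    - specialize (IH ltac:(lia)). specialize (Hcell i j ltac:(lia) Hj). simpl parity.
      destruct (parity _ i), (parity _ i), (door (l i j) _), (door (l i (S j)) _),
        (door (l 0%nat j) _), (door (l i j) _), (door (l (S i) j) _); simpl in *; congruence. }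
  assert (Hall : forall j, (j <= n)%nat -> parity (fun i => door (l i j) (l (S i) j)) n = false).
  { induction j as [|j IH]; intros Hj.
    - assert (H : forall m, (m <= n)%nat -> parity (fun i => door (l i 0%nat) (l (S i) 0%nat)) m = false).
      { induction m as [|m IHm]; intros Hm; trivial. simpl.
        rewrite IHm, !Hbot by lia; reflexivity. }
      apply H; lia.
    - specialize (Hrow j ltac:(lia) n ltac:(lia)). rewrite IH in Hrow by lia.
      rewrite xorb_false_l in Hrow; rewrite Hrow.
      generalize (Hleft j ltac:(lia)) (Hleft (S j) ltac:(lia))
        (Hright j ltac:(lia)) (Hright (S j) ltac:(lia)) (Hl 0%nat j) (Hl 0%nat (S j)) (Hl n j) (Hl n (S j)).
      destruct (l 0%nat j) as [|[|[|]]], (l 0%nat (S j)) as [|[|[|]]],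
        (l n j) as [|[|[|]]], (l n (S j)) as [|[|[|]]]; intros; try lia; reflexivity. }
  specialize (Hall n (Nat.le_refl n)).
  rewrite (parity_doors (fun i => l i n)) in Hall.
  - generalize (Hleft n (Nat.le_refl n)) (Hright n (Nat.le_refl n)) (Htop 0%nat ltac:(lia))
      (Htop n ltac:(lia)) (Hl 0%nat n) (Hl n n).
    apply negb_false_iff, Nat.eqb_eq in Hall. lia.
  - intros i Hi; generalize (Htop i Hi) (Hl i n); lia.
Qed.

Definition continuous_on_rect (a b a' b' : R) (f : R -> R -> R) : Prop :=
  forall x y, a <= x <= b -> a' <= y <= b' -> forall eps, 0 < eps ->
    exists delta, 0 < delta /\ forall u v, a <= u <= b -> a' <= v <= b' ->
      Rabs (u - x) < delta -> Rabs (v - y) < delta -> Rabs (f u v - f x y) < eps.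

Lemma constant_sign_near (a b a' b' : R) (f : R -> R -> R) (x y : R) :
  continuous_on_rect a b a' b' f -> a <= x <= b -> a' <= y <= b' -> f x y <> 0 ->
  exists delta, 0 < delta /\ forall u v, a <= u <= b -> a' <= v <= b' ->
      Rabs (u - x) < delta -> Rabs (v - y) < delta -> 0 < f u v * f x y.
Proof.
  intros Hf Hx Hy Hne.
  destruct (Hf x y Hx Hy (Rabs (f x y)) (Rabs_pos_lt _ Hne)) as [d [Hd H]].
  exists d; split; trivial. intros u v Hu Hv H1 H2.
  specialize (H u v Hu Hv H1 H2).
  revert H; unfold Rabs; destruct (Rcase_abs (f u v - f x y)), (Rcase_abs (f x y)); intros; nra.
Qed.

(** Without a common zero, every point has a neighbourhood on which [f] or [g] keeps its sign. On a
    grid finer than a Lebesgue number each cell lies in such a neighbourhood, whereas a cell with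
    all three labels shows both signs of [f] and both signs of [g]. *)
Theorem poincare_miranda (a b a' b' : R) (f g : R -> R -> R) :
  a <= b -> a' <= b' ->
  continuous_on_rect a b a' b' f -> continuous_on_rect a b a' b' g ->
  (forall y, a' <= y <= b' -> f a y < 0) -> (forall y, a' <= y <= b' -> 0 < f b y) ->
  (forall x, a <= x <= b -> g x a' < 0) -> (forall x, a <= x <= b -> 0 < g x b') ->
  exists x y, a <= x <= b /\ a' <= y <= b' /\ f x y = 0 /\ g x y = 0.
Proof.
  intros Hab Hab' Hf Hg Hleft Hright Hbot Htop. apply NNPP; intros Hno.
  assert (Hsign : forall x y, exists delta : posreal, a <= x <= b -> a' <= y <= b' ->
    exists h, (h = f \/ h = g) /\ forall u v, a <= u <= b -> a' <= v <= b' ->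
      Rabs (u - x) < 2 * delta -> Rabs (v - y) < 2 * delta -> 0 < h u v * h x y).
  { intros x y.
    destruct (classic (a <= x <= b /\ a' <= y <= b')) as [[Hx Hy]|Hout].
    2: { exists (mkposreal 1 Rlt_0_1); intros; tauto. }
    assert (Hh : exists h, (h = f \/ h = g) /\ h x y <> 0).
    { destruct (Req_dec (f x y) 0); [|exists f; auto].
      destruct (Req_dec (g x y) 0); [|exists g; auto].
      exfalso; apply Hno; exists x, y; auto. }
    destruct Hh as [h [Hh Hne]].
    destruct (constant_sign_near a b a' b' h x y) as [d [Hd H]]; trivial.
    { destruct Hh as [->| ->]; trivial. }
    (* Half of the radius covers the distance from a corner to the tag point, the other half the
       width of a cell. *)
    assert (Hd2 : 0 < d / 2) by lra.
    exists (mkposreal _ Hd2); intros _ _; exists h; split; trivial.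
    simpl; intros; apply H; trivial; lra. }
  set (delta := fun x y => proj1_sig (constructive_indefinite_description _ (Hsign x y))).
  destruct (compactness_value_2d a b a' b' delta) as [d Hd].
  set (W := Rmax (b - a) (b' - a')).
  assert (HW : 0 <= W) by (unfold W; eapply Rle_trans; [|apply Rmax_l]; lra).
  destruct (INR_unbounded (W / d)) as [n Hn].
  assert (Hd0 := cond_pos d).
  assert (HnW : W / INR n < d /\ 0 < INR n).
  { assert (0 <= W / d) by (apply Rdiv_le_0_compat; lra).
    assert (0 < INR n) by lra. split; trivial.
    apply Rlt_div_l; trivial. apply Rlt_gt, Rlt_div_l in Hn; lra. }
  destruct HnW as [HnW Hn0].
  set (px := fun i => a + (b - a) * (INR i / INR n)).
  set (py := fun j => a' + (b' - a') * (INR j / INR n)).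
  assert (Hfrac : forall i, (i <= n)%nat -> 0 <= INR i / INR n <= 1).
  { intros i Hi; split; [apply Rdiv_le_0_compat; trivial; apply pos_INR|].
    apply Rle_div_l; trivial; rewrite Rmult_1_l; apply le_INR; trivial. }
  assert (Hpx : forall i, (i <= n)%nat -> a <= px i <= b).
  { intros i Hi; specialize (Hfrac i Hi); unfold px; nra. }
  assert (Hpy : forall i, (i <= n)%nat -> a' <= py i <= b').
  { intros i Hi; specialize (Hfrac i Hi); unfold py; nra. }
  assert (Hpx0 : px 0%nat = a) by (unfold px; simpl; field; lra).
  assert (Hpy0 : py 0%nat = a') by (unfold py; simpl; field; lra).
  assert (Hpxn : px n = b) by (unfold px; field; lra).
  assert (Hpyn : py n = b') by (unfold py; field; lra).
  assert (Hstep : forall i, 0 <= px (S i) - px i < d /\ 0 <= py (S i) - py i < d).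
  { intros i. unfold px, py; rewrite S_INR.
    assert (Hbd : forall w, 0 <= w <= W -> 0 <= w * / INR n < d).
    { intros w Hw; split; [apply Rdiv_le_0_compat; lra|].
      eapply Rle_lt_trans; [|apply HnW]. apply Rmult_le_compat_r; [|lra].
      left; apply Rinv_0_lt_compat; trivial. }
    split.
    - replace (a + (b - a) * ((INR i + 1) / INR n) - (a + (b - a) * (INR i / INR n)))
        with ((b - a) * / INR n) by (field; lra).
      apply Hbd; split; [lra|apply Rmax_l].
    - replace (a' + (b' - a') * ((INR i + 1) / INR n) - (a' + (b' - a') * (INR i / INR n)))
        with ((b' - a') * / INR n) by (field; lra).
      apply Hbd; split; [lra|apply Rmax_r]. }
  set (lab := fun x y => if Rlt_dec (g x y) 0 then 0%nat else if Rlt_dec (f x y) 0 then 1%nat else 2%nat).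
  destruct (discrete_sperner n (fun i j => lab (px i) (py j))) as [i [j [Hi [Hj Hlab]]]].
  - intros; unfold lab; destruct (Rlt_dec _ _); [|destruct (Rlt_dec _ _)]; lia.
  - intros i Hi; unfold lab; rewrite Hpy0; destruct (Rlt_dec _ _) as [|H]; trivial.
    exfalso; apply H, Hbot, Hpx, Hi.
  - intros i Hi; unfold lab; rewrite Hpyn; specialize (Htop (px i) (Hpx i Hi)).
    destruct (Rlt_dec _ _); [lra|]; destruct (Rlt_dec _ _); lia.
  - intros i Hi; unfold lab; rewrite Hpx0; specialize (Hleft (py i) (Hpy i Hi)).
    destruct (Rlt_dec _ _); [lia|]; destruct (Rlt_dec _ _); [lia|lra].
  - intros i Hi; unfold lab; rewrite Hpxn; specialize (Hright (py i) (Hpy i Hi)).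
    destruct (Rlt_dec _ _); [lia|]; destruct (Rlt_dec _ _); [lra|lia].
  - apply (Hd (px i) (py j)); [apply Hpx; lia | apply Hpy; lia|].
    intros [u [v [Hu [Hv [Hxu [Hyv Hdu]]]]]].
    unfold delta in Hxu, Hyv, Hdu.
    destruct (constructive_indefinite_description _ (Hsign u v)) as [dl Hdl]; simpl in *.
    destruct (Hdl Hu Hv) as [h [Hh Hpos]].
    assert (Hcorner : forall k, (k <= 2)%nat -> exists x y, lab x y = k /\ 0 < h x y * h u v).
    { intros k Hk.
      destruct (Hstep i) as [Hsx _], (Hstep j) as [_ Hsy].
      apply Rabs_lt_between in Hxu. apply Rabs_lt_between in Hyv.
      destruct (Hlab k Hk) as [H|[H|[H|H]]]; eexists; eexists; (split; [exact H|]);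
        apply Hpos; try (apply Hpx; lia); try (apply Hpy; lia); apply Rabs_lt_between; lra. }
    destruct (Hcorner 0%nat) as [x0 [y0 [L0 P0]]]; [lia|].
    destruct (Hcorner 1%nat) as [x1 [y1 [L1 P1]]]; [lia|].
    destruct (Hcorner 2%nat) as [x2 [y2 [L2 P2]]]; [lia|].
    unfold lab in L0, L1, L2.
    destruct (Rlt_dec (g x0 y0) 0) as [G0|G0]; [|destruct (Rlt_dec (f x0 y0) 0); lia].
    destruct (Rlt_dec (g x1 y1) 0) as [G1|G1]; [lia|destruct (Rlt_dec (f x1 y1) 0) as [F1|F1]; [|lia]].
    destruct (Rlt_dec (g x2 y2) 0) as [G2|G2]; [lia|destruct (Rlt_dec (f x2 y2) 0) as [F2|F2]; [lia|]].
    destruct Hh as [->| ->]; nra.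
Qed.

(** * The flow in polar coordinates *)

Ltac derive_facts :=
  repeat match goal with
  | H : is_derive ?f ?t ?l |- context [Derive (fun x => ?g x) ?t] =>
      unify f g; change (Derive (fun x => g x) t) with (Derive f t);
      rewrite (is_derive_unique f t l H)
  end.

Ltac derive_side := repeat split; try (eexists; eassumption); try lra.

Lemma continuous_bounded (f : R -> R) (a b : R) :
  a <= b -> (forall t, a <= t <= b -> continuous f t) ->
  exists N, forall t, a <= t <= b -> Rabs (f t) <= N.
Proof.
  intros Hab Hc.
  destruct (continuity_ab_maj (fun t => Rabs (f t)) a b Hab) as [m [Hm _]].
  { intros c Hc'. apply (continuity_pt_comp f Rabs).
    - apply continuity_pt_filterlim, Hc, Hc'.
    - apply Rcontinuity_abs. }
  exists (Rabs (f m)); exact Hm.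
Qed.

Lemma continuous_positive_min (f : R -> R) (a b : R) :
  a <= b -> (forall t, a <= t <= b -> continuous f t) ->
  (forall t, a <= t <= b -> 0 < f t) ->
  exists m, 0 < m /\ forall t, a <= t <= b -> m <= f t.
Proof.
  intros Hab Hc Hp.
  destruct (continuity_ab_min f a b Hab) as [m [Hm Hm']].
  { intros c Hc'. apply continuity_pt_filterlim, Hc, Hc'. }
  exists (f m); split; [apply Hp, Hm' | exact Hm].
Qed.

Inductive coord := Rad | Ang | Vel | Mom.

(* [Vel] is the radial velocity and [Mom] the angular momentum. *)
Definition polar_rhs (d : R -> R -> R) (i : coord) (z : coord -> R) : R :=
  match i with
  | Rad => z Vel
  | Ang => z Mom / z Rad ^ 2
  | Vel => z Mom ^ 2 / z Rad ^ 3 - 1 / z Rad ^ 2 - d (z Rad) (z Ang) * z Vel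
  | Mom => - d (z Rad) (z Ang) * z Mom
  end.

Definition polar_sol (d : R -> R -> R) (tau : R) (y : coord -> R -> R) : Prop :=
  forall t, 0 <= t <= tau -> 0 < y Rad t /\
    forall i, is_derive (y i) t (polar_rhs d i (fun j => y j t)).

(** The Lipschitz constant may blow up as the annulus degenerates, but it is uniform in the angle,
    which runs over the whole line. *)
Definition polar_damping (d : R -> R -> R) (M : R) : Prop :=
  0 <= M /\
  (forall r th, 0 < r -> 0 <= d r th <= M) /\
  (forall K, 1 <= K -> exists L, 0 <= L /\ forall r1 r2 th1 th2,
     / K <= r1 <= K -> / K <= r2 <= K ->
     Rabs (d r1 th1 - d r2 th2) <= L * (Rabs (r1 - r2) + Rabs (th1 - th2))).

(** These functions form an algebra, boundedness being what keeps products Lipschitz; the truncated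
    field is checked by assembling its formula from clipped coordinates. *)
Definition bounded_lipschitz (F : (coord -> R) -> R) : Prop :=
  exists B L, 0 <= B /\ 0 <= L /\ (forall z, Rabs (F z) <= B) /\
    forall z z' e, (forall i, Rabs (z i - z' i) <= e) -> Rabs (F z - F z') <= L * e.

Lemma sup_dist_pos (z z' : coord -> R) e : (forall i, Rabs (z i - z' i) <= e) -> 0 <= e.
Proof. intros H; eapply Rle_trans; [apply Rabs_pos | apply (H Rad)]. Qed.

Lemma bl_opp F : bounded_lipschitz F -> bounded_lipschitz (fun z => - F z).
Proof.
  intros [B [L [HB [HL [H1 H2]]]]]; exists B, L; repeat split; trivial.
  - intros; rewrite Rabs_Ropp; trivial.
  - intros; replace (- F z - - F z') with (- (F z - F z')) by ring; rewrite Rabs_Ropp; auto.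
Qed.

Lemma bl_plus F G : bounded_lipschitz F -> bounded_lipschitz G -> bounded_lipschitz (fun z => F z + G z).
Proof.
  intros [B [L [HB [HL [H1 H2]]]]] [B' [L' [HB' [HL' [H1' H2']]]]].
  exists (B + B'), (L + L'); repeat split; try lra.
  - intros z; eapply Rle_trans; [apply Rabs_triang|]; specialize (H1 z); specialize (H1' z); lra.
  - intros z z' e He; specialize (H2 z z' e He); specialize (H2' z z' e He).
    replace (F z + G z - (F z' + G z')) with ((F z - F z') + (G z - G z')) by ring.
    eapply Rle_trans; [apply Rabs_triang|]; lra.
Qed.

Lemma bl_mult F G : bounded_lipschitz F -> bounded_lipschitz G -> bounded_lipschitz (fun z => F z * G z).
Proof.
  intros [B [L [HB [HL [H1 H2]]]]] [B' [L' [HB' [HL' [H1' H2']]]]].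
  exists (B * B'), (B * L' + L * B'); repeat split; try nra.
  - intros z; rewrite Rabs_mult; apply Rmult_le_compat; auto; apply Rabs_pos.
  - intros z z' e He; specialize (H2 z z' e He); specialize (H2' z z' e He).
    replace (F z * G z - F z' * G z') with (F z * (G z - G z') + (F z - F z') * G z') by ring.
    eapply Rle_trans; [apply Rabs_triang|]; rewrite !Rabs_mult.
    assert (Rabs (F z) * Rabs (G z - G z') <= B * (L' * e))
      by (apply Rmult_le_compat; auto; apply Rabs_pos).
    assert (Rabs (F z - F z') * Rabs (G z') <= (L * e) * B')
      by (apply Rmult_le_compat; auto; apply Rabs_pos). lra.
Qed.

Lemma bl_inv F k : 0 < k -> (forall z, k <= F z) -> bounded_lipschitz F -> bounded_lipschitz (fun z => / F z).
Proof.
  intros Hk HF [B [L [HB [HL [H1 H2]]]]].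
  assert (Hik : 0 < / k) by (apply Rinv_0_lt_compat; trivial).
  assert (HFk : forall z, 0 < / F z <= / k).
  { intros z; split; [apply Rinv_0_lt_compat | apply Rinv_le_contravar]; trivial.
    specialize (HF z); lra. }
  exists (/ k), (L * (/ k * / k)); repeat split; try nra.
  - intros z; rewrite Rabs_pos_eq; apply HFk || (left; apply HFk).
  - intros z z' e He; specialize (H2 z z' e He).
    assert (Hz := HF z); assert (Hz' := HF z').
    replace (/ F z - / F z') with (- ((F z - F z') * (/ F z * / F z'))) by (field; lra).
    rewrite Rabs_Ropp, Rabs_mult.
    rewrite (Rabs_pos_eq (/ F z * / F z')) by (generalize (HFk z) (HFk z'); nra).
    replace (L * (/ k * / k) * e) with ((L * e) * (/ k * / k)) by ring.
    apply Rmult_le_compat; trivial; try apply Rabs_pos.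
    + generalize (HFk z) (HFk z'); nra.
    + generalize (HFk z) (HFk z'); intros; apply Rmult_le_compat; lra.
Qed.

Lemma bl_ext F G : (forall z, F z = G z) -> bounded_lipschitz F -> bounded_lipschitz G.
Proof. intros H HF; replace G with F; trivial; apply functional_extensionality; trivial. Qed.

Definition clip (lo hi x : R) : R := Rmax lo (Rmin hi x).

Lemma clip_range lo hi x : lo <= hi -> lo <= clip lo hi x <= hi.
Proof.
  intros H; unfold clip, Rmax, Rmin.
  destruct (Rle_dec hi x); destruct (Rle_dec lo _); lra.
Qed.

Lemma clip_id lo hi x : lo <= x <= hi -> clip lo hi x = x.
Proof.
  intros H; unfold clip. rewrite Rmin_right, Rmax_right; lra.
Qed.

Lemma clip_lip lo hi x x' : lo <= hi -> Rabs (clip lo hi x - clip lo hi x') <= Rabs (x - x').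
Proof.
  intros H; unfold clip, Rmax, Rmin.
  destruct (Rle_dec hi x), (Rle_dec hi x');
  repeat match goal with |- context [Rle_dec ?u ?v] => destruct (Rle_dec u v) end;
  unfold Rabs;
  repeat match goal with |- context [Rcase_abs ?u] => destruct (Rcase_abs u) end; lra.
Qed.

Lemma bl_clip lo hi i : lo <= hi -> bounded_lipschitz (fun z => clip lo hi (z i)).
Proof.
  intros H; exists (Rabs lo + Rabs hi), 1; repeat split; try lra.
  - generalize (Rabs_pos lo) (Rabs_pos hi); lra.
  - intros z; generalize (clip_range lo hi (z i) H).
    unfold Rabs;
    repeat match goal with |- context [Rcase_abs ?u] => destruct (Rcase_abs u) end; lra.
  - intros z z' e He; eapply Rle_trans; [apply clip_lip; trivial|]. specialize (He i); lra.
Qed.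

(** The angle stays unclipped: it enters the field only through [d], whose Lipschitz constant on an
    annulus does not depend on it. *)
Definition clipped (K : R) (z : coord -> R) (i : coord) : R :=
  match i with
  | Rad => clip (/ K) K (z Rad)
  | Ang => z Ang
  | Vel => clip (- K) K (z Vel)
  | Mom => clip (- K) K (z Mom)
  end.

Definition in_box (K : R) (z : coord -> R) : Prop :=
  / K <= z Rad <= K /\ Rabs (z Vel) <= K /\ Rabs (z Mom) <= K.

Lemma inv_le_self K : 1 <= K -> 0 < / K <= 1.
Proof.
  intros H; split; [apply Rinv_0_lt_compat; lra|].
  rewrite <- Rinv_1; apply Rinv_le_contravar; lra.
Qed.

Lemma clipped_id K z : in_box K z -> clipped K z = z.
Proof.
  intros [H1 [H2 H3]]; apply functional_extensionality; intros [ | | | ]; simpl; trivial;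
  apply clip_id; trivial; apply Rabs_le_between; trivial.
Qed.

Section Flow.
Variables (d : R -> R -> R) (M : R).
Hypothesis Hd : polar_damping d M.

Lemma bl_clipped_rhs K i : 1 <= K -> bounded_lipschitz (fun z => polar_rhs d i (clipped K z)).
Proof.
  intros HK. assert (HiK := inv_le_self K HK).
  destruct Hd as [HM [HdM HdL]].
  assert (HR : bounded_lipschitz (fun z => clip (/ K) K (z Rad))) by (apply bl_clip; lra).
  assert (HV : bounded_lipschitz (fun z => clip (- K) K (z Vel))) by (apply bl_clip; lra).
  assert (HC : bounded_lipschitz (fun z => clip (- K) K (z Mom))) by (apply bl_clip; lra).
  assert (Hpos : forall z : coord -> R, / K <= clip (/ K) K (z Rad) <= K)
    by (intros; apply clip_range; lra).
  assert (HI : bounded_lipschitz (fun z => / clip (/ K) K (z Rad))).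
  { apply (bl_inv _ (/ K)); trivial; [lra|]. intros; apply Hpos. }
  assert (HD : bounded_lipschitz (fun z => d (clip (/ K) K (z Rad)) (z Ang))).
  { destruct (HdL K HK) as [L [HL0 HL]].
    exists M, (L * 2); repeat split; try lra.
    - intros z; assert (Hz := Hpos z).
      destruct (HdM (clip (/ K) K (z Rad)) (z Ang)); [lra|]. rewrite Rabs_pos_eq; trivial.
    - intros z z' e He. eapply Rle_trans; [apply HL; apply Hpos|].
      assert (Rabs (clip (/ K) K (z Rad) - clip (/ K) K (z' Rad)) <= e)
        by (eapply Rle_trans; [apply clip_lip; lra | apply He]).
      specialize (He Ang). nra. }
  destruct i; simpl.
  - trivial.
  - eapply bl_ext; [|apply (bl_mult _ _ HC (bl_mult _ _ HI HI))].
    intros z; specialize (Hpos z); simpl; field; lra.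
  - eapply bl_ext; [|apply (bl_plus _ _ (bl_plus _ _ (bl_mult _ _ (bl_mult _ _ HC HC)
       (bl_mult _ _ HI (bl_mult _ _ HI HI))) (bl_opp _ (bl_mult _ _ HI HI)))
       (bl_opp _ (bl_mult _ _ HD HV)))].
    intros z; specialize (Hpos z); simpl; field; lra.
  - eapply bl_ext; [|apply (bl_opp _ (bl_mult _ _ HD HC))].
    intros z; simpl; ring.
Qed.

Definition clipped_sol K tau (y : coord -> R -> R) : Prop :=
  forall i t, 0 <= t <= tau -> is_derive (y i) t (polar_rhs d i (clipped K (fun j => y j t))).

Lemma clipped_flow K : 1 <= K -> exists L, 1 <= L /\
  (forall y0, exists y, (forall i, y i 0 = y0 i) /\ forall tau, clipped_sol K tau y) /\
  (forall y z tau e, clipped_sol K tau y -> clipped_sol K tau z ->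
     (forall i, Rabs (y i 0 - z i 0) <= e) ->
     forall i t, 0 <= t <= tau -> Rabs (y i t - z i t) <= 2 * e * exp (2 * L * t)).
Proof.
  intros HK.
  destruct (bl_clipped_rhs K Rad HK) as [B1 [L1 [HB1 [HL1 [H1 H1']]]]].
  destruct (bl_clipped_rhs K Ang HK) as [B2 [L2 [HB2 [HL2 [H2 H2']]]]].
  destruct (bl_clipped_rhs K Vel HK) as [B3 [L3 [HB3 [HL3 [H3 H3']]]]].
  destruct (bl_clipped_rhs K Mom HK) as [B4 [L4 [HB4 [HL4 [H4 H4']]]]].
  set (f := fun i z => polar_rhs d i (clipped K z)).
  set (B := B1 + B2 + B3 + B4). set (L := 1 + L1 + L2 + L3 + L4).
  assert (HB : forall i y, Rabs (f i y) <= B).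
  { unfold B; intros [ | | | ] y; unfold f;
    specialize (H1 y); specialize (H2 y); specialize (H3 y); specialize (H4 y); lra. }
  assert (HL : forall i y z e, (forall j, Rabs (y j - z j) <= e) -> Rabs (f i y - f i z) <= L * e).
  { unfold L; intros i y z e He; assert (He0 := sup_dist_pos _ _ _ He).
    destruct i; unfold f;
    [specialize (H1' y z e He) | specialize (H2' y z e He)
    |specialize (H3' y z e He) | specialize (H4' y z e He)];
    eapply Rle_trans; try eassumption; apply Rmult_le_compat_r; lra. }
  assert (HL0 : 1 <= L) by (unfold L; lra).
  exists L; split; [trivial|split].
  - intros y0. destruct (picard_existence coord f B L HL0 HB HL y0) as [y [Hy0 Hy]].
    exists y; split; trivial. intros tau i t Ht; apply Hy; lra.
  - intros y z tau e Hy Hz He. exact (initial_dependence coord f B L HL0 HB HL y z tau e Hy Hz He).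
Qed.

Lemma sol_clipped K tau y : polar_sol d tau y ->
  (forall t, 0 <= t <= tau -> in_box K (fun j => y j t)) -> clipped_sol K tau y.
Proof.
  intros Hy Hb i t Ht. rewrite clipped_id by auto. apply Hy; trivial.
Qed.

Lemma clipped_sol_sol K tau y : 1 <= K -> clipped_sol K tau y ->
  (forall t, 0 <= t <= tau -> in_box K (fun j => y j t)) -> polar_sol d tau y.
Proof.
  intros HK Hy Hb t Ht. destruct (inv_le_self K HK) as [HiK _].
  destruct (Hb t Ht) as [Hr _]. split; [lra|].
  intros i. rewrite <- (clipped_id K (fun j => y j t)) by auto. apply Hy; trivial.
Qed.

Lemma sol_cont tau y i t : polar_sol d tau y -> 0 <= t <= tau -> continuous (y i) t.
Proof. intros Hy Ht; destruct (Hy t Ht) as [_ H]; exact (is_derive_cont _ _ _ (H i)). Qed.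

Lemma sol_restrict tau tau' y : tau' <= tau -> polar_sol d tau y -> polar_sol d tau' y.
Proof. intros H Hy t Ht; apply Hy; lra. Qed.

Lemma sol_bounds tau y : 0 <= tau -> polar_sol d tau y -> exists m N, 0 < m /\
  forall t, 0 <= t <= tau -> m <= y Rad t /\ forall i, Rabs (y i t) <= N.
Proof.
  intros Ht Hy.
  assert (Hc : forall i t, 0 <= t <= tau -> continuous (y i) t)
    by (intros; eapply sol_cont; eauto).
  destruct (continuous_positive_min (y Rad) 0 tau Ht (Hc Rad)) as [m [Hm Hm']].
  { intros t H; apply Hy; trivial. }
  destruct (continuous_bounded (y Rad) 0 tau Ht (Hc Rad)) as [N1 H1].
  destruct (continuous_bounded (y Ang) 0 tau Ht (Hc Ang)) as [N2 H2].
  destruct (continuous_bounded (y Vel) 0 tau Ht (Hc Vel)) as [N3 H3].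
  destruct (continuous_bounded (y Mom) 0 tau Ht (Hc Mom)) as [N4 H4].
  exists m, (N1 + N2 + N3 + N4); split; trivial. intros t H; split; [auto|].
  specialize (H1 t H); specialize (H2 t H); specialize (H3 t H); specialize (H4 t H).
  generalize (Rabs_pos (y Rad t)) (Rabs_pos (y Ang t)) (Rabs_pos (y Vel t)) (Rabs_pos (y Mom t)).
  intros; destruct i; lra.
Qed.

Lemma box_of_bounds m N : 0 < m -> exists K, 1 <= K /\
  forall z, m <= z Rad -> (forall i, Rabs (z i) <= N) -> in_box K z.
Proof.
  intros Hm; exists (1 + / m + Rabs N).
  assert (0 < / m) by (apply Rinv_0_lt_compat; trivial).
  assert (0 <= Rabs N) by apply Rabs_pos.
  assert (N <= Rabs N) by apply Rle_abs.
  split; [lra|]. intros z Hz HN; repeat split.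
  - eapply Rle_trans; [|apply Hz]. rewrite <- (Rinv_inv m) at 2.
    apply Rinv_le_contravar; lra.
  - specialize (HN Rad); apply Rabs_le_between in HN; lra.
  - specialize (HN Vel); lra.
  - specialize (HN Mom); lra.
Qed.

(** The box contains a tube around [y]. A nearby solution of the truncated system stays in the tube,
    hence never feels the truncation; in particular it lives up to [tau] as a genuine solution. *)
Lemma sol_continuous_dependence tau y e : 0 <= tau -> 0 < e -> polar_sol d tau y ->
  exists delta, 0 < delta /\ forall z0, (forall i, Rabs (z0 i - y i 0) <= delta) ->
    exists z, polar_sol d tau z /\ (forall i, z i 0 = z0 i) /\
      forall i t, 0 <= t <= tau -> Rabs (z i t - y i t) <= e.
Proof.
  intros Htau He Hy. destruct (sol_bounds tau y Htau Hy) as [m [N [Hm Hb]]].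
  destruct (box_of_bounds (m / 2) (N + m / 2)) as [K [HK Hbox]]; [lra|].
  destruct (clipped_flow K HK) as [L [HL [Hex Hdep]]].
  set (e' := Rmin e (m / 2)).
  assert (He' : 0 < e') by (unfold e'; apply Rmin_glb_lt; lra).
  assert (He1 : e' <= e) by apply Rmin_l. assert (He2 : e' <= m / 2) by apply Rmin_r.
  assert (HE := exp_pos (2 * L * tau)).
  exists (e' / 2 / exp (2 * L * tau)); split.
  { apply Rdiv_lt_0_compat; lra. }
  intros z0 Hz0. destruct (Hex z0) as [z [Hz1 Hz2]].
  assert (Hys : clipped_sol K tau y).
  { apply sol_clipped; trivial. intros t Ht. destruct (Hb t Ht) as [H1 H2].
    apply Hbox; [lra|]. intros i; specialize (H2 i); lra. }
  assert (Hclose : forall i t, 0 <= t <= tau -> Rabs (z i t - y i t) <= e').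
  { intros i t Ht. eapply Rle_trans.
    - apply (Hdep z y tau (e' / 2 / exp (2 * L * tau))); trivial.
      intros j; rewrite Hz1; apply Hz0.
    - assert (exp (2 * L * t) <= exp (2 * L * tau)).
      { destruct (Req_dec t tau) as [->|]; [lra|]. left; apply exp_increasing; nra. }
      apply Rle_trans with (2 * (e' / 2 / exp (2 * L * tau)) * exp (2 * L * tau)).
      + apply Rmult_le_compat_l; trivial.
        assert (0 < e' / 2 / exp (2 * L * tau)) by (apply Rdiv_lt_0_compat; lra). lra.
      + right; field; lra. }
  exists z; split; [|split]; trivial.
  - apply (clipped_sol_sol K); trivial.
    intros t Ht; destruct (Hb t Ht) as [H1 H2]. apply Hbox.
    + specialize (Hclose Rad t Ht); apply Rabs_le_between in Hclose; lra.
    + intros i; specialize (Hclose i t Ht); specialize (H2 i).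
      replace (z i t) with ((z i t - y i t) + y i t) by ring.
      eapply Rle_trans; [apply Rabs_triang|]; lra.
  - intros i t Ht; specialize (Hclose i t Ht); lra.
Qed.

Lemma sol_unique tau y z : polar_sol d tau y -> polar_sol d tau z ->
  (forall i, y i 0 = z i 0) -> forall i t, 0 <= t <= tau -> y i t = z i t.
Proof.
  intros Hy Hz H0 i t Ht.
  destruct (sol_bounds tau y ltac:(lra) Hy) as [m [N [Hm Hb]]].
  destruct (sol_bounds tau z ltac:(lra) Hz) as [m' [N' [Hm' Hb']]].
  assert (Hmm : 0 < Rmin m m') by (apply Rmin_glb_lt; trivial).
  destruct (box_of_bounds (Rmin m m') (Rmax N N')) as [K [HK Hbox]]; trivial.
  destruct (clipped_flow K HK) as [L [HL [_ Hdep]]].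
  assert (H : Rabs (y i t - z i t) <= 2 * 0 * exp (2 * L * t)).
  { apply (Hdep y z tau); trivial.
    - apply sol_clipped; trivial. intros s Hs; destruct (Hb s Hs) as [H1 H2]; apply Hbox.
      + eapply Rle_trans; [apply Rmin_l | trivial].
      + intros j; eapply Rle_trans; [apply H2 | apply Rmax_l].
    - apply sol_clipped; trivial. intros s Hs; destruct (Hb' s Hs) as [H1 H2]; apply Hbox.
      + eapply Rle_trans; [apply Rmin_r | trivial].
      + intros j; eapply Rle_trans; [apply H2 | apply Rmax_r].
    - intros j; rewrite H0, Rminus_diag, Rabs_R0; lra. }
  rewrite Rmult_0_r, Rmult_0_l in H.
  destruct (Req_dec (y i t - z i t) 0) as [|Hne]; [lra|].
  apply Rabs_pos_lt in Hne; lra.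
Qed.

Lemma sol_at tau y t : polar_sol d tau y -> 0 <= t <= tau ->
  0 < y Rad t /\ 0 <= d (y Rad t) (y Ang t) <= M /\
  is_derive (y Rad) t (y Vel t) /\ is_derive (y Ang) t (y Mom t / y Rad t ^ 2) /\
  is_derive (y Vel) t (y Mom t ^ 2 / y Rad t ^ 3 - 1 / y Rad t ^ 2
                       - d (y Rad t) (y Ang t) * y Vel t) /\
  is_derive (y Mom) t (- d (y Rad t) (y Ang t) * y Mom t).
Proof.
  intros Hy Ht; destruct (Hy t Ht) as [Hr H]. destruct Hd as [_ [HdM _]].
  split; [trivial|]. split; [apply HdM; trivial|].
  exact (conj (H Rad) (conj (H Ang) (conj (H Vel) (H Mom)))).
Qed.

(** * Energy and angular momentum *)

Definition energy (y : coord -> R -> R) (t : R) : R :=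
  y Vel t ^ 2 / 2 + y Mom t ^ 2 / (2 * y Rad t ^ 2) - 1 / y Rad t.

Lemma energy_deriv tau y t : polar_sol d tau y -> 0 <= t <= tau ->
  is_derive (energy y) t
    (- d (y Rad t) (y Ang t) * (y Vel t ^ 2 + y Mom t ^ 2 / y Rad t ^ 2)).
Proof.
  intros Hy Ht; destruct (sol_at tau y t Hy Ht) as [Hr [_ [H1 [H2 [H3 H4]]]]].
  unfold energy. auto_derive.
  - derive_side. generalize (pow_lt (y Rad t) 2 Hr); simpl; lra.
  - derive_facts. field; lra.
Qed.

Lemma energy_decr tau y s t : polar_sol d tau y -> 0 <= s <= t -> t <= tau ->
  energy y t <= energy y s.
Proof.
  intros Hy Hs Ht.
  assert (- energy y s <= - energy y t); [|lra].
  apply (incr_of_deriv (fun t => - energy y t)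
    (fun t => - (- d (y Rad t) (y Ang t) * (y Vel t ^ 2 + y Mom t ^ 2 / y Rad t ^ 2)))); [lra|..].
  - intros u Hu; apply (is_derive_opp (V := R_NormedModule)), (energy_deriv tau); trivial; lra.
  - intros u Hu; destruct (sol_at tau y u Hy ltac:(lra)) as [Hr [Hdd _]].
    assert (0 <= y Mom u ^ 2 / y Rad u ^ 2).
    { apply Rdiv_le_0_compat; [apply pow2_ge_0 | apply pow_lt; trivial]. }
    assert (0 <= y Vel u ^ 2) by apply pow2_ge_0. nra.
Qed.

Lemma mom_sq_decr tau y t : polar_sol d tau y -> 0 <= t <= tau -> y Mom t ^ 2 <= y Mom 0 ^ 2.
Proof.
  intros Hy Ht.
  assert (- y Mom 0 ^ 2 <= - y Mom t ^ 2); [|lra].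
  apply (incr_of_deriv (fun t => - y Mom t ^ 2)
    (fun t => 2 * d (y Rad t) (y Ang t) * y Mom t ^ 2)); [lra|..].
  - intros u Hu; destruct (sol_at tau y u Hy ltac:(lra)) as [Hr [_ [H1 [H2 [H3 H4]]]]].
    auto_derive; [derive_side | derive_facts; ring].
  - intros u Hu; destruct (sol_at tau y u Hy ltac:(lra)) as [Hr [Hdd _]].
    assert (0 <= y Mom u ^ 2) by apply pow2_ge_0. nra.
Qed.

(** As long as c is nonnegative, c' >= - M c makes c exp(M t) nondecreasing; this excludes a first
    zero of c and then gives the bound. *)
Lemma mom_lower tau y s t : polar_sol d tau y -> 0 <= s <= t -> t <= tau -> 0 < y Mom s ->
  y Mom s * exp (- M * (t - s)) <= y Mom t.
Proof.
  intros Hy Hs Ht Hc.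
  assert (Hinc : forall u, s <= u <= t -> (forall v, s <= v <= u -> 0 <= y Mom v) ->
    y Mom s <= y Mom u * exp (M * (u - s))).
  { intros u Hu Hv.
    replace (y Mom s) with (y Mom s * exp (M * (s - s))) by (rewrite Rminus_diag, Rmult_0_r, exp_0; ring).
    apply (incr_of_deriv (fun u => y Mom u * exp (M * (u - s)))
      (fun u => (M - d (y Rad u) (y Ang u)) * y Mom u * exp (M * (u - s)))); [lra|..].
    - intros w Hw; destruct (sol_at tau y w Hy ltac:(lra)) as [Hr [_ [H1 [H2 [H3 H4]]]]].
      auto_derive; [derive_side | derive_facts; unfold Rminus; ring].
    - intros w Hw; destruct (sol_at tau y w Hy ltac:(lra)) as [Hr [Hdd _]].
      apply Rmult_le_pos; [|left; apply exp_pos].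
      apply Rmult_le_pos; [lra | apply Hv; lra]. }
  destruct (first_zero (y Mom) s t) as [Hpos | [t1 [Ht1 [Hz Hpos]]]]; try lra.
  { intros u Hu; apply (sol_cont tau); trivial; lra. }
  - assert (H := Hinc t ltac:(lra) ltac:(intros; left; apply Hpos; lra)).
    apply (Rmult_le_compat_r (exp (- M * (t - s)))) in H; [|left; apply exp_pos].
    rewrite Rmult_assoc, <- exp_plus in H.
    replace (M * (t - s) + - M * (t - s)) with 0 in H by ring.
    rewrite exp_0 in H; lra.
  - assert (H := Hinc t1 ltac:(lra)).
    assert (y Mom s <= y Mom t1 * exp (M * (t1 - s))); [|rewrite Hz in *; lra].
    apply H; intros v Hv; destruct (Req_dec v t1) as [->|]; [lra|]. left; apply Hpos; lra.
Qed.

Lemma speed_bound tau y t : polar_sol d tau y -> 0 <= t <= tau ->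
  y Vel t ^ 2 + y Mom t ^ 2 / y Rad t ^ 2 <= 2 * energy y 0 + 2 / y Rad t.
Proof.
  intros Hy Ht. assert (H := energy_decr tau y 0 t Hy ltac:(lra) ltac:(lra)).
  destruct (sol_at tau y t Hy Ht) as [Hr _].
  unfold energy at 1 in H.
  replace (y Vel t ^ 2 + y Mom t ^ 2 / y Rad t ^ 2) with
    (2 * (y Vel t ^ 2 / 2 + y Mom t ^ 2 / (2 * y Rad t ^ 2) - 1 / y Rad t) + 2 / y Rad t)
    by (field; lra). lra.
Qed.

End Flow.

(** * A priori estimates *)

Lemma continuous_Rmin (f g : R -> R) (t : R) :
  continuous f t -> continuous g t -> continuous (fun s => Rmin (f s) (g s)) t.
Proof.
  rewrite !continuous_eps; intros Hf Hg eps He.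
  destruct (Hf eps He) as [d1 [Hd1 H1]], (Hg eps He) as [d2 [Hd2 H2]].
  exists (Rmin d1 d2); split; [apply Rmin_glb_lt; trivial|].
  intros s Hs.
  specialize (H1 s (Rlt_le_trans _ _ _ Hs (Rmin_l _ _))).
  specialize (H2 s (Rlt_le_trans _ _ _ Hs (Rmin_r _ _))).
  apply Rabs_lt_between in H1. apply Rabs_lt_between in H2. apply Rabs_lt_between.
  unfold Rmin; destruct (Rle_dec (f s) (g s)), (Rle_dec (f t) (g t)); lra.
Qed.

Lemma continuous_Rabs_comp (f : R -> R) (t : R) :
  continuous f t -> continuous (fun s => Rabs (f s)) t.
Proof.
  rewrite !continuous_eps; intros Hf eps He.
  destruct (Hf eps He) as [d1 [Hd1 H1]]. exists d1; split; trivial.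
  intros s Hs; eapply Rle_lt_trans; [apply Rabs_triang_inv2 | auto].
Qed.

(** Looking back in time from a negative value at [b] to the last zero, one finds [f] nonpositive,
    hence nondecreasing, in between; so the value at [b] cannot lie below that zero. *)
Lemma stays_nonneg (f df : R -> R) (a b : R) :
  a <= b -> (forall t, a <= t <= b -> is_derive f t (df t)) ->
  (forall t, a <= t <= b -> f t <= 0 -> 0 <= df t) -> 0 <= f a -> 0 <= f b.
Proof.
  intros Hab Hd Hp Ha. apply Rnot_lt_le; intros Hb.
  destruct (first_zero (fun t => - f (b - t)) 0 (b - a)) as [H | [t1 [Ht1 [Hz H]]]]; try lra.
  - intros t Ht.
    apply (is_derive_cont _ _ (df (b - t))).
    assert (H := Hd (b - t) ltac:(lra)).
    evar_last. { apply (is_derive_opp (V := R_NormedModule)).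
      apply (is_derive_comp f (fun t => b - t)); [exact H|].
      apply (is_derive_minus (V := R_NormedModule)); [apply is_derive_const | apply is_derive_id]. }
    unfold minus, plus, opp, scal, zero, one, mult; simpl; unfold mult; simpl; ring.
  - rewrite Rminus_0_r; lra.
  - specialize (H (b - a) ltac:(lra)). replace (b - (b - a)) with a in H by ring. lra.
  - assert (f (b - t1) <= f b); [|lra].
    apply (incr_of_deriv f df); [lra | intros; apply Hd; lra|].
    intros t Ht; apply Hp; [lra|].
    destruct (Req_dec t (b - t1)) as [->|]; [lra|].
    specialize (H (b - t) ltac:(lra)). replace (b - (b - t)) with t in H by ring. lra.
Qed.

Lemma sq_le_self (x V : R) : 1 <= V -> x ^ 2 <= V -> Rabs x <= V.
Proof. intros HV Hx. apply Rabs_le; split; nra. Qed.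

Lemma sq_le_sqrt (x A : R) : x ^ 2 <= A -> Rabs x <= sqrt A.
Proof.
  intros H. rewrite <- sqrt_Rsqr_abs. apply sqrt_le_1_alt. unfold Rsqr; simpl in H; lra.
Qed.

(** Young's inequality s <= lam s^2 + 1/lam, with [lam] so small that the part linear in E costs at
    most half of k E. The summand 3 provides the margin for a bootstrap on the energy. *)
Lemma sqrt_sublinear (k n al be : R) : 0 < k -> 0 <= n -> 0 <= al -> 0 <= be ->
  exists E0, 1 <= E0 /\ forall E, E0 <= E -> n * sqrt (al * E + be) + 3 <= k * E.
Proof.
  intros Hk Hn Hal Hbe.
  set (lam := k / (2 * (n * al + 1))).
  assert (Hna : 0 <= n * al) by nra.
  assert (Hlam : 0 < lam) by (unfold lam; apply Rdiv_lt_0_compat; lra).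
  assert (Hil : 0 < / lam) by (apply Rinv_0_lt_compat; trivial).
  assert (Hl1 : n * al * lam <= k / 2).
  { unfold lam. replace (n * al * (k / (2 * (n * al + 1)))) with (k / 2 * (n * al / (n * al + 1))) by (field; lra).
    assert (n * al / (n * al + 1) <= 1) by (apply Rle_div_l; lra). nra. }
  set (C := n * (lam * be) + n * / lam + 3).
  assert (HC : 0 <= C).
  { assert (0 <= n * (lam * be)) by (apply Rmult_le_pos; nra). unfold C; nra. }
  exists (1 + 2 * C / k).
  assert (0 <= 2 * C / k) by (apply Rdiv_le_0_compat; lra).
  split; [lra|]. intros E HE.
  assert (HE' : 2 * C <= k * E).
  { assert (2 * C / k <= E) by lra. apply Rle_div_l in H0; lra. }
  assert (Hx : 0 <= al * E + be) by nra.
  set (s := sqrt (al * E + be)).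
  assert (Hs2 : s * s = al * E + be) by (apply sqrt_sqrt; trivial).
  assert (Hs : s <= lam * (s * s) + / lam).
  { assert (lam * / lam = 1) by (field; lra). assert (0 <= (lam * s - 1) ^ 2) by apply pow2_ge_0.
    assert (0 <= s) by apply sqrt_pos.
    assert (lam * s <= lam * (lam * (s * s) + / lam)) by nra.
    apply (Rmult_le_reg_l lam); trivial. }
  rewrite Hs2 in Hs.
  assert (n * s <= n * (lam * (al * E + be) + / lam)) by (apply Rmult_le_compat_l; trivial).
  assert (n * al * lam * E <= k / 2 * E) by (apply Rmult_le_compat_r; lra).
  unfold C in *. nra.
Qed.

Definition init (r th p c : R) (i : coord) : R :=
  match i with Rad => r | Ang => th | Vel => p | Mom => c end.

Section Estimates.
Variables (d : R -> R -> R) (M : R).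
Hypothesis Hd : polar_damping d M.

Lemma apriori tau y eps t : polar_sol d tau y -> 0 < eps ->
  (forall s, 0 <= s <= tau -> eps <= y Rad s) -> 0 <= t <= tau ->
  Rabs (y Vel t) <= 1 + 2 * Rabs (energy y 0) + 2 / eps /\
  y Rad t <= y Rad 0 + (1 + 2 * Rabs (energy y 0) + 2 / eps) * t /\
  Rabs (y Mom t) <= Rabs (y Mom 0).
Proof.
  intros Hy Heps Hr Ht.
  set (V := 1 + 2 * Rabs (energy y 0) + 2 / eps).
  assert (HV : 1 <= V).
  { unfold V; generalize (Rabs_pos (energy y 0)) (Rdiv_lt_0_compat 2 eps); lra. }
  assert (Hvel : forall s, 0 <= s <= tau -> Rabs (y Vel s) <= V).
  { intros s Hs. apply sq_le_self; trivial.
    assert (H := speed_bound d M Hd tau y s Hy Hs). assert (Hrs := Hr s Hs).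
    assert (0 <= y Mom s ^ 2 / y Rad s ^ 2)
      by (apply Rdiv_le_0_compat; [apply pow2_ge_0 | apply pow_lt; lra]).
    assert (2 / y Rad s <= 2 / eps).
    { apply Rmult_le_compat_l; [lra|]. apply Rinv_le_contravar; lra. }
    unfold V; generalize (Rle_abs (energy y 0)); lra. }
  split; [auto|split].
  - assert (Rabs (y Rad t - y Rad 0) <= V * t - V * 0).
    { apply (deriv_bound (y Rad) (y Vel) (fun t => V * t) (fun _ => V)); [lra|..].
      - intros s Hs; apply (sol_at d M Hd tau y s Hy); lra.
      - intros s Hs; auto_derive; trivial; ring.
      - intros s Hs; apply Hvel; lra. }
    apply Rabs_le_between in H; lra.
  - apply Rsqr_le_abs_0. generalize (mom_sq_decr d M Hd tau y t Hy Ht); unfold Rsqr; simpl; lra.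
Qed.

(** The truncation box is built from the a priori bounds with room to spare, so the only face
    through which the solution can leave is r = [eps]. *)
Lemma continuation (z0 : coord -> R) (tau eps : R) :
  0 < eps < z0 Rad -> 0 <= tau ->
  exists tau1 y, 0 <= tau1 <= tau /\ polar_sol d tau1 y /\ (forall i, y i 0 = z0 i) /\
    (forall t, 0 <= t <= tau1 -> eps <= y Rad t) /\ (tau1 = tau \/ y Rad tau1 = eps).
Proof.
  intros Heps Htau.
  set (E0 := energy (fun i _ => z0 i) 0).
  set (V := 1 + 2 * Rabs E0 + 2 / eps).
  assert (Hi : 0 < / eps) by (apply Rinv_0_lt_compat; lra).
  assert (HV : 1 <= V).
  { unfold V, Rdiv; generalize (Rabs_pos E0); lra. }
  set (K := 1 + z0 Rad + V * (1 + tau) + Rabs (z0 Mom) + / eps).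
  assert (HcM := Rabs_pos (z0 Mom)).
  assert (HVt : 0 <= V * tau) by nra.
  assert (HK : 1 <= K) by (unfold K; lra).
  assert (HKe : / K <= eps).
  { rewrite <- (Rinv_inv eps). apply Rinv_le_contravar; trivial. unfold K; lra. }
  destruct (clipped_flow d M Hd K HK) as [L [HL [Hex _]]].
  destruct (Hex z0) as [y [Hy0 Hy]].
  assert (HE0 : energy y 0 = E0) by (unfold energy, E0, energy; rewrite !Hy0; reflexivity).
  (* [g] collects the distances to all faces of the box, with [eps] as the lower face for the
     radius. At a first zero of [g] the a priori bounds keep every entry but the first positive. *)
  set (g := fun t => Rmin (y Rad t - eps) (Rmin (K - y Rad t)
     (Rmin (K - Rabs (y Vel t)) (K - Rabs (y Mom t))))).
  assert (Hbox : forall t, 0 <= g t -> eps <= y Rad t /\ in_box K (fun j => y j t)).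
  { intros t Hg; unfold g in Hg.
    assert (H1 := Rle_trans _ _ _ Hg (Rmin_l _ _)).
    assert (H2 := Rle_trans _ _ _ Hg (Rmin_r _ _)).
    assert (H3 := Rle_trans _ _ _ H2 (Rmin_l _ _)).
    assert (H4 := Rle_trans _ _ _ H2 (Rmin_r _ _)).
    assert (H5 := Rle_trans _ _ _ H4 (Rmin_l _ _)).
    assert (H6 := Rle_trans _ _ _ H4 (Rmin_r _ _)).
    unfold in_box; lra. }
  assert (Hsol : forall t1, (forall t, 0 <= t <= t1 -> 0 <= g t) -> polar_sol d t1 y).
  { intros t1 Hg; apply (clipped_sol_sol d K); trivial. intros t Ht; apply Hbox, Hg, Ht. }
  assert (Hcy : forall i t, 0 <= t <= tau -> continuous (y i) t).
  { intros i t Ht; eapply is_derive_cont; apply (Hy tau i t Ht). }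
  assert (Hg0 : 0 < g 0).
  { unfold g; rewrite !Hy0.
    apply Rmin_glb_lt; [lra | apply Rmin_glb_lt; [unfold K; lra | apply Rmin_glb_lt; unfold K; [|lra]]].
    assert (Rabs (z0 Vel) <= V).
    { apply sq_le_self; trivial. unfold V, E0, energy.
      generalize (Rle_abs (z0 Vel ^ 2 / 2 + z0 Mom ^ 2 / (2 * z0 Rad ^ 2) - 1 / z0 Rad)); intros.
      assert (0 <= z0 Mom ^ 2 / (2 * z0 Rad ^ 2)).
      { apply Rdiv_le_0_compat; [apply pow2_ge_0|]. generalize (pow_lt (z0 Rad) 2); lra. }
      assert (1 / z0 Rad <= 1 / eps).
      { unfold Rdiv; rewrite !Rmult_1_l; apply Rinv_le_contravar; lra. }
      unfold Rdiv in *; lra. }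
    lra. }
  destruct (first_zero g 0 tau Htau) as [Hpos | [t1 [Ht1 [Hz Hpos]]]]; trivial.
  - intros t Ht; unfold g.
    apply (continuous_Rmin (fun t => y Rad t - eps)); [|apply (continuous_Rmin (fun t => K - y Rad t));
      [|apply (continuous_Rmin (fun t => K - Rabs (y Vel t)) (fun t => K - Rabs (y Mom t)))]];
    apply (continuous_minus (V := R_NormedModule));
    first [apply continuous_const | apply continuous_Rabs_comp, Hcy, Ht | apply Hcy, Ht].
  - assert (Hs : polar_sol d tau y) by (apply Hsol; intros; left; auto).
    exists tau, y; split; [lra|]. split; [trivial|]. split; [trivial|].
    split; [|left; trivial]. intros t Ht; apply Hbox; left; auto.
  - assert (Hg : forall t, 0 <= t <= t1 -> 0 <= g t).
    { intros t Ht; destruct (Req_dec t t1) as [->|]; [lra|]. left; apply Hpos; lra. }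
    assert (Hs : polar_sol d t1 y) by (apply Hsol; trivial).
    exists t1, y; split; [lra|]. split; [trivial|]. split; [trivial|].
    split; [intros t Ht; apply Hbox; auto|]. right.
    destruct (apriori t1 y eps t1 Hs) as [A1 [A2 A3]]; try lra.
    { intros; apply Hbox; auto. }
    rewrite HE0 in A1, A2; rewrite !Hy0 in *; fold V in A1, A2.
    assert (V * t1 <= V * tau) by (apply Rmult_le_compat_l; lra).
    apply NNPP; intros Hne.
    destruct (Hbox t1 (Hg t1 ltac:(lra))) as [B1 _].
    assert (0 < g t1); [|lra].
    unfold g. apply Rmin_glb_lt; [lra | apply Rmin_glb_lt; [unfold K; lra | apply Rmin_glb_lt; unfold K; lra]].
Qed.

Lemma speed_eq y t : 0 < y Rad t ->
  y Vel t ^ 2 + y Mom t ^ 2 / y Rad t ^ 2 = 2 * energy y t + 2 / y Rad t.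
Proof. intros Hr; unfold energy; field; lra. Qed.

Lemma radial_momentum_bound tau y Rmax0 t : polar_sol d tau y -> 0 <= t <= tau -> 0 <= energy y 0 ->
  y Rad t <= Rmax0 -> Rabs (y Rad t * y Vel t) <= sqrt (2 * Rmax0 ^ 2 * energy y 0 + 2 * Rmax0).
Proof.
  intros Hy Ht HE Hr. apply sq_le_sqrt.
  assert (Hr0 : 0 < y Rad t) by (apply Hy; trivial).
  assert (H := speed_bound d M Hd tau y t Hy Ht).
  assert (0 <= y Mom t ^ 2 / y Rad t ^ 2)
    by (apply Rdiv_le_0_compat; [apply pow2_ge_0 | apply pow_lt; lra]).
  replace ((y Rad t * y Vel t) ^ 2) with (y Rad t ^ 2 * y Vel t ^ 2) by ring.
  apply Rle_trans with (y Rad t ^ 2 * (2 * energy y 0 + 2 / y Rad t)).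
  - apply Rmult_le_compat_l; [apply pow2_ge_0 | lra].
  - replace (y Rad t ^ 2 * (2 * energy y 0 + 2 / y Rad t))
      with (y Rad t ^ 2 * (2 * energy y 0) + 2 * y Rad t) by (field; lra).
    assert (y Rad t ^ 2 <= Rmax0 ^ 2) by (apply pow_incr; lra). nra.
Qed.

(** The Lagrange-Jacobi (virial) identity with friction: positive energy drives r r' upwards. *)
Lemma radial_momentum_deriv tau y t : polar_sol d tau y -> 0 <= t <= tau ->
  is_derive (fun t => y Rad t * y Vel t) t
    (2 * energy y t + 1 / y Rad t - d (y Rad t) (y Ang t) * (y Rad t * y Vel t)).
Proof.
  intros Hy Ht; destruct (sol_at d M Hd tau y t Hy Ht) as [Hr [_ [H1 [H2 [H3 H4]]]]].
  auto_derive; [derive_side|]. derive_facts. unfold energy; field; lra.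
Qed.

(* The virial-type quantity g = r r'/(1+r) stays of the order of the speed, while
   1/r <= g' + d g + 1; so the energy lost to friction near a collision is lower order. *)
Lemma energy_lower tau y t : polar_sol d tau y -> 0 <= t <= tau ->
  (forall s, 0 <= s <= t -> 1 <= energy y s) ->
  exp (- (2 * M * t)) * energy y 0 - 5 * M * sqrt (2 * energy y 0 + 2) - 1 <= energy y t.
Proof.
  intros Hy Ht HE.
  destruct Hd as [HM _].
  set (B := sqrt (2 * energy y 0 + 2)).
  assert (HB0 : 0 <= B) by apply sqrt_pos.
  set (g := fun s => y Rad s * y Vel s / (1 + y Rad s)).
  assert (Hg : forall s, 0 <= s <= t -> Rabs (g s) <= B).
  { intros s Hs; apply sq_le_sqrt; unfold g.
    assert (Hr : 0 < y Rad s) by (apply Hy; lra).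
    assert (H := speed_bound d M Hd tau y s Hy ltac:(lra)).
    assert (0 <= y Mom s ^ 2 / y Rad s ^ 2)
      by (apply Rdiv_le_0_compat; [apply pow2_ge_0 | apply pow_lt; lra]).
    assert (HE0 := HE 0 ltac:(lra)).
    replace ((y Rad s * y Vel s / (1 + y Rad s)) ^ 2) with
      (y Rad s ^ 2 * y Vel s ^ 2 / (1 + y Rad s) ^ 2) by (field; lra).
    apply Rle_div_l; [apply pow_lt; lra|].
    apply Rle_trans with (y Rad s ^ 2 * (2 * energy y 0 + 2 / y Rad s)).
    - apply Rmult_le_compat_l; [apply pow2_ge_0 | lra].
    - replace (y Rad s ^ 2 * (2 * energy y 0 + 2 / y Rad s))
        with (y Rad s ^ 2 * (2 * energy y 0) + 2 * y Rad s) by (field; lra). nra. }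
  set (dg := fun s => (y Vel s ^ 2 + y Mom s ^ 2 / y Rad s ^ 2 - 1 / y Rad s
      - d (y Rad s) (y Ang s) * (y Rad s * y Vel s)) / (1 + y Rad s)
      - y Rad s * y Vel s ^ 2 / (1 + y Rad s) ^ 2).
  assert (Hdg : forall s, 0 <= s <= t -> is_derive g s (dg s)).
  { intros s Hs; destruct (sol_at d M Hd tau y s Hy ltac:(lra)) as [Hr [_ [H1 [H2 [H3 H4]]]]].
    unfold g, dg; auto_derive; [derive_side|]. derive_facts. field; lra. }
  assert (Hinv : forall s, 0 <= s <= t ->
    1 / y Rad s <= dg s + d (y Rad s) (y Ang s) * g s + 1).
  { intros s Hs. assert (Hr : 0 < y Rad s) by (apply Hy; lra).
    assert (HEs := HE s Hs). assert (Hsp := speed_eq y s Hr).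
    assert (Hc : 0 <= y Mom s ^ 2 / y Rad s ^ 2)
      by (apply Rdiv_le_0_compat; [apply pow2_ge_0 | apply pow_lt; lra]).
    unfold dg, g. rewrite Hsp.
    replace ((2 * energy y s + 2 / y Rad s - 1 / y Rad s -
      d (y Rad s) (y Ang s) * (y Rad s * y Vel s)) / (1 + y Rad s) -
      y Rad s * y Vel s ^ 2 / (1 + y Rad s) ^ 2 +
      d (y Rad s) (y Ang s) * (y Rad s * y Vel s / (1 + y Rad s)) + 1)
    with ((2 * energy y s + 1 / y Rad s) / (1 + y Rad s)
      - y Rad s * y Vel s ^ 2 / (1 + y Rad s) ^ 2 + 1) by (field; lra).
    assert (Hv : y Rad s * y Vel s ^ 2 / (1 + y Rad s) ^ 2 <=
      y Rad s * (2 * energy y s + 2 / y Rad s) / (1 + y Rad s) ^ 2).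
    { apply Rmult_le_compat_r; [left; apply Rinv_0_lt_compat, pow_lt; lra|].
      apply Rmult_le_compat_l; lra. }
    (* The weight 1 + r and the bound E >= 1 serve to make this numerator, 2E - 2 + r + r^2,
       nonnegative. *)
    assert (Hid : (2 * energy y s + 1 / y Rad s) / (1 + y Rad s)
      - y Rad s * (2 * energy y s + 2 / y Rad s) / (1 + y Rad s) ^ 2 + 1 - 1 / y Rad s
      = (2 * energy y s + y Rad s ^ 2 + y Rad s - 2) / (1 + y Rad s) ^ 2) by (field; lra).
    assert (0 <= (2 * energy y s + y Rad s ^ 2 + y Rad s - 2) / (1 + y Rad s) ^ 2).
    { apply Rdiv_le_0_compat; [generalize (pow2_ge_0 (y Rad s)); lra | apply pow_lt; lra]. }
    lra. }
  set (N := 3 * M * B + 1).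
  assert (HMB : 0 <= M * B) by nra.
  (* Friction takes away d (2E + 2/r): the exponential factor pays for 2E, the derivative of 2 M g
     pays for 2/r, and [N] absorbs the remaining terms in g. *)
  assert (Hmono : (energy y 0 + 2 * M * g 0 + N) * exp (2 * M * 0) <=
    (energy y t + 2 * M * g t + N) * exp (2 * M * t)).
  { apply (incr_of_deriv (fun s => (energy y s + 2 * M * g s + N) * exp (2 * M * s))
     (fun s => (- d (y Rad s) (y Ang s) * (y Vel s ^ 2 + y Mom s ^ 2 / y Rad s ^ 2)
        + 2 * M * dg s + 2 * M * (energy y s + 2 * M * g s + N)) * exp (2 * M * s))); [lra|..].
    - intros s Hs. assert (H1 := energy_deriv d M Hd tau y s Hy ltac:(lra)).
      assert (H2 := Hdg s Hs).
      auto_derive; [derive_side|]. derive_facts. ring.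
    - intros s Hs. apply Rmult_le_pos; [|left; apply exp_pos].
      destruct (sol_at d M Hd tau y s Hy ltac:(lra)) as [Hr [Hdd _]].
      rewrite speed_eq by trivial.
      assert (Hi := Hinv s Hs). assert (Hgs := Hg s Hs). apply Rabs_le_between in Hgs.
      assert (HEs := HE s Hs).
      set (D := d (y Rad s) (y Ang s)) in *.
      assert (0 < 1 / y Rad s) by (apply Rdiv_lt_0_compat; lra).
      replace (2 / y Rad s) with (2 * (1 / y Rad s)) by (field; lra).
      assert (D * energy y s <= M * energy y s) by (apply Rmult_le_compat_r; lra).
      assert (D * (1 / y Rad s) <= M * (1 / y Rad s)) by (apply Rmult_le_compat_r; lra).
      assert (M * (1 / y Rad s) <= M * (dg s + D * g s + 1)) by (apply Rmult_le_compat_l; lra).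
      assert (Hx : D * g s - 2 * M * g s + 1 <= N).
      { unfold N. assert (0 <= (2 * M - D) * (g s + B)) by (apply Rmult_le_pos; lra).
        assert (0 <= D * B) by (apply Rmult_le_pos; lra). nra. }
      assert (M * (D * g s - 2 * M * g s + 1) <= M * N) by (apply Rmult_le_compat_l; lra).
      nra. }
  rewrite Rmult_0_r, exp_0, Rmult_1_r in Hmono.
  assert (Hg0 := Hg 0 ltac:(lra)). assert (Hgt := Hg t ltac:(lra)).
  apply Rabs_le_between in Hg0. apply Rabs_le_between in Hgt.
  assert (H0 : energy y 0 <= (energy y t + 5 * M * B + 1) * exp (2 * M * t)).
  { eapply Rle_trans; [|eapply Rle_trans; [apply Hmono|]].
    - unfold N; nra.
    - apply Rmult_le_compat_r; [left; apply exp_pos|]. unfold N; nra. }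
  apply (Rmult_le_compat_l (exp (- (2 * M * t)))) in H0; [|left; apply exp_pos].
  rewrite (Rmult_comm _ (exp (2 * M * t))), <- Rmult_assoc, <- exp_plus, Rplus_opp_l, exp_0 in H0.
  lra.
Qed.

(** Friction costs only O(sqrt E), so a fixed fraction of a large initial energy survives. Then r r'
    grows at a rate of order E by the virial identity, while radii up to [Rm] only allow values of r
    r' of order sqrt E; for large E the radius must therefore exceed [b] at time T. Moreover,
    outward motion stays outward as long as the energy is positive. *)
Lemma high_energy (T a b : R) : 0 < T -> 0 < a -> 0 < b -> exists E0, 1 <= E0 /\
  forall tau y, 0 <= tau <= T -> polar_sol d tau y -> y Rad 0 = a -> E0 <= energy y 0 ->
    (0 < y Vel 0 -> forall t, 0 <= t <= tau -> a <= y Rad t) /\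
    (tau = T -> b < y Rad T).
Proof.
  intros HT Ha Hb. assert (HM : 0 <= M) by apply Hd.
  set (k := exp (- (2 * M * T))). assert (Hk : 0 < k) by apply exp_pos.
  set (Rm := Rmax a b).
  assert (HRa : a <= Rm) by apply Rmax_l. assert (HRb : b <= Rm) by apply Rmax_r.
  destruct (sqrt_sublinear (k / 2) (5 * M) 2 2) as [E1 [HE1 HE1']]; try lra.
  destruct (sqrt_sublinear (T * k) (2 + M * T) (2 * Rm ^ 2) (2 * Rm)) as [E2 [HE2 HE2']]; try nra.
  exists (E1 + E2); split; [lra|].
  intros tau y Htau Hy Hya HE.
  specialize (HE1' (energy y 0) ltac:(lra)). specialize (HE2' (energy y 0) ltac:(lra)).
  assert (Hcore : forall t, 0 <= t <= tau -> (forall s, 0 <= s <= t -> 1 <= energy y s) ->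
    k / 2 * energy y 0 <= energy y t /\ 2 <= energy y t).
  { intros t Ht Hs. assert (H := energy_lower tau y t Hy Ht Hs).
    assert (k <= exp (- (2 * M * t))).
    { unfold k. destruct (Req_dec (2 * M * t) (2 * M * T)) as [->|Hne]; [lra|].
      left; apply exp_increasing. assert (2 * M * t <= 2 * M * T) by nra. lra. }
    assert (k * energy y 0 <= exp (- (2 * M * t)) * energy y 0) by (apply Rmult_le_compat_r; lra).
    assert (0 <= 5 * M * sqrt (2 * energy y 0 + 2)) by (generalize (sqrt_pos (2 * energy y 0 + 2)); nra).
    lra. }
  (* Bootstrap: as long as E >= 1, the estimate even yields E >= 2, so the level 1 is never
     reached. *)
  assert (Hall : forall t, 0 <= t <= tau -> 1 <= energy y t).
  { destruct (first_zero (fun t => energy y t - 1) 0 tau) as [Hpos | [t1 [Ht1 [Hz Hpos]]]]; try lra.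
    - intros t Ht; eapply is_derive_cont.
      apply (is_derive_minus (V := R_NormedModule)); [apply (energy_deriv d M Hd tau); trivial | apply is_derive_const].
    - intros t Ht; specialize (Hpos t Ht); lra.
    - exfalso. destruct (Hcore t1) as [_ H]; try lra.
      intros s Hs; destruct (Req_dec s t1) as [->|]; [lra|]. specialize (Hpos s ltac:(lra)); lra. }
  assert (Hbig : forall t, 0 <= t <= tau -> k / 2 * energy y 0 <= energy y t).
  { intros t Ht; apply Hcore; trivial. intros; apply Hall; lra. }
  set (G := fun t => y Rad t * y Vel t).
  assert (HGd := fun t Ht => radial_momentum_deriv tau y t Hy Ht).
  assert (HGpos : forall u t, 0 <= u <= t -> t <= tau -> 0 <= y Vel u -> 0 <= y Vel t).
  { intros u t Hu Ht Hv.
    assert (H : 0 <= G t).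
    { apply (stays_nonneg G (fun t => 2 * energy y t + 1 / y Rad t
        - d (y Rad t) (y Ang t) * (y Rad t * y Vel t)) u t); try lra.
      - intros s Hs; apply HGd; lra.
      - intros s Hs HG. destruct (sol_at d M Hd tau y s Hy ltac:(lra)) as [Hr [Hdd _]].
        assert (1 <= energy y s) by (apply Hall; lra).
        assert (0 < 1 / y Rad s) by (apply Rdiv_lt_0_compat; lra).
        unfold G in HG. nra.
      - assert (0 < y Rad u) by (apply Hy; lra). unfold G; nra. }
    assert (0 < y Rad t) by (apply Hy; lra). unfold G in H; nra. }
  assert (Hincr : forall u t, 0 <= u <= t -> t <= tau -> 0 <= y Vel u -> y Rad u <= y Rad t).
  { intros u t Hu Ht Hv. apply (incr_of_deriv (y Rad) (y Vel)); [lra|..].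
    - intros s Hs; apply (sol_at d M Hd tau y s Hy); lra.
    - intros s Hs; apply (HGpos u); lra. }
  split.
  - intros Hv t Ht; rewrite <- Hya; apply Hincr; lra.
  - intros ->. apply Rnot_le_lt; intros HrT.
    (* To exceed [Rm] the radius needs r' >= 0 at some earlier time; from then on it grows up to
       time T, which contradicts [HrT]. *)
    assert (HR : forall t, 0 <= t <= T -> y Rad t <= Rm).
    { intros t Ht. apply Rnot_lt_le; intros Hlt.
      destruct (classic (exists u, 0 <= u <= t /\ 0 <= y Vel u)) as [[u [Hu Hv]]|Hno].
      - assert (y Rad t <= y Rad T); [|lra].
        apply Hincr; try lra. apply (HGpos u); lra.
      - assert (- y Rad 0 <= - y Rad t); [|lra].
        apply (incr_of_deriv (fun t => - y Rad t) (fun t => - y Vel t)); [lra|..].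
        + intros s Hs; apply (is_derive_opp (V := R_NormedModule)), (sol_at d M Hd T y s Hy); lra.
        + intros s Hs; apply Rnot_lt_le; intros H; apply Hno; exists s; lra. }
    set (C := sqrt (2 * Rm ^ 2 * energy y 0 + 2 * Rm)) in *.
    assert (HC : 0 <= C) by apply sqrt_pos.
    assert (HG : forall t, 0 <= t <= T -> Rabs (G t) <= C).
    { intros t Ht; apply (radial_momentum_bound T); trivial; [lra | auto]. }
    assert (G 0 - (k * energy y 0 - M * C) * 0 <= G T - (k * energy y 0 - M * C) * T).
    { apply (incr_of_deriv (fun t => G t - (k * energy y 0 - M * C) * t)
        (fun t => (2 * energy y t + 1 / y Rad t
        - d (y Rad t) (y Ang t) * (y Rad t * y Vel t)) - (k * energy y 0 - M * C))); [lra|..].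
      - intros s Hs; apply (is_derive_minus (V := R_NormedModule)); [apply HGd; lra|].
        auto_derive; trivial; ring.
      - intros s Hs. destruct (sol_at d M Hd T y s Hy ltac:(lra)) as [Hr [Hdd _]].
        assert (H1 := Hbig s Hs). assert (H2 := HG s Hs).
        assert (0 < 1 / y Rad s) by (apply Rdiv_lt_0_compat; lra).
        assert (d (y Rad s) (y Ang s) * (y Rad s * y Vel s) <= M * C); [|lra].
        eapply Rle_trans; [apply Rle_abs|]. rewrite Rabs_mult, (Rabs_pos_eq (d _ _)) by lra.
        apply Rmult_le_compat; try lra; [apply Rabs_pos | exact H2]. }
    assert (H0 := HG 0 ltac:(lra)). assert (H1 := HG T ltac:(lra)).
    apply Rabs_le_between in H0. apply Rabs_le_between in H1. nra.
Qed.

End Estimates.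

(** * Rectilinear motion *)

Lemma nsq_derive (x : R) : is_derive (fun x => Rmin x 0 ^ 2) x (2 * Rmin x 0).
Proof.
  apply is_derive_eps; intros eps He. exists eps; split; trivial.
  intros h Hh Hlt. eapply Rle_lt_trans; [|exact Hlt].
  replace ((Rmin (x + h) 0 ^ 2 - Rmin x 0 ^ 2) / h - 2 * Rmin x 0) with
    ((Rmin (x + h) 0 ^ 2 - Rmin x 0 ^ 2 - 2 * Rmin x 0 * h) / h) by (field; trivial).
  rewrite Rabs_div by trivial. apply Rle_div_l; [apply Rabs_pos_lt; trivial|].
  rewrite <- Rabs_mult, (Rabs_pos_eq (h * h)) by nra.
  apply Rabs_le; unfold Rmin; destruct (Rle_dec (x + h) 0), (Rle_dec x 0); split; nra.
Qed.

Section Rectilinear.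
Variables (d : R -> R -> R) (M : R).
Hypothesis Hd : polar_damping d M.

Lemma damping_continuous (f g : R -> R) (t : R) :
  continuous f t -> continuous g t -> 0 < f t -> continuous (fun s => d (f s) (g s)) t.
Proof.
  intros Hf Hg Hp. destruct Hd as [HM [_ HdL]].
  assert (Hi : 0 < / f t) by (apply Rinv_0_lt_compat; trivial).
  destruct (HdL (1 + 2 * / f t + 2 * f t)) as [L [HL0 HL]]; [lra|].
  set (K := 1 + 2 * / f t + 2 * f t) in *.
  assert (HK : / K <= f t / 2).
  { replace (f t / 2) with (/ (2 * / f t)) by (field; lra).
    apply Rinv_le_contravar; unfold K; lra. }
  rewrite continuous_eps in Hf, Hg |- *. intros eps He.
  set (e := Rmin (f t / 2) (eps / (2 * L + 1))).
  assert (He' : 0 < e) by (apply Rmin_glb_lt; [lra | apply Rdiv_lt_0_compat; lra]).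
  assert (He1 : e <= f t / 2) by apply Rmin_l.
  assert (He2 : e <= eps / (2 * L + 1)) by apply Rmin_r.
  destruct (Hf e He') as [d1 [Hd1 H1]], (Hg e He') as [d2 [Hd2 H2]].
  exists (Rmin d1 d2); split; [apply Rmin_glb_lt; trivial|]. intros s Hs.
  specialize (H1 s (Rlt_le_trans _ _ _ Hs (Rmin_l _ _))).
  specialize (H2 s (Rlt_le_trans _ _ _ Hs (Rmin_r _ _))).
  assert (Hfs := H1). apply Rabs_lt_between in Hfs.
  eapply Rle_lt_trans; [apply HL; unfold K; unfold K in HK; lra|].
  apply Rle_div_r in He2; [|lra]. assert (0 <= Rabs (f s - f t)) by apply Rabs_pos.
  assert (0 <= Rabs (g s - g t)) by apply Rabs_pos. nra.
Qed.

Lemma damping_primitive (al : R) : exists F : R -> R, forall r, 0 < r -> is_derive F r (d r al).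
Proof.
  exists (fun r => RInt (fun x => d x al) 1 r). intros r Hr.
  assert (Hc : forall x, 0 < x -> continuous (fun x => d x al) x).
  { intros x Hx; apply (damping_continuous (fun x => x) (fun _ => al));
    [apply continuous_id | apply continuous_const | trivial]. }
  apply (is_derive_RInt (V := R_NormedModule) (fun x => d x al) (fun r => RInt (fun x => d x al) 1 r) 1);
    [|apply Hc; trivial].
  exists (mkposreal r Hr). intros x Hx.
  apply (RInt_correct (V := R_CompleteNormedModule)), ex_RInt_continuous.
  intros z Hz; apply Hc.
  assert (0 < x).
  { change (Rabs (x - r) < r) in Hx. apply Rabs_lt_between in Hx; lra. }
  eapply Rlt_le_trans; [|apply Hz]. apply Rmin_glb_lt; lra.
Qed.

Lemma rectilinear_const tau y t : polar_sol d tau y -> y Mom 0 = 0 -> 0 <= t <= tau ->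
  y Mom t = 0 /\ y Ang t = y Ang 0.
Proof.
  intros Hy H0 Ht.
  assert (Hm : forall s, 0 <= s <= tau -> y Mom s = 0).
  { intros s Hs. assert (H := mom_sq_decr d M Hd tau y s Hy Hs). rewrite H0 in H.
    assert (0 <= y Mom s ^ 2) by apply pow2_ge_0.
    assert (y Mom s ^ 2 = 0) by (simpl in *; lra). simpl in H2; nra. }
  split; [auto|].
  assert (H : Rabs (y Ang t - y Ang 0) <= 0 - 0).
  { apply (deriv_bound (y Ang) (fun t => y Mom t / y Rad t ^ 2) (fun _ => 0) (fun _ => 0)); [lra|..].
    - intros s Hs; apply (sol_at d M Hd tau y s Hy); lra.
    - intros; apply (is_derive_const (V := R_NormedModule)).
    - intros s Hs; rewrite Hm by lra. unfold Rdiv; rewrite Rmult_0_l, Rabs_R0; lra. }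
  apply Rabs_le_between in H; lra.
Qed.

Lemma rectilinear_vel_deriv tau y t : polar_sol d tau y -> y Mom 0 = 0 -> 0 <= t <= tau ->
  is_derive (y Vel) t (- (1 / y Rad t ^ 2) - d (y Rad t) (y Ang 0) * y Vel t).
Proof.
  intros Hy H0 Ht. destruct (rectilinear_const tau y t Hy H0 Ht) as [H1 H2].
  destruct (sol_at d M Hd tau y t Hy Ht) as [Hr [_ [_ [_ [H3 _]]]]].
  rewrite H1, H2 in H3. evar_last; [exact H3|]. field; lra.
Qed.

(* In the variables r and w = r' + F(r), F' = d, the rectilinear flow is order preserving. *)
Lemma rectilinear_comparison tau y z : polar_sol d tau y -> polar_sol d tau z ->
  y Mom 0 = 0 -> z Mom 0 = 0 -> y Ang 0 = z Ang 0 -> y Rad 0 = z Rad 0 -> y Vel 0 < z Vel 0 ->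
  forall t, 0 <= t <= tau -> y Rad t + (z Vel 0 - y Vel 0) * t * exp (- (M * t)) <= z Rad t.
Proof.
  intros Hy Hz Hy0 Hz0 Hang Hrad Hvel.
  assert (HM : 0 <= M) by apply Hd.
  destruct (damping_primitive (y Ang 0)) as [F HF].
  assert (Hdr : forall r, 0 < r -> 0 <= d r (y Ang 0) <= M) by (intros; apply Hd; trivial).
  assert (HFmon : forall r1 r2, 0 < r1 <= r2 -> 0 <= F r2 - F r1 <= M * (r2 - r1)).
  { intros r1 r2 Hr; split.
    - assert (F r1 <= F r2); [|lra].
      apply (incr_of_deriv F (fun r => d r (y Ang 0))); [lra|..]; intros; [apply HF | apply Hdr]; lra.
    - assert (M * r1 - F r1 <= M * r2 - F r2); [|lra].
      apply (incr_of_deriv (fun r => M * r - F r) (fun r => M - d r (y Ang 0))); [lra|..].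
      + intros r Hr'. assert (H := HF r ltac:(lra)).
        auto_derive; [derive_side | derive_facts; ring].
      + intros r Hr'; specialize (Hdr r ltac:(lra)); lra. }
  set (del := fun t => z Rad t - y Rad t).
  set (eta := fun t => (z Vel t + F (z Rad t)) - (y Vel t + F (y Rad t))).
  set (eta0 := z Vel 0 - y Vel 0).
  assert (Heta0 : eta 0 = eta0) by (unfold eta, eta0; rewrite Hrad; ring).
  assert (Hpos : forall t, 0 <= t <= tau -> 0 < y Rad t /\ 0 < z Rad t)
    by (intros t Ht; split; [apply Hy | apply Hz]; trivial).
  assert (Hddel : forall t, 0 <= t <= tau ->
    is_derive del t (eta t - (F (z Rad t) - F (y Rad t)))).
  { intros t Ht.
    destruct (sol_at d M Hd tau y t Hy Ht) as [_ [_ [H1 _]]].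
    destruct (sol_at d M Hd tau z t Hz Ht) as [_ [_ [H2 _]]].
    unfold del, eta; auto_derive; [derive_side | derive_facts; ring]. }
  assert (Hdeta : forall t, 0 <= t <= tau ->
    is_derive eta t (1 / y Rad t ^ 2 - 1 / z Rad t ^ 2)).
  { intros t Ht. destruct (Hpos t Ht) as [Py Pz].
    destruct (sol_at d M Hd tau y t Hy Ht) as [_ [_ [H1 _]]].
    destruct (sol_at d M Hd tau z t Hz Ht) as [_ [_ [H2 _]]].
    assert (H3 := rectilinear_vel_deriv tau y t Hy Hy0 Ht).
    assert (H4 := rectilinear_vel_deriv tau z t Hz Hz0 Ht). rewrite <- Hang in H4.
    assert (H5 := HF _ Py). assert (H6 := HF _ Pz).
    unfold eta; auto_derive; [derive_side | derive_facts; change (fun x : R => F x) with F; rewrite (is_derive_unique _ _ _ H5), (is_derive_unique _ _ _ H6); field; lra]. }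
  (* A two-way bootstrap. Where [del] is nonpositive, monotonicity of F gives del' >= eta >= 0, so
     [del] cannot become negative; and [del] >= 0 means weaker attraction for the outer particle, so
     [eta] increases. *)
  assert (Hdel : forall u, 0 <= u <= tau -> (forall t, 0 <= t <= u -> 0 <= eta t) -> 0 <= del u).
  { intros u Hu He.
    apply (stays_nonneg del (fun t => eta t - (F (z Rad t) - F (y Rad t))) 0 u); try lra.
    - intros; apply Hddel; lra.
    - intros t Ht Hneg. unfold del in Hneg.
      destruct (Hpos t ltac:(lra)). specialize (HFmon (z Rad t) (y Rad t) ltac:(lra)).
      specialize (He t Ht). lra.
    - unfold del; lra. }
  assert (Hetainc : forall u, 0 <= u <= tau -> (forall t, 0 <= t <= u -> 0 <= eta t) -> eta0 <= eta u).
  { intros u Hu He; rewrite <- Heta0.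
    apply (incr_of_deriv eta (fun t => 1 / y Rad t ^ 2 - 1 / z Rad t ^ 2)); [lra|..].
    - intros; apply Hdeta; lra.
    - intros t Ht. destruct (Hpos t ltac:(lra)).
      assert (Hdt : 0 <= del t) by (apply Hdel; [lra | intros; apply He; lra]).
      unfold del in Hdt.
      assert (1 / z Rad t ^ 2 <= 1 / y Rad t ^ 2); [|lra].
      unfold Rdiv; rewrite !Rmult_1_l. apply Rinv_le_contravar; [apply pow_lt; trivial|].
      apply pow_incr; lra. }
  assert (Heta : forall t, 0 <= t <= tau -> 0 <= eta t).
  { intros t Ht.
    destruct (first_zero eta 0 tau) as [H | [t1 [Ht1 [Hz1 H]]]]; unfold eta0 in *; try lra.
    - intros s Hs; eapply is_derive_cont, Hdeta, Hs.
    - left; auto.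
    - exfalso. assert (z Vel 0 - y Vel 0 <= eta t1); [|lra].
      apply Hetainc; [lra|]. intros s Hs; destruct (Req_dec s t1) as [->|]; [lra|]. left; apply H; lra. }
  intros t Ht. fold eta0.
  (* F has slope at most M, so del' + M del >= eta >= eta0; the integrating factor exp(M t) turns
     this into linear growth. *)
  assert (H : del 0 * exp (M * 0) - eta0 * 0 <= del t * exp (M * t) - eta0 * t).
  { apply (incr_of_deriv (fun t => del t * exp (M * t) - eta0 * t)
      (fun t => (eta t - (F (z Rad t) - F (y Rad t)) + M * del t) * exp (M * t) - eta0)); [lra|..].
    - intros s Hs. assert (H := Hddel s ltac:(lra)).
      auto_derive; [derive_side | derive_facts; ring].
    - intros s Hs. destruct (Hpos s ltac:(lra)).
      assert (Hds : 0 <= del s) by (apply Hdel; [lra | intros; apply Heta; lra]).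
      assert (Hes : eta0 <= eta s) by (apply Hetainc; [lra | intros; apply Heta; lra]).
      unfold del in Hds |- *. specialize (HFmon (y Rad s) (z Rad s) ltac:(lra)).
      assert (1 <= exp (M * s)) by (generalize (exp_ineq1_le (M * s)); nra).
      assert (0 <= eta0) by (unfold eta0; lra). nra. }
  assert (Hd0 : del 0 = 0) by (unfold del; lra). rewrite Hd0 in H.
  assert (He : exp (M * t) * exp (- (M * t)) = 1) by (rewrite <- exp_plus, Rplus_opp_r, exp_0; trivial).
  assert (H' : eta0 * t * exp (- (M * t)) <= del t * exp (M * t) * exp (- (M * t))).
  { apply Rmult_le_compat_r; [left; apply exp_pos | lra]. }
  rewrite (Rmult_assoc (del t)), He in H'. unfold del in H'. lra.
Qed.

(** While r' <= 0, the quantity r' + M r is nonincreasing, since its derivative is - 1/r^2 + (M - d)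
    r'. Hence r' <= - z0 persists, and a solution that is still alive at [tau] must have had enough
    radius for a fall at this speed. *)
Lemma rectilinear_fall tau y t1 z0 : polar_sol d tau y -> y Mom 0 = 0 -> 0 <= t1 <= tau ->
  0 < z0 -> y Vel t1 + M * y Rad t1 <= - z0 -> z0 * (tau - t1) < y Rad t1.
Proof.
  intros Hy H0 Ht1 Hz Hv. assert (HM : 0 <= M) by apply Hd.
  assert (Hr : forall t, 0 <= t <= tau -> 0 < y Rad t) by (intros; apply Hy; trivial).
  assert (Hdec : forall t, t1 <= t <= tau -> (forall s, t1 <= s <= t -> y Vel s <= 0) ->
     y Vel t <= - z0).
  { intros t Ht Hs.
    assert (- (y Vel t1 + M * y Rad t1) <= - (y Vel t + M * y Rad t)).
    { apply (incr_of_deriv (fun t => - (y Vel t + M * y Rad t))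
        (fun t => 1 / y Rad t ^ 2 + d (y Rad t) (y Ang 0) * y Vel t - M * y Vel t)); [lra|..].
      - intros s Hs'. assert (H1 := rectilinear_vel_deriv tau y s Hy H0 ltac:(lra)).
        destruct (sol_at d M Hd tau y s Hy ltac:(lra)) as [Hrs [_ [H2 _]]].
        auto_derive; [derive_side | derive_facts; field; lra].
      - intros s Hs'. assert (Hrs := Hr s ltac:(lra)). specialize (Hs s Hs').
        assert (0 < 1 / y Rad s ^ 2) by (apply Rdiv_lt_0_compat; [lra | apply pow_lt; trivial]).
        assert (0 <= d (y Rad s) (y Ang 0) <= M) by (apply Hd; trivial). nra. }
    specialize (Hr t ltac:(lra)). nra. }
  assert (Hr1 := Hr t1 ltac:(lra)).
  assert (Hneg : forall t, t1 <= t <= tau -> y Vel t <= 0).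
  { destruct (first_zero (fun t => - y Vel t) t1 tau) as [H | [t2 [Ht2 [Hz2 H]]]]; try lra.
    - intros t Ht; apply (continuous_opp (V := R_NormedModule)), (sol_cont d tau); trivial; lra.
    - nra.
    - intros t Ht; specialize (H t Ht); lra.
    - exfalso. assert (y Vel t2 <= - z0); [|lra].
      apply Hdec; [lra|]. intros s Hs; destruct (Req_dec s t2) as [->|]; [lra|].
      specialize (H s ltac:(lra)); lra. }
  assert (- y Rad t1 - z0 * t1 <= - y Rad tau - z0 * tau).
  { apply (incr_of_deriv (fun t => - y Rad t - z0 * t) (fun t => - y Vel t - z0)); [lra|..].
    - intros s Hs. destruct (sol_at d M Hd tau y s Hy ltac:(lra)) as [Hrs [_ [H2 _]]].
      auto_derive; [derive_side | derive_facts; ring].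
    - intros s Hs; assert (y Vel s <= - z0); [|lra].
      apply Hdec; [trivial|]. intros; apply Hneg; lra. }
  specialize (Hr tau ltac:(lra)). lra.
Qed.

(** The quantity exp(2 M t) min(r', 0)^2 / 2 - 1/r is nondecreasing: during inward motion the
    exponential outweighs friction, and during outward motion - 1/r grows by itself. The squared
    negative part is differentiable, so turning points need no separate treatment. *)
Lemma impact_speed tau y t : polar_sol d tau y -> y Mom 0 = 0 -> 0 <= t <= tau ->
  1 / y Rad t - 1 / y Rad 0 <= exp (2 * M * t) * Rmin (y Vel t) 0 ^ 2 / 2.
Proof.
  intros Hy H0 Ht. assert (HM : 0 <= M) by apply Hd.
  assert (H : exp (2 * M * 0) * Rmin (y Vel 0) 0 ^ 2 / 2 - 1 / y Rad 0 <=
              exp (2 * M * t) * Rmin (y Vel t) 0 ^ 2 / 2 - 1 / y Rad t).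
  { apply (incr_of_deriv (fun t => exp (2 * M * t) * Rmin (y Vel t) 0 ^ 2 / 2 - 1 / y Rad t)
      (fun t => M * exp (2 * M * t) * Rmin (y Vel t) 0 ^ 2
        + exp (2 * M * t) * (Rmin (y Vel t) 0 * (- (1 / y Rad t ^ 2) - d (y Rad t) (y Ang 0) * y Vel t))
        + y Vel t / y Rad t ^ 2)); [lra|..].
    - intros s Hs. assert (H1 := rectilinear_vel_deriv tau y s Hy H0 ltac:(lra)).
      destruct (sol_at d M Hd tau y s Hy ltac:(lra)) as [Hrs [_ [H2 _]]].
      assert (H3 := is_derive_comp (fun x => Rmin x 0 ^ 2) (y Vel) s _ _ (nsq_derive (y Vel s)) H1).
      set (q := fun s => Rmin (y Vel s) 0 ^ 2) in *.
      change (is_derive (fun t => exp (2 * M * t) * q t / 2 - 1 / y Rad t) s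
        (M * exp (2 * M * s) * q s + exp (2 * M * s) *
          (Rmin (y Vel s) 0 * (- (1 / y Rad s ^ 2) - d (y Rad s) (y Ang 0) * y Vel s))
          + y Vel s / y Rad s ^ 2)).
      change (is_derive q s (scal (- (1 / y Rad s ^ 2) - d (y Rad s) (y Ang 0) * y Vel s)
         (2 * Rmin (y Vel s) 0))) in H3.
      auto_derive; [derive_side|]. derive_facts. unfold scal; simpl; unfold mult; simpl. field; lra.
    - intros s Hs. assert (Hr : 0 < y Rad s) by (apply Hy; lra).
      assert (Hi : 0 < 1 / y Rad s ^ 2) by (apply Rdiv_lt_0_compat; [lra | apply pow_lt; trivial]).
      assert (Hdd : 0 <= d (y Rad s) (y Ang 0) <= M) by (apply Hd; trivial).
      replace (y Vel s / y Rad s ^ 2) with (y Vel s * (1 / y Rad s ^ 2)) by (field; lra).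
      assert (HE : 1 <= exp (2 * M * s)) by (generalize (exp_ineq1_le (2 * M * s)); nra).
      set (i := 1 / y Rad s ^ 2) in *. set (D := d (y Rad s) (y Ang 0)) in *.
      set (E := exp (2 * M * s)) in *. set (v := y Vel s).
      unfold Rmin; destruct (Rle_dec v 0).
      + replace (M * E * v ^ 2 + E * (v * (- i - D * v)) + v * i) with
          (E * ((M - D) * v ^ 2) + (E - 1) * ((- v) * i)) by ring.
        assert (0 <= v ^ 2) by apply pow2_ge_0.
        apply Rplus_le_le_0_compat; apply Rmult_le_pos; try lra; apply Rmult_le_pos; lra.
      + nra. }
  rewrite Rmult_0_r, exp_0 in H. assert (0 <= Rmin (y Vel 0) 0 ^ 2) by apply pow2_ge_0. lra.
Qed.

Lemma fast_impact Q a tau : 0 < Q -> 0 < a -> 0 <= tau -> exists eps0, 0 < eps0 /\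
  forall tau1 y, 0 <= tau1 <= tau -> polar_sol d tau1 y -> y Mom 0 = 0 -> y Rad 0 = a ->
    y Rad tau1 <= eps0 -> y Vel tau1 <= - Q.
Proof.
  intros HQ Ha Htau. assert (HM : 0 <= M) by apply Hd.
  assert (Hia : 0 < / a) by (apply Rinv_0_lt_compat; trivial).
  set (E := exp (2 * M * tau)). assert (HE : 0 < E) by apply exp_pos.
  assert (HX : 0 < / a + Q ^ 2 * E) by (assert (0 <= Q ^ 2) by apply pow2_ge_0; nra).
  exists (/ (/ a + Q ^ 2 * E)); split; [apply Rinv_0_lt_compat; trivial|].
  intros tau1 y Ht1 Hy H0 Hra Hr.
  assert (H := impact_speed tau1 y tau1 Hy H0 ltac:(lra)). rewrite Hra in H.
  assert (Hr1 : 0 < y Rad tau1) by (apply Hy; lra).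
  assert (Hinv : / a + Q ^ 2 * E <= 1 / y Rad tau1).
  { unfold Rdiv; rewrite Rmult_1_l. rewrite <- (Rinv_inv (/ a + Q ^ 2 * E)).
    apply Rinv_le_contravar; trivial. }
  assert (HE1 : exp (2 * M * tau1) <= E).
  { unfold E. destruct (Req_dec (2 * M * tau1) (2 * M * tau)) as [->|Hne]; [lra|].
    left; apply exp_increasing. assert (2 * M * tau1 <= 2 * M * tau) by nra. lra. }
  assert (Hp := exp_pos (2 * M * tau1)).
  set (q := Rmin (y Vel tau1) 0) in *.
  assert (Hq : q <= 0) by apply Rmin_r.
  assert (Hq2 : Q ^ 2 * E <= E * q ^ 2 / 2).
  { assert (0 <= q ^ 2) by apply pow2_ge_0. unfold Rdiv in *. nra. }
  assert (Hq3 : 2 * Q ^ 2 <= q ^ 2) by (apply (Rmult_le_reg_l E); lra).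
  assert (q <= - Q) by nra.
  unfold q, Rmin in H1. destruct (Rle_dec (y Vel tau1) 0); lra.
Qed.

Definition starts (y : coord -> R -> R) (z0 : coord -> R) : Prop := forall i, y i 0 = z0 i.

(** The comparison is made for every solution living at least up to [tau], so that solutions on the
    full time interval can be compared with one that is followed only until shortly before its
    collision. *)
Lemma dependence a al p0 c0 tau y e : 0 <= tau -> 0 < e -> polar_sol d tau y ->
  starts y (init a al p0 c0) -> exists delta, 0 < delta /\
  forall p c, Rabs (p - p0) < delta -> Rabs (c - c0) < delta ->
    (exists z, polar_sol d tau z /\ starts z (init a al p c)) /\
    forall tau' z, tau <= tau' -> polar_sol d tau' z -> starts z (init a al p c) ->
      forall i t, 0 <= t <= tau -> Rabs (z i t - y i t) <= e.
Proof.
  intros Htau He Hy Hi.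
  destruct (sol_continuous_dependence d M Hd tau y e Htau He Hy) as [delta [Hdel H]].
  exists delta; split; trivial. intros p c Hp Hc.
  destruct (H (init a al p c)) as [w [Hw [Hw0 Hclose]]].
  { intros i; rewrite Hi; destruct i; simpl; try (rewrite Rminus_diag, Rabs_R0; lra); lra. }
  split; [exists w; split; trivial|].
  intros tau' z Htau' Hz Hz0 i t Ht.
  rewrite (sol_unique d M Hd tau z w); trivial; [auto|..].
  - apply (sol_restrict d tau'); trivial.
  - intros j; rewrite Hz0, Hw0; trivial.
Qed.

(** * Collision time as a function of the initial radial velocity *)

Section FixedStart.
Variables (a al : R).
Hypothesis Ha : 0 < a.

(** Its negation means a collision at or before [tau]; surviving every time before T but not T
    itself means colliding exactly at T. *)
Definition survives (s tau : R) : Prop :=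
  exists y, polar_sol d tau y /\ starts y (init a al s 0).

Lemma survives_open s tau : 0 <= tau -> survives s tau ->
  exists delta, 0 < delta /\ forall s', Rabs (s' - s) < delta -> survives s' tau.
Proof.
  intros Htau [y [Hy Hi]].
  destruct (dependence a al s 0 tau y 1 Htau Rlt_0_1 Hy Hi) as [delta [Hdel H]].
  exists delta; split; trivial. intros s' Hs'.
  apply (H s' 0); trivial. rewrite Rminus_diag, Rabs_R0; trivial.
Qed.

Lemma dies_reaching s tau eps : ~ survives s tau -> 0 <= tau -> 0 < eps < a ->
  exists tau1 y, 0 <= tau1 <= tau /\ polar_sol d tau1 y /\ starts y (init a al s 0) /\
    y Rad tau1 = eps.
Proof.
  intros Hs Htau Heps.
  destruct (continuation d M Hd (init a al s 0) tau eps Heps Htau)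
    as [tau1 [y [H1 [H2 [H3 [H4 H5]]]]]].
  exists tau1, y; repeat (split; trivial); try apply H1.
  destruct H5 as [->|]; trivial. exfalso; apply Hs; exists y; split; trivial.
Qed.

(** The colliding trajectory is stopped at a small radius, where it is already faster than Q + 1;
    continuous dependence up to that time carries the picture over to all nearby velocities,
    including those with c nonzero, which turn round the origin later. The lower bounds [eps] and
    [- V] make the estimate for that turn uniform. *)
Lemma near_impact s tau Q h : ~ survives s tau -> 0 <= tau -> 0 < Q -> 0 < h ->
  exists tau1 eps V delta, 0 <= tau1 <= tau /\ 0 < eps < h /\ 0 < delta /\
    forall p c T y, Rabs (p - s) < delta -> Rabs c < delta -> tau1 <= T ->
      polar_sol d T y -> starts y (init a al p c) ->
      eps <= y Rad tau1 < h /\ - V <= y Vel tau1 <= - Q.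
Proof.
  intros Hs Htau HQ Hh.
  destruct (fast_impact (Q + 1) a tau) as [eps0 [He0 Hfast]]; try lra.
  set (eps := Rmin (Rmin eps0 (h / 2)) (a / 2)).
  assert (Heps : 0 < eps).
  { unfold eps. apply Rmin_glb_lt; [apply Rmin_glb_lt|]; lra. }
  assert (He1 : eps <= Rmin eps0 (h / 2)) by apply Rmin_l.
  assert (He2 : eps <= a / 2) by apply Rmin_r.
  assert (He3 : eps <= eps0) by (eapply Rle_trans; [apply He1 | apply Rmin_l]).
  assert (He4 : eps <= h / 2) by (eapply Rle_trans; [apply He1 | apply Rmin_r]).
  destruct (dies_reaching s tau eps Hs Htau) as [tau1 [y [Ht1 [Hy [Hi Hr]]]]]; [lra|].
  assert (Hv : y Vel tau1 <= - (Q + 1)).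
  { apply (Hfast tau1); trivial; try apply Hi. lra. }
  set (e := Rmin (eps / 2) 1).
  assert (He : 0 < e) by (apply Rmin_glb_lt; lra).
  assert (Hea : e <= eps / 2) by apply Rmin_l. assert (Heb : e <= 1) by apply Rmin_r.
  destruct (dependence a al s 0 tau1 y e ltac:(lra) He Hy Hi) as [delta [Hdel H]].
  exists tau1, (eps / 2), (1 - y Vel tau1), delta; split; [trivial|].
  split; [lra|]. split; [trivial|].
  intros p c T z Hp Hc HT Hz Hzi.
  destruct (H p c Hp) as [_ H']; [rewrite Rminus_0_r; trivial|].
  assert (B1 := H' T z HT Hz Hzi Rad tau1 ltac:(lra)).
  assert (B2 := H' T z HT Hz Hzi Vel tau1 ltac:(lra)).
  apply Rabs_le_between in B1. apply Rabs_le_between in B2. lra.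
Qed.

Lemma dies_open s tau T : ~ survives s tau -> 0 <= tau < T ->
  exists delta, 0 < delta /\ forall s', Rabs (s' - s) < delta -> ~ survives s' T.
Proof.
  intros Hs Htau. assert (HM : 0 <= M) by apply Hd.
  (* From r < T - tau and r' <= - 1 - M (T - tau) follows r' + M r <= - 1, and a fall at unit speed
     exhausts r before time T. *)
  destruct (near_impact s tau (1 + M * (T - tau)) (T - tau) Hs)
    as [tau1 [eps [V [delta [Ht1 [Heps [Hdel H]]]]]]]; try nra.
  exists delta; split; trivial. intros s' Hs' [y [Hy Hi]].
  destruct (H s' 0 T y) as [H1 H2]; trivial; try lra. { rewrite Rabs_R0; trivial. }
  assert (Hf := rectilinear_fall T y tau1 1 Hy (Hi Mom) ltac:(lra) Rlt_0_1 ltac:(nra)). lra.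
Qed.

(** The velocity sought is the supremum of those that collide by time T. Openness of survival puts
    the supremum into this set, openness of collision forbids it to collide before T, and the strict
    comparison of trajectories forbids a slower one to survive equally long. *)
Lemma critical_velocity T : 0 < T -> exists s,
  ~ survives s T /\ (forall tau, 0 <= tau < T -> survives s tau) /\
  (forall s', s < s' -> survives s' T) /\
  (forall s', s' < s -> exists tau, 0 <= tau < T /\ ~ survives s' tau).
Proof.
  intros HT. assert (HM : 0 <= M) by apply Hd.
  destruct (high_energy d M Hd T a 1 HT Ha Rlt_0_1) as [E0 [HE0 Hhigh]].
  set (X := E0 + 1 / a + 1).
  assert (HX : 1 <= X) by (unfold X; generalize (Rdiv_lt_0_compat 1 a); lra).
  assert (Hup : forall s, 2 * X <= s -> survives s T).
  { intros s Hs.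
    destruct (continuation d M Hd (init a al s 0) T (a / 2)) as [tau1 [y [H1 [H2 [H3 [H4 H5]]]]]];
      [simpl; lra | lra|].
    destruct H5 as [->|H5]; [exists y; split; trivial|]. exfalso.
    destruct (Hhigh tau1 y H1 H2 (H3 Rad)) as [Hh _].
    { unfold energy; rewrite !H3; simpl init.
      replace (0 ^ 2 / (2 * a ^ 2)) with 0 by (field; lra).
      unfold X in *. assert (2 * (E0 + 1 / a + 1) <= s ^ 2 / 2) by nra. lra. }
    specialize (Hh ltac:(rewrite H3; simpl; lra) tau1 ltac:(lra)). lra. }
  destruct (completeness (fun s => ~ survives s T)) as [s [Hs1 Hs2]].
  { exists (2 * X). intros x Hx; apply Rnot_lt_le; intros Hlt; apply Hx, Hup; lra. }
  (* This inward velocity makes r' + M r = - 2a/T initially, a speed at which the radius a is used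
     up by time T/2. *)
  { exists (- (M * a + 2 * a / T)). intros [y [Hy Hi]].
    assert (Hp : 0 < 2 * a / T) by (apply Rdiv_lt_0_compat; lra).
    assert (H := rectilinear_fall T y 0 (2 * a / T) Hy (Hi Mom) ltac:(lra) Hp).
    rewrite !Hi in H; simpl in H. specialize (H ltac:(lra)).
    replace (2 * a / T * (T - 0)) with (2 * a) in H by (field; lra). lra. }
  assert (Habove : forall s', s < s' -> survives s' T).
  { intros s' Hs'. apply NNPP; intros Hn; specialize (Hs1 s' Hn); lra. }
  assert (HsT : ~ survives s T).
  { intros Hs. destruct (survives_open s T) as [delta [Hdel H]]; [lra | trivial|].
    assert (s <= s - delta / 2); [|lra]. apply Hs2; intros x Hx.
    apply Rnot_lt_le; intros Hlt. destruct (Rle_dec s x) as [Hle|Hle].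
    - destruct (Req_dec s x) as [->|]; [tauto|]. apply Hx, Habove; lra.
    - apply Hx, H, Rabs_def1; lra. }
  assert (Hbelow : forall tau, 0 <= tau < T -> survives s tau).
  { intros tau Htau. apply NNPP; intros Hn.
    destruct (dies_open s tau T Hn Htau) as [delta [Hdel H]].
    apply (H (s + delta / 2)); [apply Rabs_def1; lra | apply Habove; lra]. }
  exists s; repeat (split; trivial).
  intros s' Hs'. apply NNPP; intros Hno.
  assert (Hall : forall tau, 0 <= tau < T -> survives s' tau).
  { intros tau Htau; apply NNPP; intros Hn; apply Hno; exists tau; auto. }
  destruct (Hbelow (T / 2)) as [w [Hw Hwi]]; [lra|].
  destruct (sol_bounds d (T / 2) w) as [m [N [Hm Hmw]]]; [lra | trivial|].
  (* A lower bound for the gap between the two trajectories from time T/2 on; before T/2 the radius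
     for [s] is at least [m]. So the radius [eps] could be reached in neither half. *)
  set (k := (s - s') * (T / 2) * exp (- (M * T))).
  assert (Hk : 0 < k).
  { unfold k; apply Rmult_lt_0_compat; [apply Rmult_lt_0_compat; lra | apply exp_pos]. }
  set (eps := Rmin (Rmin (m / 2) (k / 2)) (a / 2)).
  assert (Heps : 0 < eps).
  { unfold eps. apply Rmin_glb_lt; [apply Rmin_glb_lt|]; lra. }
  assert (He1 : eps <= Rmin (m / 2) (k / 2)) by apply Rmin_l.
  assert (He2 : eps <= a / 2) by apply Rmin_r.
  assert (He3 : eps <= m / 2) by (eapply Rle_trans; [apply He1 | apply Rmin_l]).
  assert (He4 : eps <= k / 2) by (eapply Rle_trans; [apply He1 | apply Rmin_r]).
  destruct (dies_reaching s T eps HsT) as [tau1 [y [Ht1 [Hy [Hi Hr]]]]]; [lra | lra|].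
  assert (Hlt : tau1 < T).
  { destruct (Req_dec tau1 T) as [->|]; [|lra]. exfalso; apply HsT; exists y; split; trivial. }
  destruct (Rle_dec tau1 (T / 2)) as [Hle|Hle].
  - assert (y Rad tau1 = w Rad tau1).
    { apply (sol_unique d M Hd tau1 y w); trivial; [|intros i; rewrite Hi, Hwi; trivial | lra].
      apply (sol_restrict d (T / 2)); trivial. }
    destruct (Hmw tau1) as [H1 _]; lra.
  - destruct (Hall tau1) as [z [Hz Hzi]]; [lra|].
    assert (Hc := rectilinear_comparison tau1 z y Hz Hy (Hzi Mom) (Hi Mom)).
    rewrite !Hi, !Hzi in Hc; simpl in Hc.
    specialize (Hc eq_refl eq_refl Hs' tau1 ltac:(lra)).
    assert (0 < z Rad tau1) by (apply Hz; lra).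
    assert (Hexp : exp (- (M * T)) <= exp (- (M * tau1))).
    { destruct (Req_dec (M * T) (M * tau1)) as [->|Hne]; [lra|].
      left; apply exp_increasing. assert (M * tau1 <= M * T) by nra. lra. }
    assert (k <= (s - s') * tau1 * exp (- (M * tau1))).
    { unfold k. apply Rmult_le_compat; [nra | left; apply exp_pos | nra | trivial]. }
    lra.
Qed.

End FixedStart.
End Rectilinear.

(** * Motion near a collision *)

Lemma cos_ge_half (x : R) : 0 <= x <= 1 -> / 2 <= cos x.
Proof.
  intros Hx. replace (/ 2) with (cos (PI / 3)) by (rewrite cos_PI3; field).
  assert (HP := PI2_3_2). assert (HP1 : 1 <= PI / 3) by lra.
  apply cos_decr_1; lra.
Qed.

Lemma sin_ge_half (x : R) : 0 <= x <= 1 -> x / 2 <= sin x.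
Proof.
  intros Hx.
  assert (sin 0 - 0 / 2 <= sin x - x / 2).
  { apply (incr_of_deriv (fun x => sin x - x / 2) (fun x => cos x - / 2)); [lra|..].
    - intros; auto_derive; trivial; field.
    - intros t Ht; generalize (cos_ge_half t); lra. }
  rewrite sin_0 in H; lra.
Qed.

Lemma cos_le_away (x y : R) : 0 <= x -> x <= y <= 2 * PI - x -> cos y <= cos x.
Proof.
  intros Hx Hy. destruct (Rle_dec y PI) as [H|H].
  - apply cos_decr_1; lra.
  - replace (cos y) with (cos (2 * PI - y)).
    + apply cos_decr_1; lra.
    + rewrite cos_minus, cos_2PI, sin_2PI; ring.
Qed.

(** A Lebesgue number argument along a segment of the axis c = 0 in the velocity plane. *)
Lemma uniform_near (a b : R) (Q : R -> R -> Prop) :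
  (forall s, a <= s <= b -> exists e, 0 < e /\ forall p c, Rabs (p - s) < e -> 0 < c < e -> Q p c) ->
  exists e, 0 < e /\ forall p c, a <= p <= b -> 0 < c < e -> Q p c.
Proof.
  intros H.
  assert (H' : forall s, exists e : posreal, a <= s <= b ->
    forall p c, Rabs (p - s) < e -> 0 < c < e -> Q p c).
  { intros s. destruct (classic (a <= s <= b)) as [Hs|Hs].
    - destruct (H s Hs) as [e [He Hq]]. exists (mkposreal e He); auto.
    - exists (mkposreal 1 Rlt_0_1); tauto. }
  set (delta := fun s => proj1_sig (constructive_indefinite_description _ (H' s))).
  destruct (compactness_value_1d a b delta) as [e He].
  exists e; split; [apply cond_pos|]. intros p c Hp Hc. apply NNPP; intros Hn.
  apply (He p Hp). intros [t [Ht [Hpt Hle]]]. apply Hn. unfold delta in Hpt, Hle.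
  destruct (constructive_indefinite_description _ (H' t)) as [dl Hdl]; simpl in *.
  apply (Hdl Ht); trivial; lra.
Qed.

Section Arcs.
Variables (d : R -> R -> R) (M : R).
Hypothesis Hd : polar_damping d M.

Lemma mom_pos tau y t : polar_sol d tau y -> 0 <= t <= tau -> 0 < y Mom 0 -> 0 < y Mom t.
Proof.
  intros Hy Ht H0. assert (H := mom_lower d M Hd tau y 0 t Hy ltac:(lra) ltac:(lra) H0).
  assert (0 < y Mom 0 * exp (- M * (t - 0))) by (apply Rmult_lt_0_compat; [trivial | apply exp_pos]).
  lra.
Qed.

Lemma ang_incr tau y s t : polar_sol d tau y -> 0 <= s <= t -> t <= tau -> 0 < y Mom 0 ->
  y Ang s <= y Ang t.
Proof.
  intros Hy Hs Ht H0.
  apply (incr_of_deriv (y Ang) (fun t => y Mom t / y Rad t ^ 2)); [lra|..].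
  - intros u Hu; apply (sol_at d M Hd tau y u Hy); lra.
  - intros u Hu; apply Rdiv_le_0_compat.
    + left; apply (mom_pos tau); trivial; lra.
    + apply pow_lt, Hy; lra.
Qed.

(* In the hodograph W = v/c one has dW/dpsi = - c^{-2} e_r: friction enters only through
   the slow drift of c, so k W, with k the initial c^2, is the Keplerian
   (- sin psi, cos psi - 1) up to a small error, and k/r is close to 1 - cos psi. *)
Lemma bounce Th : 0 < Th < 2 * PI -> exists Del0, 0 < Del0 /\
  forall Del rlo V, 0 < Del <= Del0 -> 0 < rlo -> exists c0, 0 < c0 /\
  forall tau y t1, polar_sol d tau y -> 0 <= t1 -> t1 + Del <= tau -> 0 < y Mom 0 ->
    rlo <= y Rad t1 < Del / 8 -> - V <= y Vel t1 <= - 1 -> y Mom t1 < c0 ->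
    y Ang t1 + Th < y Ang (t1 + Del).
Proof.
  intros HTh. assert (HM : 0 <= M) by apply Hd.
  (* For psi in [psia, Th] one has cos psi <= cos psia because Th <= 2 pi - psia; there the
     Keplerian value 1 - cos psi of k/r is at least 2m. *)
  set (psia := Rmin 1 (2 * PI - Th)).
  assert (Hpa : 0 < psia) by (apply Rmin_glb_lt; lra).
  assert (Hpa1 : psia <= 1) by apply Rmin_l.
  assert (Hpa2 : psia <= 2 * PI - Th) by apply Rmin_r.
  set (m := (1 - cos psia) / 2).
  assert (HPI := PI2_3_2). assert (HPI4 := PI_4).
  assert (Hcosa : cos psia < 1).
  { rewrite <- cos_0. apply cos_decreasing_1; lra. }
  assert (Hcosb := cos_ge_half psia ltac:(lra)).
  assert (Hm : 0 < m <= / 4) by (unfold m; lra).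
  set (ep := m / 32).
  assert (Hep : 0 < ep) by (unfold ep; lra).
  assert (Hln : 0 < ln (1 + ep)) by (rewrite <- ln_1; apply ln_increasing; lra).
  (* Within this time c^2 decreases by a factor of at most 1 + ep. *)
  exists (ln (1 + ep) / (2 * M + 1)); split; [apply Rdiv_lt_0_compat; lra|].
  intros Del rlo V HDel Hrlo.
  assert (HDM : exp (2 * M * Del) <= 1 + ep).
  { rewrite <- (exp_ln (1 + ep)) by lra.
    assert (Del * (2 * M + 1) <= ln (1 + ep)).
    { destruct HDel as [_ HDel]. apply Rle_div_r in HDel; lra. }
    assert (2 * M * Del <= ln (1 + ep)) by nra.
    destruct (Req_dec (2 * M * Del) (ln (1 + ep))) as [->|]; [lra|].
    left; apply exp_increasing; lra. }
  assert (HV := Rabs_pos V).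
  (* The entries ensure that powers of c are at most c, that c |r'| <= m/4 and k/r <= m/4 at the
     initial time, and that an orbit with k/r >= m turns too fast for the second half of the time
     interval. *)
  set (c0 := Rmin (Rmin 1 (m / (4 * (Rabs V + 1)))) (Rmin (m * rlo / 4) (Del * m ^ 2 / 32))).
  assert (Hm2 : 0 < m ^ 2) by (apply pow_lt; lra).
  exists c0; split.
  { unfold c0. apply Rmin_glb_lt; apply Rmin_glb_lt; try lra.
    - apply Rdiv_lt_0_compat; lra.
    - assert (0 < m * rlo) by nra; lra.
    - assert (0 < Del * m ^ 2) by (apply Rmult_lt_0_compat; lra); lra. }
  intros tau y t1 Hy Ht1 HtD HM0 Hr1 Hv1 Hc1.
  assert (A1 : c0 <= Rmin 1 (m / (4 * (Rabs V + 1)))) by apply Rmin_l.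
  assert (A2 : c0 <= Rmin (m * rlo / 4) (Del * m ^ 2 / 32)) by apply Rmin_r.
  assert (A3 : c0 <= 1) by (eapply Rle_trans; [apply A1 | apply Rmin_l]).
  assert (A4 : c0 <= m / (4 * (Rabs V + 1))) by (eapply Rle_trans; [apply A1 | apply Rmin_r]).
  assert (A5 : c0 <= m * rlo / 4) by (eapply Rle_trans; [apply A2 | apply Rmin_l]).
  assert (A6 : c0 <= Del * m ^ 2 / 32) by (eapply Rle_trans; [apply A2 | apply Rmin_r]).
  clear A1 A2. set (c1 := y Mom t1) in *.
  assert (Hc1p : 0 < c1) by (apply (mom_pos tau); trivial; lra).
  set (t2 := t1 + Del) in *.
  assert (Hin : forall t, t1 <= t <= t2 -> 0 <= t <= tau) by (intros; lra).
  assert (Hmom : forall t, t1 <= t <= t2 -> 0 < y Mom t <= c1 /\ c1 ^ 2 <= (1 + ep) * y Mom t ^ 2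
    /\ c1 / 2 <= y Mom t).
  { intros t Ht. assert (Hp := mom_pos tau y t Hy (Hin t Ht) HM0).
    assert (Hup : - c1 <= - y Mom t).
    { apply (incr_of_deriv (fun t => - y Mom t) (fun t => - (- d (y Rad t) (y Ang t) * y Mom t))); [lra|..].
      - intros s Hs; apply (is_derive_opp (V := R_NormedModule)).
        apply (sol_at d M Hd tau y s Hy), Hin; lra.
      - intros s Hs. destruct (sol_at d M Hd tau y s Hy) as [_ [Hdd _]]; [apply Hin; lra|].
        assert (0 < y Mom s) by (apply (mom_pos tau); trivial; apply Hin; lra). nra. }
    assert (Hlo := mom_lower d M Hd tau y t1 t Hy ltac:(lra) ltac:(apply Hin; trivial) Hc1p).
    fold c1 in Hlo.
    set (q := exp (- M * (t - t1))) in *.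
    assert (Hq : 0 < q) by apply exp_pos.
    assert (Hqq : 1 <= (1 + ep) * (q * q)).
    { apply Rle_trans with (exp (2 * M * Del) * (q * q)).
      - unfold q; rewrite <- !exp_plus.
        assert (0 <= 2 * M * Del + (- M * (t - t1) + - M * (t - t1))) by (unfold t2 in Ht; nra).
        generalize (exp_ineq1_le (2 * M * Del + (- M * (t - t1) + - M * (t - t1)))); lra.
      - apply Rmult_le_compat_r; nra. }
    assert (Hsq : (c1 * q) ^ 2 <= y Mom t ^ 2) by (apply pow_incr; nra).
    assert (Hc2 : 0 < c1 ^ 2) by (apply pow_lt; trivial).
    split; [lra|]. assert (Hmain : c1 ^ 2 <= (1 + ep) * y Mom t ^ 2).
    { apply Rle_trans with ((1 + ep) * (c1 * q) ^ 2); [|apply Rmult_le_compat_l; lra].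
      replace ((1 + ep) * (c1 * q) ^ 2) with (c1 ^ 2 * ((1 + ep) * (q * q))) by ring. nra. }
    split; trivial. unfold ep in *. nra. }
  set (k := c1 ^ 2). assert (Hk : 0 < k) by (apply pow_lt; trivial).
  set (psi := fun t => y Ang t - y Ang t1).
  (* In the frame of the initial direction, (Z2, - Z1) is the Laplace-Runge-Lenz vector, up to the
     drift of c: it is constant without friction. It starts close to (- 1, 0), that is, at
     eccentricity close to 1. *)
  set (Z1 := fun t => k * (y Vel t / y Mom t * cos (psi t) - 1 / y Rad t * sin (psi t)) + sin (psi t)).
  set (Z2 := fun t => k * (y Vel t / y Mom t * sin (psi t) + 1 / y Rad t * cos (psi t)) - cos (psi t)).
  assert (Hdpsi : forall t, t1 <= t <= t2 -> is_derive psi t (y Mom t / y Rad t ^ 2)).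
  { intros t Ht. destruct (sol_at d M Hd tau y t Hy (Hin t Ht)) as [Hr [_ [_ [H2 _]]]].
    unfold psi; auto_derive; [derive_side | derive_facts; ring]. }
  assert (HdZ : forall t, t1 <= t <= t2 ->
     is_derive Z1 t ((1 - k / y Mom t ^ 2) * (y Mom t / y Rad t ^ 2) * cos (psi t)) /\
     is_derive Z2 t ((1 - k / y Mom t ^ 2) * (y Mom t / y Rad t ^ 2) * sin (psi t))).
  { intros t Ht. assert (H0 := Hdpsi t Ht). destruct (Hmom t Ht) as [Hp _].
    destruct (sol_at d M Hd tau y t Hy (Hin t Ht)) as [Hr [_ [H1 [_ [H3 H4]]]]].
    unfold Z1, Z2; split; (auto_derive; [derive_side | derive_facts; field; lra]). }
  assert (Hpsi : forall s t, t1 <= s <= t -> t <= t2 -> psi s <= psi t).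
  { intros s t Hs Ht; unfold psi.
    assert (y Ang s <= y Ang t); [|lra]. apply (ang_incr tau); trivial; [lra|].
    apply Hin; lra. }
  assert (Hpsi1 : psi t1 = 0) by (unfold psi; ring).
  assert (Hdev : forall t, t1 <= t <= t2 ->
    Rabs (Z1 t - Z1 t1) <= ep * psi t /\ Rabs (Z2 t - Z2 t1) <= ep * psi t).
  { intros t Ht.
    replace (ep * psi t) with (ep * psi t - ep * psi t1) by (rewrite Hpsi1; ring).
    assert (Hg : forall s, t1 <= s <= t -> is_derive (fun s => ep * psi s) s (ep * (y Mom s / y Rad s ^ 2))).
    { intros s Hs. assert (H0 := Hdpsi s ltac:(lra)).
      auto_derive; [derive_side | derive_facts; ring]. }
    assert (Hb : forall s x, t1 <= s <= t -> Rabs x <= 1 ->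
      Rabs ((1 - k / y Mom s ^ 2) * (y Mom s / y Rad s ^ 2) * x) <= ep * (y Mom s / y Rad s ^ 2)).
    { intros s x Hs Hx. destruct (Hmom s ltac:(lra)) as [[Hp1 Hp2] [Hp3 _]].
      assert (Hms : 0 < y Mom s ^ 2) by (apply pow_lt; trivial).
      assert (Hpos : 0 <= y Mom s / y Rad s ^ 2).
      { apply Rdiv_le_0_compat; [lra|]. apply pow_lt, Hy, Hin; lra. }
      assert (Hkk : Rabs (1 - k / y Mom s ^ 2) <= ep).
      { assert (1 <= k / y Mom s ^ 2).
        { apply Rle_div_r; trivial. rewrite Rmult_1_l. apply pow_incr; lra. }
        assert (k / y Mom s ^ 2 <= 1 + ep) by (apply Rle_div_l; trivial).
        apply Rabs_le; lra. }
      rewrite !Rabs_mult, (Rabs_pos_eq (y Mom s / y Rad s ^ 2)) by trivial.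
      assert (HX := Rabs_pos x). assert (HK := Rabs_pos (1 - k / y Mom s ^ 2)).
      rewrite <- (Rmult_1_r (ep * _)). apply Rmult_le_compat; trivial; [nra|].
      apply Rmult_le_compat_r; trivial. }
    split.
    - apply (deriv_bound Z1 (fun t => (1 - k / y Mom t ^ 2) * (y Mom t / y Rad t ^ 2) * cos (psi t))
        (fun s => ep * psi s) (fun s => ep * (y Mom s / y Rad s ^ 2))); trivial; [lra|..].
      + intros s Hs; apply HdZ; lra.
      + intros s Hs; apply Hb; trivial. apply Rabs_le; apply COS_bound.
    - apply (deriv_bound Z2 (fun t => (1 - k / y Mom t ^ 2) * (y Mom t / y Rad t ^ 2) * sin (psi t))
        (fun s => ep * psi s) (fun s => ep * (y Mom s / y Rad s ^ 2))); trivial; [lra|..].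
      + intros s Hs; apply HdZ; lra.
      + intros s Hs; apply Hb; trivial. apply Rabs_le; apply SIN_bound. }
  assert (HZ1 : Z1 t1 = c1 * y Vel t1).
  { unfold Z1; rewrite Hpsi1, cos_0, sin_0; fold c1; unfold k.
    assert (0 < y Rad t1) by lra. field; lra. }
  assert (HZ2 : Z2 t1 = k / y Rad t1 - 1).
  { unfold Z2; rewrite Hpsi1, cos_0, sin_0; fold c1.
    assert (0 < y Rad t1) by lra. field; lra. }
  assert (HZ1b : Rabs (Z1 t1) <= m / 4).
  { rewrite HZ1, Rabs_mult, (Rabs_pos_eq c1) by lra.
    assert (Rabs (y Vel t1) <= Rabs V).
    { rewrite Rabs_left by lra. generalize (Rle_abs V); lra. }
    assert (c1 * (4 * (Rabs V + 1)) <= m).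
    { assert (H4 : c1 <= m / (4 * (Rabs V + 1))) by lra. apply Rle_div_r in H4; lra. }
    assert (c1 * Rabs (y Vel t1) <= c1 * Rabs V) by (apply Rmult_le_compat_l; lra). nra. }
  assert (HZ2b : Rabs (Z2 t1 + 1) <= m / 4).
  { rewrite HZ2. replace (k / y Rad t1 - 1 + 1) with (k / y Rad t1) by ring.
    rewrite Rabs_pos_eq by (apply Rdiv_le_0_compat; lra).
    apply Rle_div_l; [lra|]. unfold k. assert (c1 ^ 2 <= c1) by (simpl; nra). nra. }
  apply Rnot_le_lt; intros Hcon.
  assert (HpsiT : forall t, t1 <= t <= t2 -> 0 <= psi t <= Th).
  { intros t Ht; split.
    - rewrite <- Hpsi1; apply Hpsi; lra.
    - apply Rle_trans with (psi t2); [apply Hpsi; lra | unfold psi; lra]. }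
  assert (Hsmall : forall t, t1 <= t <= t2 -> Rabs (Z1 t) <= m / 2 /\ Rabs (Z2 t + 1) <= m / 2).
  { intros t Ht. destruct (Hdev t Ht) as [D1 D2]. assert (HpT := HpsiT t Ht).
    assert (ep * psi t <= m / 4) by (unfold ep; nra).
    split.
    - replace (Z1 t) with ((Z1 t - Z1 t1) + Z1 t1) by ring.
      eapply Rle_trans; [apply Rabs_triang | lra].
    - replace (Z2 t + 1) with ((Z2 t - Z2 t1) + (Z2 t1 + 1)) by ring.
      eapply Rle_trans; [apply Rabs_triang | lra]. }
  (* Assuming the swept angle stays at most [Th], the time is split in the middle. If psi reaches
     [psia] in the first half, then r <= k/m afterwards and the angular velocity is enormous; if
     not, the particle falls inwards at speed at least 1/4 throughout the first half, which uses up
     a radius below Del / 8. *)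
  set (tm := t1 + Del / 2).
  assert (Htm : t1 < tm < t2) by (unfold tm, t2; lra).
  assert (Hearly : psi tm < psia).
  { apply Rnot_le_lt; intros Hge.
    assert (Hu : forall t, tm <= t <= t2 -> m <= k / y Rad t).
    { intros t Ht. assert (Ht' : t1 <= t <= t2) by lra.
      destruct (Hsmall t Ht') as [S1 S2]. assert (HpT := HpsiT t Ht').
      assert (Hr : 0 < y Rad t) by (apply Hy, Hin, Ht').
      destruct (Hmom t Ht') as [[Hp _] _].
      (* The conic equation of the orbit, obtained by solving [Z1] and [Z2] for 1/r. *)
      assert (Hid : k / y Rad t = 1 - cos (psi t) + (Z2 t + 1) * cos (psi t) - Z1 t * sin (psi t)).
      { unfold Z1, Z2. assert (Hcs := sin2_cos2 (psi t)). unfold Rsqr in Hcs.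
        replace (1 - cos (psi t) + (k * (y Vel t / y Mom t * sin (psi t) + 1 / y Rad t * cos (psi t)) -
           cos (psi t) + 1) * cos (psi t) -
           (k * (y Vel t / y Mom t * cos (psi t) - 1 / y Rad t * sin (psi t)) + sin (psi t)) * sin (psi t))
        with (k / y Rad t * (sin (psi t) * sin (psi t) + cos (psi t) * cos (psi t))
           + (1 - (sin (psi t) * sin (psi t) + cos (psi t) * cos (psi t)))) by (field; lra).
        rewrite Hcs; ring. }
      assert (Hca : cos (psi t) <= cos psia).
      { apply cos_le_away; [lra|]. split; [|lra].
        apply Rle_trans with (psi tm); trivial. apply Hpsi; lra. }
      assert (B1 : Rabs ((Z2 t + 1) * cos (psi t)) <= m / 2).
      { rewrite Rabs_mult. rewrite <- (Rmult_1_r (m / 2)). apply Rmult_le_compat; trivial; try apply Rabs_pos.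
        apply Rabs_le, COS_bound. }
      assert (B2 : Rabs (Z1 t * sin (psi t)) <= m / 2).
      { rewrite Rabs_mult. rewrite <- (Rmult_1_r (m / 2)). apply Rmult_le_compat; trivial; try apply Rabs_pos.
        apply Rabs_le, SIN_bound. }
      apply Rabs_le_between in B1. apply Rabs_le_between in B2.
      rewrite Hid. unfold m in *. lra. }
    set (w := m ^ 2 / (2 * c1 ^ 3)).
    assert (Hc3 : 0 < c1 ^ 3) by (apply pow_lt; trivial).
    assert (Hfast : psi tm - w * tm <= psi t2 - w * t2).
    { apply (incr_of_deriv (fun t => psi t - w * t) (fun t => y Mom t / y Rad t ^ 2 - w)); [lra|..].
      - intros t Ht. assert (H0 := Hdpsi t ltac:(lra)).
        auto_derive; [derive_side | derive_facts; ring].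
      - intros t Ht. assert (Hu' := Hu t Ht).
        assert (Hr : 0 < y Rad t) by (apply Hy, Hin; lra).
        destruct (Hmom t ltac:(lra)) as [_ [_ Hp]].
        assert (Hx : m ^ 2 <= (k / y Rad t) ^ 2) by (apply pow_incr; lra).
        replace (y Mom t / y Rad t ^ 2) with (y Mom t / k ^ 2 * (k / y Rad t) ^ 2) by (field; lra).
        assert (Hy' : c1 / 2 / k ^ 2 <= y Mom t / k ^ 2).
        { apply Rmult_le_compat_r; [left; apply Rinv_0_lt_compat, pow_lt; trivial | trivial]. }
        assert (w = c1 / 2 / k ^ 2 * m ^ 2) by (unfold w, k; field; lra).
        assert (c1 / 2 / k ^ 2 * m ^ 2 <= y Mom t / k ^ 2 * (k / y Rad t) ^ 2); [|lra].
        apply Rmult_le_compat; trivial; [|lra].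
        apply Rdiv_le_0_compat; [lra | apply pow_lt; trivial]. }
    assert (P1 := HpsiT tm ltac:(lra)). assert (P2 := HpsiT t2 ltac:(lra)).
    assert (Hw : w * (Del / 2) <= Th).
    { replace (Del / 2) with (t2 - tm) by (unfold t2, tm; field). lra. }
    (* The angle swept in the second half would exceed 8, hence 2 pi. *)
    assert (Hbig : 8 < w * (Del / 2)); [|lra].
    unfold w. replace (m ^ 2 / (2 * c1 ^ 3) * (Del / 2)) with (Del * m ^ 2 / (4 * c1 ^ 3)) by (field; lra).
    apply -> (Rlt_div_r 8 (Del * m ^ 2) (4 * c1 ^ 3)); [|lra].
    assert (c1 ^ 3 <= c1) by (simpl; assert (c1 * c1 <= 1) by nra; nra). lra. }
  assert (Hfall : forall t, t1 <= t <= tm -> y Vel t <= - / 4).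
  { intros t Ht. assert (Ht' : t1 <= t <= t2) by lra.
    assert (Hps : psi t <= psia) by (apply Rle_trans with (psi tm); [apply Hpsi|]; lra).
    assert (HpT := HpsiT t Ht'). destruct (Hsmall t Ht') as [_ S2]. destruct (Hdev t Ht') as [D1 _].
    apply Rabs_le_between in S2. apply Rabs_le_between in D1. rewrite HZ1 in D1.
    assert (C1 := cos_ge_half (psi t) ltac:(lra)). assert (C2 := sin_ge_half (psi t) ltac:(lra)).
    assert (C3 : cos (psi t) <= 1) by apply COS_bound.
    destruct (Hmom t Ht') as [[Hp Hp'] [_ Hp2]].
    assert (Hr : 0 < y Rad t) by (apply Hy, Hin, Ht').
    assert (Hid : y Vel t = y Mom t / k * (Z1 t * cos (psi t) + Z2 t * sin (psi t))).
    { unfold Z1, Z2. assert (Hcs := sin2_cos2 (psi t)). unfold Rsqr in Hcs.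
      replace (y Mom t / k * ((k * (y Vel t / y Mom t * cos (psi t) - 1 / y Rad t * sin (psi t)) +
         sin (psi t)) * cos (psi t) + (k * (y Vel t / y Mom t * sin (psi t) +
         1 / y Rad t * cos (psi t)) - cos (psi t)) * sin (psi t)))
      with (y Vel t * (sin (psi t) * sin (psi t) + cos (psi t) * cos (psi t))) by (field; lra).
      rewrite Hcs; ring. }
    assert (E1 : Z1 t * cos (psi t) <= c1 * y Vel t1 / 2 + ep * psi t).
    { assert (Z1 t * cos (psi t) <= (c1 * y Vel t1 + ep * psi t) * cos (psi t))
        by (apply Rmult_le_compat_r; lra).
      assert (0 <= ep * psi t * (1 - cos (psi t)))
        by (apply Rmult_le_pos; [apply Rmult_le_pos|]; lra).
      assert (0 <= c1 * - y Vel t1 * (cos (psi t) - / 2))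
        by (apply Rmult_le_pos; [apply Rmult_le_pos|]; lra). lra. }
    assert (E2 : Z2 t * sin (psi t) <= - (psi t / 4)).
    { assert (0 <= (- / 2 - Z2 t) * sin (psi t)) by (apply Rmult_le_pos; lra). lra. }
    assert (E3 : ep * psi t <= psi t / 4).
    { assert (0 <= (/ 4 - ep) * psi t) by (apply Rmult_le_pos; [unfold ep|]; lra). lra. }
    assert (E4 : Z1 t * cos (psi t) + Z2 t * sin (psi t) <= - (c1 / 2)).
    { assert (0 <= c1 * (- 1 - y Vel t1)) by (apply Rmult_le_pos; lra). lra. }
    assert (E5 : c1 / 2 / k <= y Mom t / k)
      by (apply Rmult_le_compat_r; [left; apply Rinv_0_lt_compat|]; trivial).
    assert (E6 : c1 / 2 / k * (c1 / 2) = / 4) by (unfold k; field; lra).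
    assert (E7 : 0 < c1 / 2 / k) by (apply Rdiv_lt_0_compat; lra).
    set (S := Z1 t * cos (psi t) + Z2 t * sin (psi t)) in *.
    assert (c1 / 2 / k * (c1 / 2) <= y Mom t / k * - S) by (apply Rmult_le_compat; lra).
    rewrite Hid. lra. }
  assert (- y Rad t1 - / 4 * t1 <= - y Rad tm - / 4 * tm).
  { apply (incr_of_deriv (fun t => - y Rad t - / 4 * t) (fun t => - y Vel t - / 4)); [lra|..].
    - intros t Ht. destruct (sol_at d M Hd tau y t Hy) as [_ [_ [H2 _]]]; [apply Hin; lra|].
      auto_derive; [derive_side | derive_facts; field].
    - intros t Ht; specialize (Hfall t Ht); lra. }
  assert (0 < y Rad tm) by (apply Hy, Hin; lra).
  unfold tm in *. lra.
Qed.

End Arcs.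

(** * Boundary value problems in polar coordinates *)

Section BoundaryValue.
Variables (d : R -> R -> R) (M a al T : R).
Hypothesis Hd : polar_damping d M.
Hypothesis Ha : 0 < a.
Hypothesis HT : 0 < T.

Notation survives := (survives d a al).

(** The collision before T leaves a positive time for the turn. Trajectories near the colliding one
    arrive close to the origin with inward speed at least 1, and c has only decreased meanwhile, so
    [bounce] applies with constants uniform in (p, c). *)
Lemma swept_large s tau Th : ~ survives s tau -> 0 <= tau < T -> 0 < Th < 2 * PI ->
  exists e, 0 < e /\ forall p c, Rabs (p - s) < e -> 0 < c < e ->
    forall y, polar_sol d T y -> starts y (init a al p c) -> al + Th < y Ang T.
Proof.
  intros Hs Htau HTh.
  destruct (bounce d M Hd Th HTh) as [Del0 [HDel0 Hb]].
  set (Del := Rmin Del0 (T - tau)).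
  assert (HDel : 0 < Del) by (apply Rmin_glb_lt; lra).
  assert (HD1 : Del <= Del0) by apply Rmin_l. assert (HD2 : Del <= T - tau) by apply Rmin_r.
  destruct (near_impact d M Hd a al Ha s tau 1 (Del / 8) Hs)
    as [t1 [eps [V [delta [Ht1 [Heps [Hdel H]]]]]]]; try lra.
  destruct (Hb Del eps V) as [c0 [Hc0 Hbb]]; try lra.
  exists (Rmin delta c0); split; [apply Rmin_glb_lt; trivial|].
  intros p c Hp Hc y Hy Hi.
  assert (B1 := Rmin_l delta c0). assert (B2 := Rmin_r delta c0).
  destruct (H p c T y) as [H1 H2]; trivial; try lra.
  { rewrite Rabs_pos_eq; lra. }
  assert (Hm0 : y Mom 0 = c) by (rewrite Hi; reflexivity).
  assert (Hm1 : y Mom t1 < c0).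
  { assert (Hsq := mom_sq_decr d M Hd T y t1 Hy ltac:(lra)). rewrite Hm0 in Hsq.
    assert (0 < y Mom t1) by (apply (mom_pos d M Hd T); trivial; lra). nra. }
  specialize (Hbb T y t1 Hy ltac:(lra) ltac:(lra) ltac:(lra) H1 H2 Hm1).
  assert (y Ang 0 <= y Ang t1) by (apply (ang_incr d M Hd T); trivial; lra).
  assert (y Ang (t1 + Del) <= y Ang T) by (apply (ang_incr d M Hd T); trivial; lra).
  rewrite Hi in H0; simpl in H0. lra.
Qed.

Lemma swept_small s Th : survives s T -> 0 < Th ->
  exists e, 0 < e /\ forall p c, Rabs (p - s) < e -> 0 < c < e ->
    forall y, polar_sol d T y -> starts y (init a al p c) -> y Ang T < al + Th.
Proof.
  intros [w [Hw Hwi]] HTh.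
  destruct (dependence d M Hd a al s 0 T w (Th / 2)) as [e [He H]]; trivial; try lra.
  exists e; split; trivial. intros p c Hp Hc y Hy Hi.
  destruct (H p c Hp) as [_ H']; [rewrite Rminus_0_r, Rabs_pos_eq; lra|].
  specialize (H' T y ltac:(lra) Hy Hi Ang T ltac:(lra)).
  destruct (rectilinear_const d M Hd T w T Hw (Hwi Mom) ltac:(lra)) as [_ Hang].
  rewrite Hang, (Hwi Ang) in H'; simpl in H'. apply Rabs_le_between in H'; lra.
Qed.

(* Since (r^2)' = 2 r r' and (r r')^2 <= 2 E r^2 + 2 r, the growth of 1 + r^2 after the near
   collision is controlled by the initial energy alone. *)
Lemma near_critical s b : ~ survives s T -> (forall tau, 0 <= tau < T -> survives s tau) ->
  0 < b -> exists e, 0 < e /\ forall p c, Rabs (p - s) < e -> Rabs c < e ->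
    forall y, polar_sol d T y -> starts y (init a al p c) -> y Rad T < b.
Proof.
  intros Hs Hlt Hb.
  (* With x <= 1 and 4x <= b^2 one has (1 + x)^2 <= 1 + 3x < 1 + b^2. *)
  set (x := Rmin (b ^ 2 / 4) 1).
  assert (Hb2 : 0 < b ^ 2) by (apply pow_lt; trivial).
  assert (Hx : 0 < x) by (apply Rmin_glb_lt; lra).
  assert (Hx1 : x <= b ^ 2 / 4) by apply Rmin_l. assert (Hx2 : x <= 1) by apply Rmin_r.
  set (EB := (Rabs s + 1) ^ 2 / 2 + 1 / (2 * a ^ 2)).
  assert (Ha2 : 0 < a ^ 2) by (apply pow_lt; trivial).
  assert (HEB : 0 <= EB).
  { assert (0 < 1 / (2 * a ^ 2)) by (apply Rdiv_lt_0_compat; lra).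
    assert (0 <= (Rabs s + 1) ^ 2) by apply pow2_ge_0. unfold EB; lra. }
  set (C := 2 + 2 * EB).
  assert (Hln : 0 < ln (1 + x)) by (rewrite <- ln_1; apply ln_increasing; lra).
  (* Since 2 r r' <= C (1 + r^2), the quantity 1 + r^2 grows by a factor of at most 1 + x during the
     time [sig]. *)
  set (sig := ln (1 + x) / C).
  assert (Hsig : 0 < sig) by (apply Rdiv_lt_0_compat; unfold C; lra).
  set (tau0 := Rmax 0 (T - sig)).
  assert (Htau0 : 0 <= tau0 < T) by (unfold tau0, Rmax; destruct (Rle_dec 0 (T - sig)); lra).
  assert (Htau0' : T - sig <= tau0) by apply Rmax_r.
  destruct (Hlt tau0 Htau0) as [w [Hw Hwi]].
  destruct (sol_bounds d tau0 w) as [m [N [Hm Hmw]]]; [lra | trivial|].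
  set (eps := Rmin (Rmin (m / 2) (a / 2)) (x / 5)).
  assert (Heps : 0 < eps).
  { unfold eps. apply Rmin_glb_lt; [apply Rmin_glb_lt|]; lra. }
  assert (He1 : eps <= Rmin (m / 2) (a / 2)) by apply Rmin_l.
  assert (He2 : eps <= x / 5) by apply Rmin_r.
  assert (He3 : eps <= m / 2) by (eapply Rle_trans; [apply He1 | apply Rmin_l]).
  assert (He4 : eps <= a / 2) by (eapply Rle_trans; [apply He1 | apply Rmin_r]).
  (* As [eps] lies below the minimum of r on [0, tau0], this radius is reached only in the last
     stretch, of length less than [sig]. *)
  destruct (dies_reaching d M Hd a al s T eps Hs) as [t1 [y [Ht1 [Hy [Hi Hr]]]]]; try lra.
  assert (Hlate : tau0 < t1).
  { apply Rnot_le_lt; intros Hle.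
    assert (y Rad t1 = w Rad t1).
    { apply (sol_unique d M Hd t1 y w); trivial; [|intros i; rewrite Hi, Hwi; trivial | lra].
      apply (sol_restrict d tau0); trivial. }
    destruct (Hmw t1) as [H1 _]; lra. }
  destruct (dependence d M Hd a al s 0 t1 y eps ltac:(lra) Heps Hy Hi) as [e [He H]].
  exists (Rmin e 1); split; [apply Rmin_glb_lt; lra|].
  intros p c Hp Hc z Hz Hzi.
  assert (B1 := Rmin_l e 1). assert (B2 := Rmin_r e 1).
  destruct (H p c) as [_ H']; [lra | rewrite Rminus_0_r; lra|].
  specialize (H' T z ltac:(lra) Hz Hzi Rad t1 ltac:(lra)). rewrite Hr in H'.
  apply Rabs_le_between in H'.
  assert (HE : energy z 0 <= EB).
  { unfold energy, EB; rewrite !Hzi; simpl init.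
    assert (p ^ 2 <= (Rabs s + 1) ^ 2).
    { rewrite <- (pow2_abs p). apply pow_incr; split; [apply Rabs_pos|].
      replace p with ((p - s) + s) by ring. eapply Rle_trans; [apply Rabs_triang | lra]. }
    assert (c ^ 2 / (2 * a ^ 2) <= 1 / (2 * a ^ 2)).
    { apply Rmult_le_compat_r; [left; apply Rinv_0_lt_compat; lra|].
      rewrite <- (pow2_abs c), <- (pow1 2). apply pow_incr; split; [apply Rabs_pos | lra]. }
    assert (0 < 1 / a) by (apply Rdiv_lt_0_compat; lra). lra. }
  assert (HzT : - ((1 + z Rad t1 ^ 2) * exp (- C * (t1 - t1))) <= - ((1 + z Rad T ^ 2) * exp (- C * (T - t1)))).
  { apply (incr_of_deriv (fun t => - ((1 + z Rad t ^ 2) * exp (- C * (t - t1))))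
      (fun t => (C * (1 + z Rad t ^ 2) - 2 * (z Rad t * z Vel t)) * exp (- C * (t - t1)))); [lra|..].
    - intros t Ht. destruct (sol_at d M Hd T z t Hz ltac:(lra)) as [_ [_ [H1 _]]].
      auto_derive; [derive_side | derive_facts; unfold Rminus; ring].
    - intros t Ht. apply Rmult_le_pos; [|left; apply exp_pos].
      assert (Hrt : 0 < z Rad t) by (apply Hz; lra).
      assert (Hsp := speed_bound d M Hd T z t Hz ltac:(lra)).
      assert (Hc0 : 0 <= z Mom t ^ 2 / z Rad t ^ 2)
        by (apply Rdiv_le_0_compat; [apply pow2_ge_0 | apply pow_lt; trivial]).
      assert (Hg : (z Rad t * z Vel t) ^ 2 <= 2 * EB * z Rad t ^ 2 + 2 * z Rad t).
      { replace ((z Rad t * z Vel t) ^ 2) with (z Rad t ^ 2 * z Vel t ^ 2) by ring.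
        replace (2 * EB * z Rad t ^ 2 + 2 * z Rad t) with (z Rad t ^ 2 * (2 * EB + 2 / z Rad t))
          by (field; lra).
        apply Rmult_le_compat_l; [apply pow2_ge_0 | lra]. }
      assert (0 <= (z Rad t * z Vel t - 1) ^ 2) by apply pow2_ge_0.
      assert (0 <= (z Rad t - 1) ^ 2) by apply pow2_ge_0.
      unfold C. nra. }
  rewrite Rminus_diag, Rmult_0_r, exp_0, Rmult_1_r in HzT.
  assert (HCe : exp (C * (T - t1)) <= 1 + x).
  { rewrite <- (exp_ln (1 + x)) by lra.
    assert (C * (T - t1) < ln (1 + x)); [|left; apply exp_increasing; trivial].
    assert (T - t1 < sig) by lra. unfold sig in H0. apply Rlt_div_r in H0; [|unfold C; lra]. lra. }
  assert (Hee : exp (- C * (T - t1)) * exp (C * (T - t1)) = 1).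
  { rewrite <- exp_plus. replace (- C * (T - t1) + C * (T - t1)) with 0 by ring. apply exp_0. }
  assert (Hfin : 1 + z Rad T ^ 2 <= (1 + z Rad t1 ^ 2) * exp (C * (T - t1))).
  { assert (HX := exp_pos (C * (T - t1))).
    apply Ropp_le_cancel in HzT. apply (Rmult_le_compat_r (exp (C * (T - t1)))) in HzT; [|lra].
    rewrite Rmult_assoc, Hee in HzT. lra. }
  assert (Hz1 : 1 + z Rad t1 ^ 2 <= 1 + x).
  { assert (0 < z Rad t1) by (apply Hz; lra). simpl. nra. }
  assert (1 + z Rad T ^ 2 < 1 + b ^ 2).
  { eapply Rle_lt_trans; [apply Hfin|]. apply Rle_lt_trans with ((1 + x) * (1 + x)).
    - apply Rmult_le_compat; trivial; [nra | left; apply exp_pos].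
    - nra. }
  assert (0 < z Rad T) by (apply Hz; lra). nra.
Qed.

(** The centrifugal barrier: c stays above c exp(- M T), while the energy bound gives c^2 <= 2 E r^2
    + 2 r, so r cannot come down to [eps]. *)
Lemma rotating_survives p c : 0 < c -> exists y, polar_sol d T y /\ starts y (init a al p c).
Proof.
  intros Hc. assert (HM : 0 <= M) by apply Hd.
  set (E0 := energy (fun i _ => init a al p c i) 0).
  set (c1 := c * exp (- M * T)).
  assert (Hc1 : 0 < c1) by (apply Rmult_lt_0_compat; [trivial | apply exp_pos]).
  assert (HE0 := Rabs_pos E0).
  set (rho := c1 ^ 2 / (2 * Rabs E0 + 2)).
  assert (Hrho : 0 < rho) by (apply Rdiv_lt_0_compat; [apply pow_lt; trivial | lra]).
  set (eps := Rmin (Rmin (rho / 2) (/ 2)) (a / 2)).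
  assert (Heps : 0 < eps).
  { unfold eps. apply Rmin_glb_lt; [apply Rmin_glb_lt|]; lra. }
  assert (He1 : eps <= Rmin (rho / 2) (/ 2)) by apply Rmin_l.
  assert (He2 : eps <= a / 2) by apply Rmin_r.
  assert (He3 : eps <= rho / 2) by (eapply Rle_trans; [apply He1 | apply Rmin_l]).
  assert (He4 : eps <= / 2) by (eapply Rle_trans; [apply He1 | apply Rmin_r]).
  destruct (continuation d M Hd (init a al p c) T eps) as [t1 [y [H1 [H2 [H3 [H4 H5]]]]]];
    [simpl; lra | lra|].
  destruct H5 as [->|H5]; [exists y; split; trivial|]. exfalso.
  assert (Hm := mom_lower d M Hd t1 y 0 t1 H2 ltac:(lra) ltac:(lra)).
  rewrite H3 in Hm; simpl in Hm. specialize (Hm Hc).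
  assert (Hm1 : c1 <= y Mom t1).
  { eapply Rle_trans; [|apply Hm]. apply Rmult_le_compat_l; [lra|].
    destruct (Req_dec (M * T) (M * (t1 - 0))) as [Heq|Hne].
    - right; f_equal; lra.
    - left; apply exp_increasing. assert (M * (t1 - 0) <= M * T) by nra. lra. }
  assert (Hsp := speed_bound d M Hd t1 y t1 H2 ltac:(lra)).
  assert (HEy : energy y 0 = E0) by (unfold E0, energy; rewrite !H3; reflexivity).
  rewrite HEy, H5 in Hsp.
  assert (0 <= y Vel t1 ^ 2) by apply pow2_ge_0.
  assert (Hk : y Mom t1 ^ 2 <= (2 * E0 + 2 / eps) * eps ^ 2).
  { apply Rle_div_l; [apply pow_lt; trivial | lra]. }
  replace ((2 * E0 + 2 / eps) * eps ^ 2) with (2 * E0 * eps ^ 2 + 2 * eps) in Hk by (field; lra).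
  assert (Hck : c1 ^ 2 <= y Mom t1 ^ 2) by (apply pow_incr; lra).
  assert (Hle := Rle_abs E0).
  assert (E0 * eps ^ 2 <= Rabs E0 * eps).
  { apply Rle_trans with (Rabs E0 * eps ^ 2); [apply Rmult_le_compat_r; [apply pow2_ge_0|trivial]|].
    apply Rmult_le_compat_l; [trivial | simpl; nra]. }
  assert (Hfin : c1 ^ 2 <= (2 * Rabs E0 + 2) * eps) by lra.
  assert (rho <= eps); [|lra].
  unfold rho. apply Rle_div_l; lra.
Qed.

Theorem polar_rectilinear_arc b : 0 < b ->
  exists s y, polar_sol d T y /\ starts y (init a al s 0) /\ y Rad T = b.
Proof.
  intros Hb.
  destruct (critical_velocity d M Hd a al Ha T HT) as [s [Hs1 [Hs2 [Hs3 _]]]].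
  destruct (near_critical s b Hs1 Hs2 Hb) as [e [He Hnear]].
  destruct (high_energy d M Hd T a b HT Ha Hb) as [E0 [HE0 Hhigh]].
  (* The default value 0 belongs to colliding velocities and is never met for p > s. *)
  set (flow := fun p => match excluded_middle_informative (survives p T) with
    | left H => proj1_sig (constructive_indefinite_description _ H) Rad T
    | right _ => 0 end).
  assert (Hflow : forall p, s < p -> exists y, polar_sol d T y /\ starts y (init a al p 0) /\ flow p = y Rad T).
  { intros p Hp; unfold flow. destruct (excluded_middle_informative _) as [H|H]; [|exfalso; auto].
    destruct (constructive_indefinite_description _ H) as [y [Hy Hi]]; exists y; auto. }
  assert (Hcont : forall p, s < p -> continuous flow p).
  { intros p Hp. apply continuous_eps; intros eps Heps.
    destruct (Hflow p Hp) as [y [Hy [Hi Hf]]].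
    destruct (dependence d M Hd a al p 0 T y (eps / 2)) as [dl [Hdl H]]; trivial; try lra.
    exists (Rmin dl (p - s)); split; [apply Rmin_glb_lt; lra|]. intros q Hq.
    assert (B1 := Rmin_l dl (p - s)). assert (B2 := Rmin_r dl (p - s)).
    assert (Hq' := Hq). apply Rabs_lt_between in Hq'.
    destruct (Hflow q) as [z [Hz [Hzi Hzf]]]; [lra|].
    destruct (H q 0) as [_ H']; [lra | rewrite Rminus_diag, Rabs_R0; trivial|].
    specialize (H' T z ltac:(lra) Hz Hzi Rad T ltac:(lra)). rewrite Hf, Hzf. lra. }
  set (X := E0 + 1 / a + 1).
  assert (HX : 1 <= X) by (unfold X; generalize (Rdiv_lt_0_compat 1 a); lra).
  set (p1 := s + e / 2). set (p2 := 2 * X + Rabs s + e).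
  assert (Hss := Rle_abs s). assert (Hsp := Rabs_pos s).
  assert (Hp12 : p1 <= p2) by (unfold p1, p2; lra).
  destruct (first_zero (fun p => b - flow p) p1 p2 Hp12) as [Hpos | [p [Hp [Hz _]]]].
  - intros p Hp; apply (continuous_minus (V := R_NormedModule));
    [apply continuous_const | apply Hcont; unfold p1 in Hp; lra].
  - destruct (Hflow p1) as [y [Hy [Hi ->]]]; [unfold p1; lra|].
    assert (y Rad T < b); [|lra]. apply (Hnear p1 0); trivial.
    + unfold p1; apply Rabs_def1; lra.
    + rewrite Rabs_R0; trivial.
  - exfalso. specialize (Hpos p2 ltac:(lra)).
    destruct (Hflow p2) as [y [Hy [Hi Hf]]]; [unfold p2; lra|]. rewrite Hf in Hpos.
    destruct (Hhigh T y ltac:(lra) Hy (Hi Rad)) as [_ Hh].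
    + unfold energy; rewrite !Hi; simpl init.
      replace (0 ^ 2 / (2 * a ^ 2)) with 0 by (field; lra).
      assert (2 * X <= p2) by (unfold p2; lra).
      assert (2 * X <= p2 ^ 2 / 2) by nra. unfold X in *; lra.
    + specialize (Hh eq_refl); lra.
  - destruct (Hflow p) as [y [Hy [Hi Hf]]]; [unfold p1 in Hp; lra|].
    exists p, y; repeat (split; trivial). rewrite <- Hf; lra.
Qed.

(* Initial velocities (p, c) are described by polar coordinates (phi, rho) centred at the
   critical velocity (s, 0).  The final radius is < b on a small and > b on a large half
   circle; along the two ends of the half circles the angle swept is < Th and > Th. *)
Theorem polar_rotating_arc b Th : 0 < b -> 0 < Th < 2 * PI ->
  exists p c y, 0 < c /\ polar_sol d T y /\ starts y (init a al p c) /\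
    y Rad T = b /\ y Ang T = al + Th.
Proof.
  intros Hb HTh.
  destruct (critical_velocity d M Hd a al Ha T HT) as [s [Hs1 [Hs2 [Hs3 Hs4]]]].
  destruct (near_critical s b Hs1 Hs2 Hb) as [e [He Hnear]].
  destruct (high_energy d M Hd T a b HT Ha Hb) as [E0 [HE0 Hhigh]].
  set (eta := e / 2).
  assert (Ha2 : 0 < a ^ 2) by (apply pow_lt; trivial).
  (* [kap] bounds the kinetic energy from below by kap rho^2 up to an additive constant. The entry
     1/4, rather than 1/2, comes from (s + x)^2 / 2 >= x^2 / 4 - s^2 / 2, which recentres the energy
     at the critical velocity. *)
  set (kap := Rmin (/ 4) (/ (2 * a ^ 2))).
  assert (Hkap : 0 < kap) by (apply Rmin_glb_lt; [lra | apply Rinv_0_lt_compat; lra]).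
  assert (Hk1 : kap <= / 4) by apply Rmin_l. assert (Hk2 : kap <= / (2 * a ^ 2)) by apply Rmin_r.
  set (X := E0 + s ^ 2 / 2 + 1 / a).
  assert (HX : 0 < X).
  { assert (0 < 1 / a) by (apply Rdiv_lt_0_compat; lra). generalize (pow2_ge_0 s); unfold X; lra. }
  set (P := 1 + eta + X / kap).
  assert (HXk : 0 < X / kap) by (apply Rdiv_lt_0_compat; trivial).
  assert (HP : 1 <= P /\ eta <= P /\ X <= kap * P ^ 2).
  { unfold P; split; [unfold eta; lra|]. split; [lra|]. fold P.
    assert (HP1 : X / kap <= P) by (unfold P, eta; lra).
    apply Rle_div_l in HP1; trivial.
    assert (1 <= P) by (unfold P, eta; lra). nra. }
  destruct HP as [HP1 [HP2 HP3]].
  destruct (uniform_near (s + eta / 2) (s + P) (fun p c =>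
    forall y, polar_sol d T y -> starts y (init a al p c) -> y Ang T < al + Th)) as [e1 [He1 Hsmall]].
  { intros q Hq; apply swept_small; [|lra]. apply Hs3; unfold eta in Hq; lra. }
  destruct (uniform_near (s - P) (s - eta / 2) (fun p c =>
    forall y, polar_sol d T y -> starts y (init a al p c) -> al + Th < y Ang T)) as [e2 [He2 Hlarge]].
  { intros q Hq. destruct (Hs4 q) as [tau [Htau Hq']]; [unfold eta in Hq; lra|].
    apply (swept_large q tau); trivial. }
  (* The entry 1 gives cos phi0 >= 1/2, so p keeps the distance eta/2 from s along both end rays;
     the other entries put c = rho sin phi0 below [e1] and [e2] for every rho <= P. *)
  set (phi0 := Rmin 1 (Rmin (e1 / (2 * P)) (e2 / (2 * P)))).
  assert (Hphi0 : 0 < phi0).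
  { unfold phi0; apply Rmin_glb_lt; [lra|]. apply Rmin_glb_lt; apply Rdiv_lt_0_compat; lra. }
  assert (Hphi1 : phi0 <= 1) by apply Rmin_l.
  assert (Hphi' : phi0 <= Rmin (e1 / (2 * P)) (e2 / (2 * P))) by apply Rmin_r.
  assert (Hphi2 : phi0 * (2 * P) <= e1).
  { apply Rle_div_r; [lra|]. eapply Rle_trans; [apply Hphi' | apply Rmin_l]. }
  assert (Hphi3 : phi0 * (2 * P) <= e2).
  { apply Rle_div_r; [lra|]. eapply Rle_trans; [apply Hphi' | apply Rmin_r]. }
  assert (HPI := PI2_3_2).
  assert (Hsin0 : sin phi0 < phi0) by (apply sin_lt_x; trivial).
  assert (Hcos0 := cos_ge_half phi0 ltac:(lra)).
  assert (Hcos0' : cos phi0 <= 1) by apply COS_bound.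
  assert (Hsinpos : forall phi, phi0 <= phi <= PI - phi0 -> 0 < sin phi)
    by (intros; apply sin_gt_0; lra).
  set (pv := fun phi rho => s + rho * cos phi). set (cv := fun phi rho => rho * sin phi).
  assert (Hcv : forall phi rho, phi0 <= phi <= PI - phi0 -> eta <= rho <= P -> 0 < cv phi rho).
  { intros phi rho H1 H2; apply Rmult_lt_0_compat; [unfold eta in H2; lra | auto]. }
  set (flow := fun i phi rho => match excluded_middle_informative (0 < cv phi rho) with
    | left H => proj1_sig (constructive_indefinite_description _
                  (rotating_survives (pv phi rho) (cv phi rho) H)) i T
    | right _ => 0 end).
  assert (Hflow : forall phi rho, phi0 <= phi <= PI - phi0 -> eta <= rho <= P ->
    exists y, polar_sol d T y /\ starts y (init a al (pv phi rho) (cv phi rho)) /\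
      forall i, flow i phi rho = y i T).
  { intros phi rho H1 H2; unfold flow.
    destruct (excluded_middle_informative _) as [H|H]; [|exfalso; auto].
    destruct (constructive_indefinite_description _ _) as [y [Hy Hi]]; exists y; auto. }
  assert (Htrig : forall (tr : R -> R) phi rho, (forall x, continuous tr x) -> forall eps, 0 < eps ->
    exists dl, 0 < dl /\ forall u v, Rabs (u - phi) < dl -> Rabs (v - rho) < dl ->
      Rabs (tr u) <= 1 -> Rabs (v * tr u - rho * tr phi) < eps).
  { intros tr phi rho Htr eps Heps.
    specialize (Htr phi). rewrite continuous_eps in Htr.
    assert (HR := Rabs_pos rho).
    destruct (Htr (eps / (2 * (Rabs rho + 1)))) as [d1 [Hd1 H1]]; [apply Rdiv_lt_0_compat; lra|].
    exists (Rmin d1 (eps / 2)); split; [apply Rmin_glb_lt; lra|].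
    intros u v Hu Hv Hb1.
    specialize (H1 u (Rlt_le_trans _ _ _ Hu (Rmin_l _ _))).
    assert (Hv' := Rlt_le_trans _ _ _ Hv (Rmin_r _ _)).
    apply Rlt_div_r in H1; [|lra].
    replace (v * tr u - rho * tr phi) with ((v - rho) * tr u + rho * (tr u - tr phi)) by ring.
    eapply Rle_lt_trans; [apply Rabs_triang|]. rewrite !Rabs_mult.
    assert (Hq := Rabs_pos (v - rho)). assert (Hq2 := Rabs_pos (tr u - tr phi)).
    assert (Rabs (v - rho) * Rabs (tr u) <= Rabs (v - rho)) by nra. nra. }
  assert (Hcont : forall i, continuous_on_rect phi0 (PI - phi0) eta P (flow i)).
  { intros i phi rho Hphi Hrho eps Heps.
    destruct (Hflow phi rho Hphi Hrho) as [y [Hy [Hi Hf]]].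
    destruct (dependence d M Hd a al (pv phi rho) (cv phi rho) T y (eps / 2)) as [dl [Hdl H]];
      trivial; try lra.
    destruct (Htrig cos phi rho continuous_cos dl Hdl) as [d1 [Hd1 H1]].
    destruct (Htrig sin phi rho continuous_sin dl Hdl) as [d2 [Hd2 H2]].
    exists (Rmin d1 d2); split; [apply Rmin_glb_lt; trivial|].
    intros u v Hu Hv Hu' Hv'.
    assert (B1 := Rmin_l d1 d2). assert (B2 := Rmin_r d1 d2).
    destruct (Hflow u v Hu Hv) as [z [Hz [Hzi Hzf]]].
    destruct (H (pv u v) (cv u v)) as [_ H'].
    - unfold pv. replace (s + v * cos u - (s + rho * cos phi)) with (v * cos u - rho * cos phi) by ring.
      apply H1; try lra. apply Rabs_le, COS_bound.
    - unfold cv; apply H2; try lra. apply Rabs_le, SIN_bound.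
    - specialize (H' T z ltac:(lra) Hz Hzi i T ltac:(lra)). rewrite Hf, Hzf. lra. }
  assert (Hshift : forall i k, continuous_on_rect phi0 (PI - phi0) eta P (fun phi rho => flow i phi rho - k)).
  { intros i k phi rho Hphi Hrho eps Heps.
    destruct (Hcont i phi rho Hphi Hrho eps Heps) as [dl [Hdl H]].
    exists dl; split; trivial. intros u v Hu Hv H1 H2.
    replace (flow i u v - k - (flow i phi rho - k)) with (flow i u v - flow i phi rho) by ring. auto. }
  destruct (poincare_miranda phi0 (PI - phi0) eta P
    (fun phi rho => flow Ang phi rho - (al + Th)) (fun phi rho => flow Rad phi rho - b))
    as [phi [rho [Hphi [Hrho [Hang Hrad]]]]]; trivial; try lra.
  - intros rho Hrho. destruct (Hflow phi0 rho ltac:(lra) Hrho) as [y [Hy [Hi ->]]].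
    assert (y Ang T < al + Th); [|lra].
    apply (Hsmall (pv phi0 rho) (cv phi0 rho)); trivial.
    + unfold pv, eta in *; nra.
    + split; [apply Hcv; lra|]. unfold cv. unfold eta in Hrho. nra.
  - intros rho Hrho. destruct (Hflow (PI - phi0) rho ltac:(lra) Hrho) as [y [Hy [Hi ->]]].
    assert (al + Th < y Ang T); [|lra].
    assert (Hc' : cos (PI - phi0) = - cos phi0) by (rewrite cos_minus, cos_PI, sin_PI; ring).
    assert (Hs' : sin (PI - phi0) = sin phi0) by (rewrite sin_minus, cos_PI, sin_PI; ring).
    apply (Hlarge (pv (PI - phi0) rho) (cv (PI - phi0) rho)); trivial.
    + unfold pv; rewrite Hc'. unfold eta in *; nra.
    + split; [apply Hcv; lra|]. unfold cv; rewrite Hs'. unfold eta in Hrho. nra.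
  - intros phi Hphi. destruct (Hflow phi eta Hphi ltac:(lra)) as [y [Hy [Hi ->]]].
    assert (y Rad T < b); [|lra].
    assert (He0 : 0 < eta < e) by (unfold eta; lra).
    apply (Hnear (pv phi eta) (cv phi eta)); trivial.
    + unfold pv. replace (s + eta * cos phi - s) with (eta * cos phi) by ring.
      generalize (COS_bound phi); intros; apply Rabs_def1; nra.
    + unfold cv. generalize (SIN_bound phi); intros; apply Rabs_def1; nra.
  - intros phi Hphi. destruct (Hflow phi P Hphi ltac:(lra)) as [y [Hy [Hi ->]]].
    destruct (Hhigh T y ltac:(lra) Hy (Hi Rad)) as [_ Hh]; [|specialize (Hh eq_refl); lra].
    unfold energy; rewrite !Hi; simpl init. unfold pv, cv.
    assert (Hcs := sin2_cos2 phi). unfold Rsqr in Hcs.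
    set (C := cos phi) in *. set (S := sin phi) in *.
    assert (Hpc : (P * C) ^ 2 / 4 - s ^ 2 / 2 <= (s + P * C) ^ 2 / 2)
      by (generalize (pow2_ge_0 (2 * s + P * C)); lra).
    assert (Hkc : kap * (P * C) ^ 2 <= (P * C) ^ 2 / 4)
      by (generalize (pow2_ge_0 (P * C)); intros; nra).
    assert (Hks : kap * (P * S) ^ 2 <= (P * S) ^ 2 / (2 * a ^ 2)).
    { unfold Rdiv. rewrite (Rmult_comm ((P * S) ^ 2)). apply Rmult_le_compat_r; trivial. apply pow2_ge_0. }
    assert (Hsum : kap * (P * C) ^ 2 + kap * (P * S) ^ 2 = kap * P ^ 2).
    { replace (kap * (P * C) ^ 2 + kap * (P * S) ^ 2) with (kap * P ^ 2 * (S * S + C * C)) by ring.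
      rewrite Hcs; ring. }
    unfold X in HP3. lra.
  - destruct (Hflow phi rho Hphi Hrho) as [y [Hy [Hi Hf]]].
    exists (pv phi rho), (cv phi rho), y.
    split; [apply Hcv; trivial|]. rewrite <- !Hf. repeat (split; trivial); lra.
Qed.

End BoundaryValue.

(** * Back to Cartesian coordinates *)

Lemma norm2_sqr x y : norm2 x y * norm2 x y = x * x + y * y.
Proof. unfold norm2; apply sqrt_sqrt; nra. Qed.

Lemma norm2_pos x y : (x, y) <> (0, 0) -> 0 < norm2 x y.
Proof.
  intros H. unfold norm2; apply sqrt_lt_R0.
  destruct (Req_dec x 0) as [->|Hx]; [destruct (Req_dec y 0) as [->|Hy]; [tauto|nra]|nra].
Qed.

Lemma pair_nonzero x y : 0 < norm2 x y -> (x, y) <> (0, 0).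
Proof.
  intros H Heq; injection Heq as -> ->. assert (Hn := norm2_sqr 0 0). nra.
Qed.

Lemma norm2_le x y n : 0 <= n -> x * x + y * y <= n * n -> norm2 x y <= n.
Proof.
  intros Hn H. assert (0 <= norm2 x y) by apply sqrt_pos.
  assert (Hs := norm2_sqr x y). nra.
Qed.

Lemma norm2_ge_fst x y : Rabs x <= norm2 x y.
Proof.
  assert (H0 : 0 <= norm2 x y) by apply sqrt_pos. assert (Hs := norm2_sqr x y).
  apply Rabs_le; split; nra.
Qed.

Lemma norm2_sym x y : norm2 x y = norm2 y x.
Proof. unfold norm2; f_equal; ring. Qed.

Lemma norm2_shift x x' y : norm2 x y <= norm2 x' y + Rabs (x - x').
Proof.
  assert (H0 : 0 <= norm2 x' y) by apply sqrt_pos. assert (Hs := norm2_sqr x' y).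
  assert (Hf := norm2_ge_fst x' y). assert (Ha := Rabs_pos (x - x')).
  apply norm2_le; [lra|].
  assert (Hh : (x - x') * (x - x') = Rabs (x - x') * Rabs (x - x')).
  { rewrite <- Rabs_mult, Rabs_pos_eq; [ring | apply Rle_0_sqr]. }
  assert (x' * (x - x') <= norm2 x' y * Rabs (x - x')).
  { eapply Rle_trans; [apply Rle_abs|]. rewrite Rabs_mult. apply Rmult_le_compat_r; trivial. }
  nra.
Qed.

Lemma norm2_le_sum x y : norm2 x y <= Rabs x + Rabs y.
Proof.
  eapply Rle_trans; [apply (norm2_shift x 0 y)|]. rewrite Rminus_0_r.
  rewrite norm2_sym. assert (H := norm2_shift y 0 0). rewrite Rminus_0_r in H.
  assert (norm2 0 0 <= 0) by (apply norm2_le; lra). lra.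
Qed.

(** The gauge is tied to the size of [f]: a Lebesgue number e with e <= 1 / (|f| + 1) at the tag
    point bounds |f| + 1 by 1/e. At the origin a gauge below rho/2 excludes all points of norm at
    least rho. *)
Lemma punctured_bounded (f : R -> R -> R) (rho K : R) : cont_punctured f -> 0 < rho ->
  exists N, 0 <= N /\ forall x y, Rabs x <= K -> Rabs y <= K -> rho <= norm2 x y -> Rabs (f x y) <= N.
Proof.
  intros Hf Hrho.
  assert (H : forall u v, exists dl : posreal,
    dl <= / (Rabs (f u v) + 1) /\
    forall x y, Rabs (x - u) < dl -> Rabs (y - v) < dl -> rho <= norm2 x y -> Rabs (f x y) <= Rabs (f u v) + 1).
  { intros u v. assert (Hp := Rabs_pos (f u v)).
    assert (Hi : 0 < / (Rabs (f u v) + 1)) by (apply Rinv_0_lt_compat; lra).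
    destruct (classic ((u, v) = (0, 0))) as [Huv|Huv].
    - assert (Hd : 0 < Rmin (rho / 2) (/ (Rabs (f u v) + 1))) by (apply Rmin_glb_lt; lra).
      exists (mkposreal _ Hd); simpl; split; [apply Rmin_r|].
      intros x y Hx Hy Hn; exfalso.
      injection Huv as -> ->. rewrite Rminus_0_r in Hx, Hy.
      assert (H1 := Rmin_l (rho / 2) (/ (Rabs (f 0 0) + 1))).
      assert (H2 := norm2_le_sum x y). lra.
    - destruct (Hf u v Huv 1 Rlt_0_1) as [e [He Hc]].
      assert (Hd : 0 < Rmin (e / 2) (/ (Rabs (f u v) + 1))) by (apply Rmin_glb_lt; lra).
      exists (mkposreal _ Hd); simpl; split; [apply Rmin_r|].
      intros x y Hx Hy Hn.
      assert (H1 := Rmin_l (e / 2) (/ (Rabs (f u v) + 1))).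
      assert (H2 := norm2_le_sum (x - u) (y - v)).
      assert (H3 : Rabs (f x y - f u v) < 1).
      { apply Hc; [apply pair_nonzero; lra | lra]. }
      replace (f x y) with ((f x y - f u v) + f u v) by ring.
      eapply Rle_trans; [apply Rabs_triang | lra]. }
  set (delta := fun u v => proj1_sig (constructive_indefinite_description _ (H u v))).
  destruct (compactness_value_2d (- K) K (- K) K delta) as [e He].
  assert (He0 := cond_pos e).
  exists (/ e + 1); split; [generalize (Rinv_0_lt_compat e He0); lra|].
  intros x y Hx Hy Hn. apply NNPP; intros Hno.
  apply Rabs_le_between in Hx. apply Rabs_le_between in Hy.
  apply (He x y Hx Hy). intros [u [v [_ [_ [Hxu [Hyv Hle]]]]]]. apply Hno.
  unfold delta in Hxu, Hyv, Hle.
  destruct (constructive_indefinite_description _ (H u v)) as [dl [Hdl1 Hdl2]]; simpl in *.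
  specialize (Hdl2 x y Hxu Hyv Hn).
  assert (Hp := Rabs_pos (f u v)).
  assert (Rabs (f u v) + 1 <= / e).
  { rewrite <- (Rinv_inv (Rabs (f u v) + 1)). apply Rinv_le_contravar; lra. }
  lra.
Qed.

Lemma mvt_lipschitz (f df : R -> R) (N u v : R) :
  (forall x, Rmin u v <= x <= Rmax u v -> is_derive f x (df x) /\ Rabs (df x) <= N) ->
  Rabs (f v - f u) <= N * Rabs (v - u).
Proof.
  intros H. destruct (MVT_gen f u v df) as [c [Hc Heq]].
  - intros x Hx; apply H; lra.
  - intros x Hx. apply continuity_pt_filterlim, (is_derive_cont _ _ (df x)), H, Hx.
  - rewrite Heq, Rabs_mult. apply Rmult_le_compat_r; [apply Rabs_pos | apply H, Hc].
Qed.

Lemma between_abs u v x : Rmin u v <= x <= Rmax u v ->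
  Rabs (x - u) <= Rabs (v - u) /\ Rabs (x - v) <= Rabs (v - u) /\ Rabs x <= Rmax (Rabs u) (Rabs v).
Proof.
  unfold Rmin, Rmax; destruct (Rle_dec u v); intros Hx; destruct (Rle_dec (Rabs u) (Rabs v)) as [H|H];
  revert H; unfold Rabs;
  repeat match goal with |- context [Rcase_abs ?z] => destruct (Rcase_abs z) end; lra.
Qed.

(** The annulus is not convex. For two close points the axis-parallel path joining them stays
    outside the radius rho/2, where the partial derivatives are bounded; for distant points the
    bound 2M on the difference is already proportional to the distance. *)
Lemma annulus_lipschitz (D : R -> R -> R) (K : R) : damping_hyp D -> 1 <= K ->
  exists L, 0 <= L /\ forall x1 y1 x2 y2, / K <= norm2 x1 y1 <= K -> / K <= norm2 x2 y2 <= K ->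
    Rabs (D x1 y1 - D x2 y2) <= L * (Rabs (x1 - x2) + Rabs (y1 - y2)).
Proof.
  intros [_ [[M HM] [D1 [D2 [[Hder [HD1 HD2]] _]]]]] HK.
  set (rho := / K). assert (Hrho : 0 < rho) by (apply Rinv_0_lt_compat; lra).
  destruct (punctured_bounded D1 (rho / 2) K HD1) as [N1 [HN1 HB1]]; [lra|].
  destruct (punctured_bounded D2 (rho / 2) K HD2) as [N2 [HN2 HB2]]; [lra|].
  assert (HM0 : 0 <= M).
  { eapply Rle_trans; [apply Rabs_pos | apply (HM 1 0)]. intros H; injection H; lra. }
  assert (Hq : 0 <= 4 * M / rho) by (apply Rdiv_le_0_compat; lra).
  exists (N1 + N2 + 4 * M / rho); split; [lra|].
  intros x1 y1 x2 y2 Hp1 Hp2. fold rho in Hp1, Hp2.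
  assert (Hax := Rabs_pos (x1 - x2)). assert (Hay := Rabs_pos (y1 - y2)).
  set (S := Rabs (x1 - x2) + Rabs (y1 - y2)).
  destruct (Rlt_dec S (rho / 2)) as [Hnear|Hfar].
  - assert (Cx1 := norm2_ge_fst x1 y1). assert (Cx2 := norm2_ge_fst x2 y2).
    assert (Cy1 := norm2_ge_fst y1 x1). rewrite norm2_sym in Cy1.
    assert (Cy2 := norm2_ge_fst y2 x2). rewrite norm2_sym in Cy2.
    assert (H1 : Rabs (D x1 y1 - D x2 y1) <= N1 * Rabs (x1 - x2)).
    { apply (mvt_lipschitz (fun s => D s y1) (fun s => D1 s y1)). intros x Hx.
      destruct (between_abs x2 x1 x Hx) as [Q1 [Q2 Q3]].
      assert (Hn := norm2_shift x1 x y1). rewrite Rabs_minus_sym in Hn. unfold S in Hnear.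
      split.
      - apply is_derive_Reals, Hder, pair_nonzero; lra.
      - apply HB1; try lra. eapply Rle_trans; [apply Q3|]. apply Rmax_lub; lra. }
    assert (H2 : Rabs (D x2 y1 - D x2 y2) <= N2 * Rabs (y1 - y2)).
    { apply (mvt_lipschitz (fun s => D x2 s) (fun s => D2 x2 s)). intros y Hy.
      destruct (between_abs y2 y1 y Hy) as [Q1 [Q2 Q3]].
      assert (Hn := norm2_shift y2 y x2). rewrite Rabs_minus_sym, norm2_sym, (norm2_sym y) in Hn.
      unfold S in Hnear. split.
      - apply is_derive_Reals, Hder, pair_nonzero; lra.
      - apply HB2; try lra. eapply Rle_trans; [apply Q3|]. apply Rmax_lub; lra. }
    replace (D x1 y1 - D x2 y2) with ((D x1 y1 - D x2 y1) + (D x2 y1 - D x2 y2)) by ring.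
    eapply Rle_trans; [apply Rabs_triang|]. unfold S in *. nra.
  - assert (H1 := HM x1 y1 (pair_nonzero x1 y1 ltac:(lra))).
    assert (H2 := HM x2 y2 (pair_nonzero x2 y2 ltac:(lra))).
    replace (D x1 y1 - D x2 y2) with (D x1 y1 + - D x2 y2) by ring.
    eapply Rle_trans; [apply Rabs_triang|]. rewrite Rabs_Ropp.
    assert (2 * M <= 4 * M / rho * S).
    { replace (2 * M) with (4 * M / rho * (rho / 2)) by (field; lra).
      apply Rmult_le_compat_l; lra. }
    assert (0 <= (N1 + N2) * S) by (apply Rmult_le_pos; unfold S; lra). lra.
Qed.

Lemma norm2_polar sg r th : sg * sg = 1 -> 0 <= r -> norm2 (r * cos th) (sg * (r * sin th)) = r.
Proof.
  intros Hsg Hr. unfold norm2.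
  replace (r * cos th * (r * cos th) + sg * (r * sin th) * (sg * (r * sin th))) with (r * r).
  - apply sqrt_square; trivial.
  - assert (H := sin2_cos2 th); unfold Rsqr in H.
    replace (r * cos th * (r * cos th) + sg * (r * sin th) * (sg * (r * sin th)))
      with (r * r * ((sg * sg) * (sin th * sin th) + cos th * cos th)) by ring.
    rewrite Hsg, Rmult_1_l, H; ring.
Qed.

(* With sg = -1 this is D reflected in the first axis, which turns clockwise arcs into
   counterclockwise ones. *)
Definition polar_of (D : R -> R -> R) (sg r th : R) : R := D (r * cos th) (sg * (r * sin th)).

Lemma polar_of_damping (D : R -> R -> R) (sg : R) : damping_hyp D -> sg * sg = 1 ->
  exists M, polar_damping (polar_of D sg) M.
Proof.
  intros HD Hsg. assert (HD' := HD). destruct HD' as [Hpos [[M HM] _]].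
  assert (Hnz : forall r th, 0 < r -> (r * cos th, sg * (r * sin th)) <> (0, 0)).
  { intros r th Hr; apply pair_nonzero; rewrite norm2_polar; lra. }
  exists M; split; [|split].
  - eapply Rle_trans; [apply Rabs_pos | apply (HM 1 0)]. intros H; injection H; lra.
  - intros r th Hr; split; [apply Hpos; auto|].
    eapply Rle_trans; [apply Rle_abs | apply HM; auto].
  - intros K HK. destruct (annulus_lipschitz D K HD HK) as [L [HL0 HL]].
    exists (2 * L * (1 + K)); split; [nra|]. intros r1 r2 th1 th2 H1 H2.
    assert (HiK : 0 < / K) by (apply Rinv_0_lt_compat; lra).
    assert (Hs : Rabs sg = 1).
    { assert (Rabs sg * Rabs sg = 1) by (rewrite <- Rabs_mult, Hsg; apply Rabs_R1).
      assert (0 <= Rabs sg) by apply Rabs_pos. nra. }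
    assert (Hr := Rabs_pos (r1 - r2)). assert (Ht := Rabs_pos (th1 - th2)).
    assert (Htrig : forall f : R -> R, Rabs (f th1 - f th2) <= 1 * Rabs (th1 - th2) -> Rabs (f th1) <= 1 ->
      Rabs (r1 * f th1 - r2 * f th2) <= Rabs (r1 - r2) + K * Rabs (th1 - th2)).
    { intros f Hf Hf1.
      replace (r1 * f th1 - r2 * f th2) with ((r1 - r2) * f th1 + r2 * (f th1 - f th2)) by ring.
      eapply Rle_trans; [apply Rabs_triang|]. rewrite !Rabs_mult, (Rabs_pos_eq r2) by lra.
      assert (Rabs (r1 - r2) * Rabs (f th1) <= Rabs (r1 - r2)) by nra.
      assert (r2 * Rabs (f th1 - f th2) <= K * Rabs (th1 - th2))
        by (apply Rmult_le_compat; try lra; apply Rabs_pos). lra. }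
    assert (Hc : Rabs (r1 * cos th1 - r2 * cos th2) <= Rabs (r1 - r2) + K * Rabs (th1 - th2)).
    { apply Htrig; [|apply Rabs_le, COS_bound].
      apply (mvt_lipschitz cos (fun x => - sin x)). intros x _; split.
      - auto_derive; trivial; ring.
      - rewrite Rabs_Ropp; apply Rabs_le, SIN_bound. }
    assert (Hsn : Rabs (r1 * sin th1 - r2 * sin th2) <= Rabs (r1 - r2) + K * Rabs (th1 - th2)).
    { apply Htrig; [|apply Rabs_le, SIN_bound].
      apply (mvt_lipschitz sin cos). intros x _; split.
      - auto_derive; trivial; ring.
      - apply Rabs_le, COS_bound. }
    unfold polar_of. eapply Rle_trans; [apply HL; rewrite norm2_polar; lra|].
    replace (sg * (r1 * sin th1) - sg * (r2 * sin th2)) with (sg * (r1 * sin th1 - r2 * sin th2)) by ring.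
    rewrite Rabs_mult, Hs, Rmult_1_l.
    apply Rle_trans with (L * (2 * (Rabs (r1 - r2) + K * Rabs (th1 - th2)))).
    + apply Rmult_le_compat_l; lra.
    + assert (0 <= K * Rabs (r1 - r2)) by (apply Rmult_le_pos; lra).
      replace (2 * L * (1 + K) * (Rabs (r1 - r2) + Rabs (th1 - th2))) with
        (L * (2 * ((1 + K) * (Rabs (r1 - r2) + Rabs (th1 - th2))))) by ring.
      apply Rmult_le_compat_l; lra.
Qed.

(** * Translation between polar solutions on [0, T] and arcs on [- T, 0] *)

Lemma deriv_on_shift (T : R) (f df : R -> R) :
  (forall s, 0 <= s <= T -> is_derive f s (df s)) ->
  deriv_on (- T) 0 (fun t => f (t + T)) (fun t => df (t + T)).
Proof.
  intros H t Ht eps He. unfold in_I in *.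
  assert (Hs := H (t + T) ltac:(lra)). rewrite is_derive_eps in Hs.
  destruct (Hs eps He) as [dl [Hdl Hd]]. exists dl; split; trivial.
  intros h Hh _ Hlt. replace (t + h + T) with (t + T + h) by ring. auto.
Qed.

Lemma cont_on_shift (T : R) (f : R -> R) :
  (forall s, 0 <= s <= T -> continuous f s) -> cont_on (- T) 0 (fun t => f (t + T)).
Proof.
  intros H t Ht eps He. unfold in_I in *.
  assert (Hs := H (t + T) ltac:(lra)). rewrite continuous_eps in Hs.
  destruct (Hs eps He) as [dl [Hdl Hd]]. exists dl; split; trivial.
  intros s _ Hlt. apply Hd. replace (s + T - (t + T)) with (s - t) by ring; trivial.
Qed.

Lemma arc_of_polar (D : R -> R -> R) (sg T : R) (k : rot_kind) (y : coord -> R -> R) :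
  damping_hyp D -> sg * sg = 1 -> 0 < T -> polar_sol (polar_of D sg) T y ->
  Rabs (y Ang T - y Ang 0) < 2 * PI ->
  has_kind k (fun t => sg * y Mom (t + T)) T ->
  arc_of_kind D T (y Rad 0 * cos (y Ang 0), sg * (y Rad 0 * sin (y Ang 0)))
    (y Rad T * cos (y Ang T), sg * (y Rad T * sin (y Ang T))) k
    (fun t => y Rad (t + T) * cos (y Ang (t + T)))
    (fun t => sg * (y Rad (t + T) * sin (y Ang (t + T)))).
Proof.
  intros HD Hsg HT Hy Hw Hk.
  destruct (polar_of_damping D sg HD Hsg) as [M Hd].
  set (d := polar_of D sg) in *.
  assert (Hat := fun t Ht => sol_at d M Hd T y t Hy Ht).
  set (V1 := fun s => y Vel s * cos (y Ang s) - y Mom s / y Rad s * sin (y Ang s)).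
  set (V2 := fun s => sg * (y Vel s * sin (y Ang s) + y Mom s / y Rad s * cos (y Ang s))).
  set (X1 := fun s => y Rad s * cos (y Ang s)).
  set (X2 := fun s => sg * (y Rad s * sin (y Ang s))).
  set (A1 := fun s => - d (y Rad s) (y Ang s) * V1 s - X1 s / y Rad s ^ 3).
  set (A2 := fun s => - d (y Rad s) (y Ang s) * V2 s - X2 s / y Rad s ^ 3).
  assert (HX : forall s, 0 <= s <= T -> is_derive X1 s (V1 s) /\ is_derive X2 s (V2 s)).
  { intros s Hs; destruct (Hat s Hs) as [Hr [_ [H1 [H2 _]]]].
    unfold X1, X2, V1, V2; split; (auto_derive; [derive_side | derive_facts; field; lra]). }
  assert (HV : forall s, 0 <= s <= T -> is_derive V1 s (A1 s) /\ is_derive V2 s (A2 s)).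
  { intros s Hs; destruct (Hat s Hs) as [Hr [_ [H1 [H2 [H3 H4]]]]].
    unfold V1, V2, A1, A2, V1, V2, X1, X2; split;
    (auto_derive; [derive_side | derive_facts; field; lra]). }
  assert (Hdc : forall s, 0 <= s <= T -> continuous (fun s => - d (y Rad s) (y Ang s)) s).
  { intros s Hs; destruct (Hat s Hs) as [Hr [_ [H1 [H2 _]]]].
    apply (continuous_opp (V := R_NormedModule)), (damping_continuous d M Hd); trivial;
    eapply is_derive_cont; eassumption. }
  assert (HA : forall s, 0 <= s <= T -> continuous A1 s /\ continuous A2 s).
  { intros s Hs; destruct (Hat s Hs) as [Hr [_ [H1 [H2 _]]]]. destruct (HX s Hs), (HV s Hs).
    assert (Hr3 : 0 < y Rad s ^ 3) by (apply pow_lt; trivial).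
    split; apply (continuous_minus (V := R_NormedModule)).
    - apply (continuous_mult (K := R_AbsRing)); [auto | eapply is_derive_cont; eassumption].
    - apply (@ex_derive_continuous R_AbsRing R_NormedModule).
      auto_derive; derive_side; simpl in *; lra.
    - apply (continuous_mult (K := R_AbsRing)); [auto | eapply is_derive_cont; eassumption].
    - apply (@ex_derive_continuous R_AbsRing R_NormedModule).
      auto_derive; derive_side; simpl in *; lra. }
  assert (HN : forall s, 0 <= s <= T -> norm2 (X1 s) (X2 s) = y Rad s).
  { intros s Hs; apply norm2_polar; trivial. left; apply (Hat s Hs). }
  exists (fun t => V1 (t + T)), (fun t => V2 (t + T)), (fun t => A1 (t + T)), (fun t => A2 (t + T)).
  split; [|split; [|split; [|split]]].
  - split; [apply (deriv_on_shift T X1 V1); apply HX|].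
    split; [apply (deriv_on_shift T X2 V2); apply HX|].
    split; [apply (deriv_on_shift T V1 A1); apply HV|].
    split; [apply (deriv_on_shift T V2 A2); apply HV|].
    split; [apply (cont_on_shift T A1); apply HA|].
    split; [apply (cont_on_shift T A2); apply HA|].
    intros t Ht. unfold in_I in Ht. set (s := t + T).
    assert (Hs : 0 <= s <= T) by (unfold s; lra).
    change (y Rad s * cos (y Ang s)) with (X1 s). change (sg * (y Rad s * sin (y Ang s))) with (X2 s).
    rewrite (HN s Hs). destruct (Hat s Hs) as [Hr _].
    split; [apply pair_nonzero; rewrite HN; trivial|].
    unfold A1, A2, d, polar_of; fold (X1 s) (X2 s). split; field; lra.
  - f_equal; replace (- T + T) with 0 by ring; reflexivity.
  - rewrite Rplus_0_l; reflexivity.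
  (* The polar angle, with its sign reversed in the reflected case, is itself the continuous
     lift. *)
  - exists (fun t => sg * y Ang (t + T)).
    assert (Hsg1 : sg = 1 \/ sg = - 1).
    { assert (Hz : (sg - 1) * (sg + 1) = 0) by (ring_simplify; lra).
      apply Rmult_integral in Hz; lra. }
    split; [|split].
    + apply (cont_on_shift T (fun s => sg * y Ang s)). intros s Hs.
      apply (continuous_mult (K := R_AbsRing)); [apply continuous_const | apply (sol_cont d T); trivial].
    + intros t Ht. unfold in_I in Ht. set (s := t + T).
      assert (Hs : 0 <= s <= T) by (unfold s; lra).
      change (y Rad s * cos (y Ang s)) with (X1 s). change (sg * (y Rad s * sin (y Ang s))) with (X2 s).
      rewrite (HN s Hs). unfold X1, X2.
      destruct Hsg1 as [-> | ->]; [rewrite Rmult_1_l | replace (-1 * y Ang s) with (- y Ang s) by ring;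
        rewrite cos_neg, sin_neg]; split; ring.
    + replace (0 + T) with T by ring. replace (- T + T) with 0 by ring.
      replace (sg * y Ang T - sg * y Ang 0) with (sg * (y Ang T - y Ang 0)) by ring.
      rewrite Rabs_mult. destruct Hsg1 as [-> | ->]; [rewrite Rabs_R1 | rewrite Rabs_left by lra]; lra.
  - intros t Ht. specialize (Hk t Ht). unfold in_I in Ht. unfold angmom. cbv beta in *. set (s := t + T) in *.
    assert (Hs : 0 <= s <= T) by (unfold s; lra). destruct (Hat s Hs) as [Hr _].
    replace (y Rad s * cos (y Ang s) * V2 s - sg * (y Rad s * sin (y Ang s)) * V1 s) with (sg * y Mom s); trivial.
    unfold V1, V2. assert (Hcs := sin2_cos2 (y Ang s)). unfold Rsqr in Hcs.
    replace (sg * y Mom s) with (sg * y Mom s * (sin (y Ang s) * sin (y Ang s) + cos (y Ang s) * cos (y Ang s)))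
      by (rewrite Hcs; ring).
    field; lra.
Qed.

(* Affine continuation beyond the endpoints turns one-sided derivatives into two-sided ones. *)
Definition extend (a b : R) (f df : R -> R) (t : R) : R :=
  f (clip a b t) + df (clip a b t) * (t - clip a b t).

Lemma extend_eq a b f df t : a <= t <= b -> extend a b f df t = f t.
Proof. intros Ht; unfold extend; rewrite clip_id by trivial; ring. Qed.

Lemma extend_derive a b f df t : deriv_on a b f df -> a <= t <= b ->
  is_derive (extend a b f df) t (df t).
Proof.
  intros H Ht. apply is_derive_eps; intros eps He.
  destruct (H t Ht eps He) as [d0 [Hd0 Hd]].
  set (e1 := if Rlt_dec t b then b - t else 1). set (e2 := if Rlt_dec a t then t - a else 1).
  assert (He1 : 0 < e1) by (unfold e1; destruct (Rlt_dec t b); lra).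
  assert (He2 : 0 < e2) by (unfold e2; destruct (Rlt_dec a t); lra).
  exists (Rmin d0 (Rmin e1 e2)); split; [apply Rmin_glb_lt; [|apply Rmin_glb_lt]; trivial|].
  intros h Hh Hlt.
  assert (H0 := Rlt_le_trans _ _ _ Hlt (Rmin_l _ _)).
  assert (H12 := Rlt_le_trans _ _ _ Hlt (Rmin_r _ _)).
  assert (H1 := Rlt_le_trans _ _ _ H12 (Rmin_l _ _)).
  assert (H2 := Rlt_le_trans _ _ _ H12 (Rmin_r _ _)).
  rewrite (extend_eq a b f df t Ht).
  destruct (Rle_dec a (t + h)) as [Ha|Ha]; [destruct (Rle_dec (t + h) b) as [Hb|Hb]|].
  - rewrite extend_eq by lra. apply Hd; trivial. unfold in_I; lra.
  - assert (t = b).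
    { apply NNPP; intros Hne. unfold e1 in H1. destruct (Rlt_dec t b); [|lra].
      apply Rabs_lt_between in H1; lra. }
    subst t. unfold extend.
    replace (clip a b (b + h)) with b
      by (unfold clip; rewrite Rmin_left, Rmax_right; lra).
    replace ((f b + df b * (b + h - b) - f b) / h - df b) with 0 by (field; trivial).
    rewrite Rabs_R0; trivial.
  - assert (t = a).
    { apply NNPP; intros Hne. unfold e2 in H2. destruct (Rlt_dec a t); [|lra].
      apply Rabs_lt_between in H2; lra. }
    subst t. unfold extend.
    replace (clip a b (a + h)) with a
      by (unfold clip; rewrite Rmin_right, Rmax_left; lra).
    replace ((f a + df a * (a + h - a) - f a) / h - df a) with 0 by (field; trivial).
    rewrite Rabs_R0; trivial.
Qed.

Lemma extend_shift_derive T f df s : deriv_on (- T) 0 f df -> 0 <= s <= T ->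
  is_derive (fun s => extend (- T) 0 f df (s - T)) s (df (s - T)).
Proof.
  intros H Hs.
  assert (H1 := extend_derive (- T) 0 f df (s - T) H ltac:(lra)).
  evar_last.
  - apply (is_derive_comp (extend (- T) 0 f df) (fun s => s - T)); [exact H1|].
    apply (is_derive_minus (V := R_NormedModule)); [apply is_derive_id | apply is_derive_const].
  - unfold minus, plus, opp, scal, zero, one, mult; simpl; unfold mult; simpl; ring.
Qed.

(** Uniqueness concerns arbitrary rectilinear arcs, so these have to be brought into polar form.
    Vanishing angular momentum makes the direction x/|x| constant, and the radius is then the
    component of x along it. *)
Lemma polar_of_rectilinear (D : R -> R -> R) (T a al : R) (B : R * R) (x1 x2 : R -> R) :
  0 < T -> 0 < a -> arc_of_kind D T (a * cos al, a * sin al) B Rectilinear x1 x2 ->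
  exists y, polar_sol (polar_of D 1) T y /\
    y Mom 0 = 0 /\ y Ang 0 = al /\ y Rad 0 = a /\
    forall t, in_I (- T) 0 t -> x1 t = y Rad (t + T) * cos al /\ x2 t = y Rad (t + T) * sin al.
Proof.
  intros HT Ha [v1 [v2 [a1 [a2 [[Hx1 [Hx2 [Hv1 [Hv2 [_ [_ Heq]]]]]] [HA [_ [_ Hkind]]]]]]]].
  set (X1 := fun s => extend (- T) 0 x1 v1 (s - T)). set (X2 := fun s => extend (- T) 0 x2 v2 (s - T)).
  set (V1 := fun s => extend (- T) 0 v1 a1 (s - T)). set (V2 := fun s => extend (- T) 0 v2 a2 (s - T)).
  assert (Hval : forall s, 0 <= s <= T -> X1 s = x1 (s - T) /\ X2 s = x2 (s - T) /\
     V1 s = v1 (s - T) /\ V2 s = v2 (s - T)).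
  { intros s Hs; unfold X1, X2, V1, V2; rewrite !extend_eq by lra; auto. }
  assert (HdX : forall s, 0 <= s <= T -> is_derive X1 s (V1 s) /\ is_derive X2 s (V2 s) /\
     is_derive V1 s (a1 (s - T)) /\ is_derive V2 s (a2 (s - T))).
  { intros s Hs; destruct (Hval s Hs) as [_ [_ [E3 E4]]]. rewrite E3, E4.
    split; [|split; [|split]]; apply extend_shift_derive; trivial. }
  assert (HE : forall s, 0 <= s <= T -> (X1 s, X2 s) <> (0, 0) /\
     a1 (s - T) = - D (X1 s) (X2 s) * V1 s - X1 s / norm2 (X1 s) (X2 s) ^ 3 /\
     a2 (s - T) = - D (X1 s) (X2 s) * V2 s - X2 s / norm2 (X1 s) (X2 s) ^ 3 /\
     X1 s * V2 s - X2 s * V1 s = 0).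
  { intros s Hs. destruct (Hval s Hs) as [-> [-> [-> ->]]].
    assert (Hin : in_I (- T) 0 (s - T)) by (unfold in_I; lra).
    destruct (Heq _ Hin) as [Hnz [E1 E2]]. split; trivial.
    specialize (Hkind _ Hin); simpl in Hkind; unfold angmom in Hkind.
    unfold Rdiv in *. lra. }
  assert (Hunit : forall s, 0 <= s <= T ->
    X1 s = norm2 (X1 s) (X2 s) * cos al /\ X2 s = norm2 (X1 s) (X2 s) * sin al).
  { assert (H0 : X1 0 = a * cos al /\ X2 0 = a * sin al).
    { destruct (Hval 0 ltac:(lra)) as [-> [-> _]]. rewrite Rminus_0_l. injection HA; auto. }
    assert (Hn0 : norm2 (X1 0) (X2 0) = a).
    { destruct H0 as [-> ->]. rewrite <- (Rmult_1_l (a * sin al)). apply norm2_polar; lra. }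
    (* Applied to both components of x: the numerator of the derivative of Z/|x| is then a multiple
       of the angular momentum. *)
    assert (Hconst : forall (Z : R -> R) (W : R -> R), (forall s, 0 <= s <= T -> is_derive Z s (W s)) ->
      (forall s, 0 <= s <= T -> W s * (X1 s * X1 s + X2 s * X2 s) - Z s * (X1 s * V1 s + X2 s * V2 s) = 0) ->
      forall s, 0 <= s <= T -> Z s / norm2 (X1 s) (X2 s) = Z 0 / norm2 (X1 0) (X2 0)).
    { intros Z W HZ HW s Hs.
      assert (Hb : Rabs (Z s / norm2 (X1 s) (X2 s) - Z 0 / norm2 (X1 0) (X2 0)) <= 0 - 0).
      { apply (deriv_bound (fun s => Z s / norm2 (X1 s) (X2 s)) (fun _ => 0) (fun _ => 0) (fun _ => 0)); [lra|..].
        - intros u Hu. destruct (HdX u ltac:(lra)) as [D1 [D2 _]]. destruct (HE u ltac:(lra)) as [Hnz _].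
          assert (HZu := HZ u ltac:(lra)). assert (HWu := HW u ltac:(lra)).
          assert (Hn := norm2_pos _ _ Hnz). assert (Hn2 := norm2_sqr (X1 u) (X2 u)).
          unfold norm2 in *. auto_derive.
          + derive_side. nra.
          + derive_facts. set (n := sqrt (X1 u * X1 u + X2 u * X2 u)) in *.
            field_simplify; [|lra].
            replace (n ^ 2) with (X1 u * X1 u + X2 u * X2 u) by (simpl; lra).
            apply Rmult_eq_reg_r with (n ^ 3); [|apply pow_nonzero; lra].
            field_simplify; [|lra]. lra.
        - intros; apply (is_derive_const (V := R_NormedModule)).
        - intros; rewrite Rabs_R0; lra. }
      apply Rabs_le_between in Hb; lra. }
    intros s Hs. destruct (HE s Hs) as [Hnz _]. assert (Hn := norm2_pos _ _ Hnz).
    assert (C1 := Hconst X1 V1 ltac:(intros; apply HdX; trivial)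
      ltac:(intros u Hu; destruct (HE u Hu) as [_ [_ [_ Hc]]];
        replace (V1 u * (X1 u * X1 u + X2 u * X2 u) - X1 u * (X1 u * V1 u + X2 u * V2 u))
        with (- X2 u * (X1 u * V2 u - X2 u * V1 u)) by ring; rewrite Hc; ring) s Hs).
    assert (C2 := Hconst X2 V2 ltac:(intros; apply HdX; trivial)
      ltac:(intros u Hu; destruct (HE u Hu) as [_ [_ [_ Hc]]];
        replace (V2 u * (X1 u * X1 u + X2 u * X2 u) - X2 u * (X1 u * V1 u + X2 u * V2 u))
        with (X1 u * (X1 u * V2 u - X2 u * V1 u)) by ring; rewrite Hc; ring) s Hs).
    destruct H0 as [E1 E2]. rewrite Hn0, E1 in C1. rewrite Hn0, E2 in C2.
    replace (a * cos al / a) with (cos al) in C1 by (field; lra).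
    replace (a * sin al / a) with (sin al) in C2 by (field; lra).
    rewrite <- C1, <- C2. split; field; lra. }
  set (Rd := fun s => X1 s * cos al + X2 s * sin al).
  assert (Hcs := sin2_cos2 al). unfold Rsqr in Hcs.
  assert (HRd : forall s, 0 <= s <= T -> Rd s = norm2 (X1 s) (X2 s)).
  { intros s Hs. destruct (Hunit s Hs) as [E1 E2]. unfold Rd.
    set (n := norm2 (X1 s) (X2 s)) in *. rewrite E1, E2.
    replace (n * cos al * cos al + n * sin al * sin al) with (n * (sin al * sin al + cos al * cos al)) by ring.
    rewrite Hcs; ring. }
  assert (HXR : forall s, 0 <= s <= T -> X1 s = Rd s * cos al /\ X2 s = Rd s * sin al).
  { intros s Hs; rewrite HRd by trivial; auto. }
  exists (fun i s => match i with Rad => Rd s | Ang => al | Vel => V1 s * cos al + V2 s * sin al | Mom => 0 end).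
  split; [|split; [|split; [|split]]]; trivial.
  - intros s Hs. destruct (HE s Hs) as [Hnz [E1 [E2 _]]]. assert (Hn := norm2_pos _ _ Hnz).
    destruct (HXR s Hs) as [F1 F2]. rewrite <- HRd in Hn, E1, E2 by trivial.
    destruct (HdX s Hs) as [D1 [D2 [D3 D4]]].
    split; trivial. intros [ | | | ]; simpl polar_rhs.
    + unfold Rd; auto_derive; [derive_side | derive_facts; ring].
    + evar_last; [apply (is_derive_const (V := R_NormedModule))|]. unfold zero; simpl; field; lra.
    + evar_last.
      * apply (is_derive_plus (V := R_NormedModule)).
        -- apply (is_derive_scal_l (V := R_NormedModule) V1 s _ (cos al) D3).
        -- apply (is_derive_scal_l (V := R_NormedModule) V2 s _ (sin al) D4).
      * unfold plus, scal; simpl; unfold mult; simpl. rewrite E1, E2.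
        unfold polar_of. rewrite Rmult_1_l, <- F1, <- F2.
        replace (X1 s / Rd s ^ 3) with (cos al / Rd s ^ 2) by (rewrite F1; field; lra).
        replace (X2 s / Rd s ^ 3) with (sin al / Rd s ^ 2) by (rewrite F2; field; lra).
        replace (1 / (Rd s * (Rd s * 1))) with ((sin al * sin al + cos al * cos al) / Rd s ^ 2)
          by (rewrite Hcs; field; lra).
        field; lra.
    + evar_last; [apply (is_derive_const (V := R_NormedModule))|]. unfold zero; simpl; ring.
  - destruct (Hval 0 ltac:(lra)) as [E1 [E2 _]]. unfold Rd; rewrite E1, E2, Rminus_0_l.
    injection HA as -> ->.
    replace (a * cos al * cos al + a * sin al * sin al) with (a * (sin al * sin al + cos al * cos al)) by ring.
    rewrite Hcs; ring.
  - intros t Ht. unfold in_I in Ht. destruct (HXR (t + T) ltac:(lra)) as [E1 E2].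
    destruct (Hval (t + T) ltac:(lra)) as [E3 [E4 _]].
    replace (t + T - T) with t in E3, E4 by ring. rewrite <- E1, <- E2. auto.
Qed.

Lemma polar_angle (x y : R) : (x, y) <> (0, 0) ->
  exists al, 0 <= al < 2 * PI /\ x = norm2 x y * cos al /\ y = norm2 x y * sin al.
Proof.
  intros Hnz. assert (Hn := norm2_pos x y Hnz). assert (Hs := norm2_sqr x y).
  set (n := norm2 x y) in *. set (u := x / n).
  assert (Hxu : x = n * u) by (unfold u; field; lra).
  assert (Hu2 : n * n * (1 - u²) = y * y) by (unfold Rsqr; rewrite Hxu in Hs; lra).
  assert (Hu1 : u² <= 1) by (unfold Rsqr in *; assert (0 < n * n) by nra; nra).
  assert (Hu : - 1 <= u <= 1) by (unfold Rsqr in Hu1; split; nra).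
  assert (Hb := acos_bound u). assert (Hc := cos_acos u Hu). assert (Hsn := sin_acos u Hu).
  assert (Hys : n * sqrt (1 - u²) = Rabs y).
  { rewrite <- (sqrt_Rsqr n) at 1 by lra. rewrite <- sqrt_mult_alt by apply Rle_0_sqr.
    replace (n² * (1 - u²)) with (y²) by (unfold Rsqr in *; lra). apply sqrt_Rsqr_abs. }
  assert (HP := PI_RGT_0).
  destruct (Rle_dec 0 y) as [Hy|Hy].
  - exists (acos u). rewrite Hc, Hsn, Hys, Rabs_pos_eq by trivial.
    split; [lra|]. split; trivial.
  - exists (2 * PI - acos u).
    rewrite cos_minus, sin_minus, cos_2PI, sin_2PI, Hc, Hsn.
    split.
    + assert (acos u <> 0); [|lra]. intros H0. rewrite H0, cos_0 in Hc.
      rewrite <- Hc in Hu2. unfold Rsqr in Hu2. nra.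
    + rewrite Rabs_left in Hys by lra. split; lra.
Qed.

Lemma rotating_arc (D : R -> R -> R) (T sg : R) (k : rot_kind) (A B : R * R) :
  damping_hyp D -> 0 < T -> A <> (0, 0) -> B <> (0, 0) -> ~ same_ray A B ->
  (sg = 1 /\ k = Counterclockwise \/ sg = - 1 /\ k = Clockwise) ->
  exists x1 x2, arc_of_kind D T A B k x1 x2.
Proof.
  destruct A as [A1 A2], B as [B1 B2]. intros HD HT HA HB Hray Hk.
  assert (Hsg : sg * sg = 1) by (destruct Hk as [[-> _]|[-> _]]; ring).
  assert (Hrefl : forall x y, (x, y) <> (0, 0) -> exists r al, 0 < r /\ 0 <= al < 2 * PI /\
    x = r * cos al /\ y = sg * (r * sin al)).
  { intros x y Hxy.
    destruct (polar_angle x (sg * y)) as [al [Hal [E1 E2]]].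
    { intros H; apply Hxy; injection H as -> H. f_equal.
      replace y with (sg * (sg * y)) by (rewrite <- Rmult_assoc, Hsg; ring). rewrite H; ring. }
    exists (norm2 x (sg * y)), al. split; [|split; [trivial|split; trivial]].
    - apply norm2_pos. intros H; apply Hxy; injection H as -> H. f_equal.
      replace y with (sg * (sg * y)) by (rewrite <- Rmult_assoc, Hsg; ring). rewrite H; ring.
    - rewrite <- E2, <- Rmult_assoc, Hsg; ring. }
  destruct (Hrefl A1 A2 HA) as [a [al [Ha [Hal [-> ->]]]]].
  destruct (Hrefl B1 B2 HB) as [b [be [Hb [Hbe [-> ->]]]]].
  assert (Hne : al <> be).
  { intros ->. apply Hray. exists (b / a); simpl. split; [apply Rdiv_lt_0_compat; trivial|].
    split; field; lra. }
  (* The representative modulo 2 pi of the angle from A to B, counted in the sense of rotation; it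
     is not 0 because A and B lie on different rays. *)
  assert (HTh : exists Th, 0 < Th < 2 * PI /\ cos (al + Th) = cos be /\ sin (al + Th) = sin be).
  { destruct (Rlt_dec al be).
    - exists (be - al). replace (al + (be - al)) with be by ring. split; [lra | auto].
    - exists (be - al + 2 * PI). replace (al + (be - al + 2 * PI)) with (be + 2 * PI) by ring.
      rewrite cos_plus, sin_plus, cos_2PI, sin_2PI. split; [lra | split; ring]. }
  destruct HTh as [Th [HTh [Hc Hs]]].
  destruct (polar_of_damping D sg HD Hsg) as [M Hd].
  destruct (polar_rotating_arc (polar_of D sg) M a al T Hd Ha HT b Th Hb HTh)
    as [p [c [y [Hcp [Hy [Hi [HR HAn]]]]]]].
  assert (Harc := arc_of_polar D sg T k y HD Hsg HT Hy).
  rewrite HR, HAn, Hc, Hs, (Hi Rad), (Hi Ang) in Harc. simpl init in Harc.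
  eexists; eexists; apply Harc.
  - replace (al + Th - al) with Th by ring. rewrite Rabs_pos_eq; lra.
  - intros t Ht; unfold in_I in Ht.
    assert (0 < y Mom (t + T)).
    { apply (mom_pos (polar_of D sg) M Hd T); trivial; [lra|]. rewrite Hi; trivial. }
    destruct Hk as [[-> ->]|[-> ->]]; lra.
Qed.

(** Uniqueness is the strict comparison: of two rectilinear motions from the same point, the one
    with larger initial velocity ends farther out, so equal endpoints force equal initial data. *)
Lemma rectilinear_arc (D : R -> R -> R) (T : R) (A B : R * R) :
  damping_hyp D -> 0 < T -> A <> (0, 0) -> same_ray A B ->
  exists x1 x2 : R -> R, arc_of_kind D T A B Rectilinear x1 x2 /\
    forall y1 y2 : R -> R, arc_of_kind D T A B Rectilinear y1 y2 ->
      forall t, in_I (- T) 0 t -> y1 t = x1 t /\ y2 t = x2 t.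
Proof.
  destruct A as [A1 A2], B as [B1 B2]. intros HD HT HA [lam [Hlam [E1 E2]]]. simpl in E1, E2.
  destruct (polar_angle A1 A2 HA) as [al [_ [F1 F2]]].
  assert (Ha := norm2_pos _ _ HA). set (a := norm2 A1 A2) in *.
  assert (H11 : 1 * 1 = 1) by ring.
  destruct (polar_of_damping D 1 HD H11) as [M Hd].
  assert (Hb : 0 < lam * a) by (apply Rmult_lt_0_compat; trivial).
  destruct (polar_rectilinear_arc (polar_of D 1) M a al T Hd Ha HT (lam * a) Hb) as [s [y [Hy [Hi HR]]]].
  assert (Hconst := fun t Ht => rectilinear_const (polar_of D 1) M Hd T y t Hy (Hi Mom) Ht).
  assert (HA0 : y Ang 0 = al) by (rewrite Hi; reflexivity).
  assert (HAT : y Ang T = al) by (rewrite <- HA0; apply Hconst; lra).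
  assert (HR0 : y Rad 0 = a) by (rewrite Hi; reflexivity).
  assert (Harc := arc_of_polar D 1 T Rectilinear y HD H11 HT Hy).
  rewrite HR, HAT, HA0, HR0, !Rmult_1_l, <- F1, <- F2 in Harc.
  replace (lam * a * cos al) with B1 in Harc by (rewrite E1, F1; ring).
  replace (lam * a * sin al) with B2 in Harc by (rewrite E2, F2; ring).
  eexists; eexists; split; [apply Harc|].
  - rewrite Rminus_diag, Rabs_R0. generalize PI_RGT_0; lra.
  - intros t Ht; unfold in_I in Ht. destruct (Hconst (t + T)) as [-> _]; [lra | ring].
  - intros y1 y2 Hother t Ht. rewrite F1, F2 in Hother.
    assert (HB0 : y1 0 = B1 /\ y2 0 = B2).
    { destruct Hother as [v1 [v2 [a1 [a2 [_ [_ [HB _]]]]]]]. injection HB; auto. }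
    destruct (polar_of_rectilinear D T a al (B1, B2) y1 y2 HT Ha Hother)
      as [w [Hw [Wm [Wa [Wr Hwx]]]]].
    assert (HwT : w Rad T = lam * a).
    { destruct (Hwx 0) as [G1 G2]; [unfold in_I; lra|]. rewrite Rplus_0_l in G1, G2.
      destruct HB0 as [K1 K2]. rewrite K1, E1, F1 in G1. rewrite K2, E2, F2 in G2.
      assert (Hcs := sin2_cos2 al). unfold Rsqr in Hcs.
      replace (w Rad T) with (w Rad T * (sin al * sin al + cos al * cos al)) by (rewrite Hcs; ring).
      replace (lam * a) with (lam * a * (sin al * sin al + cos al * cos al)) by (rewrite Hcs; ring).
      replace (w Rad T * (sin al * sin al + cos al * cos al)) with
        (w Rad T * cos al * cos al + w Rad T * sin al * sin al) by ring.
      rewrite <- G1, <- G2; ring. }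
    assert (Hstrict : forall u z, polar_sol (polar_of D 1) T u -> polar_sol (polar_of D 1) T z ->
      u Mom 0 = 0 -> z Mom 0 = 0 -> u Ang 0 = z Ang 0 -> u Rad 0 = z Rad 0 ->
      u Rad T = z Rad T -> ~ u Vel 0 < z Vel 0).
    { intros u z Hu Hz U1 U2 U3 U4 U5 Hlt.
      assert (Hcmp := rectilinear_comparison (polar_of D 1) M Hd T u z Hu Hz U1 U2 U3 U4 Hlt T ltac:(lra)).
      assert (0 < (z Vel 0 - u Vel 0) * T * exp (- (M * T))).
      { apply Rmult_lt_0_compat; [apply Rmult_lt_0_compat; lra | apply exp_pos]. }
      lra. }
    assert (Hm0 : y Mom 0 = 0) by (rewrite Hi; reflexivity).
    assert (Hvel : w Vel 0 = y Vel 0).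
    { destruct (Rtotal_order (w Vel 0) (y Vel 0)) as [H|[H|H]]; trivial; exfalso; revert H;
      apply Hstrict; trivial; congruence. }
    assert (Hsame : forall i, w i 0 = y i 0) by (intros [ | | | ]; congruence).
    unfold in_I in Ht.
    assert (Heq := sol_unique (polar_of D 1) M Hd T w y Hw Hy Hsame Rad (t + T) ltac:(lra)).
    destruct (Hwx t Ht) as [-> ->]. destruct (Hconst (t + T)) as [_ ->]; [lra|].
    rewrite Heq, HA0. split; ring.
Qed.

Theorem theorem1p1 (D : R -> R -> R) (T : R) (A B : R * R) :
  damping_hyp D -> 0 < T -> A <> (0, 0) -> B <> (0, 0) ->
  (same_ray A B ->
     exists x1 x2 : R -> R, arc_of_kind D T A B Rectilinear x1 x2 /\
       forall y1 y2 : R -> R, arc_of_kind D T A B Rectilinear y1 y2 ->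
         forall t, in_I (- T) 0 t -> y1 t = x1 t /\ y2 t = x2 t) /\
  (~ same_ray A B ->
     (exists x1 x2 : R -> R, arc_of_kind D T A B Clockwise x1 x2) /\
     (exists x1 x2 : R -> R, arc_of_kind D T A B Counterclockwise x1 x2)).
Proof.
  intros HD HT HA HB; split.
  - intros Hray; apply rectilinear_arc; trivial.
  - intros Hray; split.
    + apply (rotating_arc D T (- 1)); auto.
    + apply (rotating_arc D T 1); auto.
Qed.
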